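(* Let $(M,\alpha,\omega_1,\omega_2,\omega_3)$ be a contact-Hypo $5$-manifold. Assume that the Ricci tensor of the metric $g$ induced by the structure satisfies $\mathrm{Ric}(R_\alpha,R_\alpha)=4$. Then $(M,\alpha,\omega_1,\omega_2,\omega_3)$ is Sasaki $\alpha$-Einstein (i.e. it is Sasakian and $g$ is $\alpha$-Einstein).
   Context: An $\mathrm{SU}(2)$-structure on a smooth $5$-manifold $M$ is a reduction of the frame bundle to $\mathrm{SU}(2)$; equivalently, a quadruple $(\alpha,\omega_1,\omega_2,\omega_3)$ with $\alpha$ a nowhere vanishing $1$-form and $\omega_1,\omega_2,\omega_3$ $2$-forms with $\omega_i\wedge\omega_j=\delta_{ij}v$ for a $4$-form $v$ with $v\wedge\alpha\ne0$ everywhere, and such that $\iota_X\omega_1=\iota_Y\omega_2$ implies $\omega_3(X,Y)\ge 0$. Near each point there are adapted coframes $e^1,\dots,e^5$ with $\alpha=e^5$, $\omega_1=e^{12}+e^{34}$, $\omega_2=e^{13}-e^{24}$, $\omega_3=e^{14}+e^{23}$ (where $e^{ij}=e^i\wedge e^j$). The induced Riemannian metric is $g=\sum_{i=1}^5 e^i\otimes e^i=g^T+\alpha\otimes\alpha$, with $g^T=\sum_{i=1}^4e^i\otimes e^i$. The Reeb field $R_\alpha$ is defined by $\alpha(R_\alpha)=1$, $\iota_{R_\alpha}\omega_1=0$. The endomorphism $J_1$ of $TM$ is given by $J_1R_\alpha=0$ and, on $\ker\alpha$, by $\omega_1(X,J_1Y)=g^T(X,Y)$ (so $J_1e_1=e_2$,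 $J_1e_3=e_4$ in the dual frame). The structure is contact-Hypo if $d\alpha=-2\omega_1$, $d(\alpha\wedge\omega_2)=0$ and $d(\alpha\wedge\omega_3)=0$. Sasakian: on the cone $C(M)=M\times\mathbb{R}^+_t$ consider $\kappa=t^2\omega_1+t\,\alpha\wedge dt$ and the almost complex structure $\widetilde J$ with $\widetilde JX=J_1X$ for $X\in\ker\alpha$ and $\widetilde JR_\alpha=t\,\partial/\partial t$. The structure is Sasakian if $(C(M),\kappa,\widetilde J)$ is Kähler. $\alpha$-Einstein: $g$ is $\alpha$-Einstein if the component $\mathrm{Ric}_0$ vanishes in the decomposition $\mathrm{Ric}=\frac{\lambda}{4}g^T+\mu\,\alpha\otimes\alpha+\mathrm{Ric}_0$, where $\lambda$ is the $g^T$-trace of $\mathrm{Ric}$ restricted to $\ker\alpha$ and $\mu=\mathrm{Ric}(R_\alpha,R_\alpha)$; that is, if $\mathrm{Ric}=\frac{\lambda}{4}g^T+\mu\,\alpha\otimes\alpha$. *)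

(* Defs.v *)
From HB Require Import structures.
From mathcomp Require Import all_boot all_order all_fingroup all_algebra.
From mathcomp Require Import all_classical all_reals.
From mathcomp Require Import topology normedtype derive.

Set Implicit Arguments.
Unset Strict Implicit.
Unset Printing Implicit Defensive.
Import Order.TTheory GRing.Theory Num.Theory.
Import numFieldNormedType.Exports.
Local Open Scope classical_set_scope.
Local Open Scope ring_scope.

Definition eq_on (T U : Type) (A : set T) (f h : T -> U) : Prop :=
  forall x, A x -> f x = h x.

Section Local.
Variable R : realType.

(* C^oo on an open set U of a finite-dimensional space: all the iterated
   directional derivatives along constant vectors exist and are continuous. *)
Definition iter_derive (E F : normedModType R) (s : seq E) (f : E -> F) :
    E -> F :=
  foldr (fun v h => fun x => 'D_v h x) f s.

Definition smooth_on (E F : normedModType R) (U : set E) (f : E -> F) : Prop :=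
  forall (s : seq E) x, U x ->
    {for x, continuous (iter_derive s f)} /\
    (forall v, derivable (iter_derive s f) x v).

(* Covariant k-tensor fields on (open subsets of) the vector space E: the
   tangent space at each point is identified with E.  A form is an alternating
   such field. *)
Definition tensor (E : normedModType R) (k : nat) := E -> k.-tuple E -> R.

Section Tensors.
Variable E : normedModType R.
Implicit Types (U : set E) (x : E).

Definition tset k (v : k.-tuple E) (i : 'I_k) (u : E) : k.-tuple E :=
  [tuple (if j == i then u else tnth v j) | j < k].

Definition multilinear k (T : k.-tuple E -> R) : Prop :=
  forall (v : k.-tuple E) i (a : R) (u w : E),
    T (tset v i (a *: u + w)) = a * T (tset v i u) + T (tset v i w).

Definition alternating k (T : k.-tuple E -> R) : Prop :=
  forall (v : k.-tuple E) i j, i != j -> tnth v i = tnth v j -> T v = 0.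

Definition smooth_tensor_on U k (T : tensor E k) : Prop :=
  (forall x, U x -> multilinear (T x)) /\
  (forall v, smooth_on U (fun x => T x v)).

Definition smooth_form_on U k (T : tensor E k) : Prop :=
  smooth_tensor_on U T /\ (forall x, U x -> alternating (T x)).

Definition smooth_endo_on U (J : E -> E -> E) : Prop :=
  (forall x, U x -> forall (a : R) u w, J x (a *: u + w) = a *: J x u + J x w) /\
  (forall v, smooth_on U (fun x => J x v)).

Definition otimes p q (a : tensor E p) (b : tensor E q) : tensor E (p + q) :=
  fun x v => a x [tuple tnth v (lshift q i) | i < p] *
             b x [tuple tnth v (rshift p i) | i < q].

(* Normalised so that (a /\ b)(u, w) = a(u) b(w) - a(w) b(u) on 1-forms. *)
Definition wedge p q (a : tensor E p) (b : tensor E q) : tensor E (p + q) :=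
  fun x v => ((p`! * q`!)%:R)^-1 *
    \sum_(s : 'S_(p + q))
      (-1) ^+ s * otimes a b x [tuple tnth v (s i) | i < p + q].

(* Exterior derivative, evaluated on constant vector fields (so that the terms
   with Lie brackets vanish); no 1/(k+1) factor, consistently with wedge. *)
Definition extd k (a : tensor E k) : tensor E k.+1 :=
  fun x v => \sum_(j < k.+1)
    (-1) ^+ j * 'D_(tnth v j) (fun y => a y [tuple tnth v (lift j i) | i < k]) x.

Definition lie_bracket (X Y : E -> E) : E -> E :=
  fun x => 'D_(X x) Y x - 'D_(Y x) X x.

(* N_J(u, w) at x; N_J is a tensor, hence can be computed by extending u and w
   to constant vector fields. *)
Definition nijenhuis (J : E -> E -> E) (x u w : E) : E :=
  let Ju y := J y u in let Jw y := J y w in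
  lie_bracket Ju Jw x - J x (lie_bracket Ju (cst w) x)
  - J x (lie_bracket (cst u) Jw x) - lie_bracket (cst u) (cst w) x.

(* The Riemannian metric associated with (kappa, J) is kappa(., J .). *)
Definition kahler_on U (kappa : tensor E 2) (J : E -> E -> E) : Prop :=
  [/\ smooth_form_on U kappa /\ smooth_endo_on U J,
      eq_on U (extd kappa) 0,
      (forall x, U x -> forall u, J x (J x u) = - u),
      (forall x, U x -> forall u w, nijenhuis J x u w = 0) &
      (forall x, U x ->
        (forall u w, kappa x [tuple u; J x w] = kappa x [tuple w; J x u]) /\
        (forall u, u != 0 -> 0 < kappa x [tuple u; J x u]))].

End Tensors.

Section Ricci.
Variable n : nat.
Local Notation E := 'rV[R]_n.+1.
Variable g : tensor E 2.

Definition ebase (i : 'I_n.+1) : E := delta_mx 0 i.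
Definition partial (i : 'I_n.+1) (f : E -> R) (x : E) : R := 'D_(ebase i) f x.

Definition gram (x : E) : 'M[R]_n.+1 :=
  \matrix_(i, j) g x [tuple ebase i; ebase j].

(* christoffel k i j = Gamma^k_{ij} of the Levi-Civita connection of g. *)
Definition christoffel (k i j : 'I_n.+1) (x : E) : R :=
  2^-1 * \sum_l invmx (gram x) k l *
    (partial i (fun y => gram y j l) x + partial j (fun y => gram y i l) x
     - partial l (fun y => gram y i j) x).

(* riemann l k i j is the l-th component of R(d_i, d_j) d_k, with
   R(X, Y) Z = D_X D_Y Z - D_Y D_X Z - D_[X,Y] Z. *)
Definition riemann (l k i j : 'I_n.+1) (x : E) : R :=
  partial i (christoffel l j k) x - partial j (christoffel l i k) x
  + \sum_m (christoffel l i m x * christoffel m j k x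
            - christoffel l j m x * christoffel m i k x).

(* Ric(Y, Z) = trace of X |-> R(X, Y) Z: positive on round spheres. *)
Definition ricci (x u w : E) : R :=
  \sum_j \sum_k u 0 j * w 0 k * \sum_i riemann i k i j x.

End Ricci.
End Local.

Section Manifolds.
Variable R : realType.

(* cmap and cinv are total functions; only their restrictions to cdom and to
   the open image of cdom are meaningful. *)
Record chart (E : normedModType R) (M : topologicalType) := Chart {
  cdom : set M;
  cmap : M -> E;
  cinv : E -> M;
  cdom_open : open cdom;
  cimg_open : open (cmap @` cdom);
  cmapK : {in cdom, cancel cmap cinv};
  cmap_continuous : {in cdom, continuous cmap};
  cinv_continuous : {in cmap @` cdom, continuous cinv}
}.

Definition cimg E M (c : chart E M) : set E := cmap c @` cdom c.

Definition overlap E M (c d : chart E M) : set E :=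
  cmap c @` (cdom c `&` cdom d).

Definition transition E M (c d : chart E M) : E -> E := cmap d \o cinv c.

Record manifold (E : normedModType R) (M : topologicalType) := Manifold {
  atlas : set (chart E M);
  manifold_hausdorff : hausdorff_space M;
  manifold_second_countable : @second_countable M;
  atlas_cover : forall p : M, exists2 c, atlas c & cdom c p;
  atlas_compatible : forall c d, atlas c -> atlas d ->
    smooth_on (overlap c d) (transition c d)
}.

Section Fields.
Variables (E : normedModType R) (M : topologicalType) (A : manifold E M).

(* A field on M is the family of its expressions in the charts of the atlas,
   subject to the transformation law on overlaps. *)
Definition tensor_field k := chart E M -> tensor E k.
Definition vector_field := chart E M -> E -> E.
Definition endo_field := chart E M -> E -> E -> E.

Definition is_form k (T : tensor_field k) : Prop :=
  (forall c, atlas A c -> smooth_form_on (cimg c) (T c)) /\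
  (forall c d, atlas A c -> atlas A d -> forall x, overlap c d x ->
    forall v, T c x v =
      T d (transition c d x)
        [tuple 'd (transition c d) x (tnth v i) | i < k]).

Definition is_vector_field (X : vector_field) : Prop :=
  (forall c, atlas A c -> smooth_on (cimg c) (X c)) /\
  (forall c d, atlas A c -> atlas A d -> forall x, overlap c d x ->
    X d (transition c d x) = 'd (transition c d) x (X c x)).

Definition is_endo_field (J : endo_field) : Prop :=
  (forall c, atlas A c -> smooth_endo_on (cimg c) (J c)) /\
  (forall c d, atlas A c -> atlas A d -> forall x, overlap c d x ->
    forall v, J d (transition c d x) ('d (transition c d) x v) =
              'd (transition c d) x (J c x v)).

End Fields.

Section SU2.
Variable M : topologicalType.
Local Notation E := 'rV[R]_5.
Variable A : manifold E M.
Variables (alpha : tensor_field E M 1) (w1 w2 w3 : tensor_field E M 2).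

Definition SU2_structure : Prop :=
  [/\ is_form A alpha, is_form A w1, is_form A w2 & is_form A w3] /\
  (forall c x, atlas A c -> cimg c x -> alpha c x <> 0) /\
  (exists v : tensor_field E M 4, is_form A v /\
    forall c, atlas A c ->
      (let w := [tuple w1 c; w2 c; w3 c] in
       forall i j : 'I_3, eq_on (cimg c)
         (wedge (tnth w i) (tnth w j)) ((i == j)%:R *: v c)) /\
      (forall x, cimg c x -> wedge (v c) (alpha c) x <> 0)) /\
  (forall c x, atlas A c -> cimg c x -> forall X Y : E,
    (forall Z, w1 c x [tuple X; Z] = w2 c x [tuple Y; Z]) ->
    0 <= w3 c x [tuple X; Y]).

Definition contact_hypo : Prop :=
  forall c, atlas A c ->
  [/\ eq_on (cimg c) (extd (alpha c)) (- 2 *: w1 c),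
      eq_on (cimg c) (extd (wedge (alpha c) (w2 c))) 0 &
      eq_on (cimg c) (extd (wedge (alpha c) (w3 c))) 0].

Definition adapted_coframe (c : chart E M) (V : set E)
    (e1 e2 e3 e4 e5 : tensor E 1) : Prop :=
  [/\ smooth_form_on V e1, smooth_form_on V e2, smooth_form_on V e3,
      smooth_form_on V e4 & smooth_form_on V e5] /\
  (forall x, V x -> forall u : E,
    e1 x [tuple u] = 0 -> e2 x [tuple u] = 0 -> e3 x [tuple u] = 0 ->
    e4 x [tuple u] = 0 -> e5 x [tuple u] = 0 -> u = 0) /\
  [/\ eq_on V (alpha c) e5,
      eq_on V (w1 c) (wedge e1 e2 + wedge e3 e4),
      eq_on V (w2 c) (wedge e1 e3 - wedge e2 e4) &
      eq_on V (w3 c) (wedge e1 e4 + wedge e2 e3)].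

Definition induced_metric (g : tensor_field E M 2) : Prop :=
  forall c x, atlas A c -> cimg c x ->
  exists V e1 e2 e3 e4 e5,
    [/\ open V, V x, V `<=` cimg c,
        adapted_coframe c V e1 e2 e3 e4 e5 &
        eq_on V (g c) (otimes e1 e1 + otimes e2 e2 + otimes e3 e3 +
                       otimes e4 e4 + otimes e5 e5)].

Definition transverse_metric (g : tensor_field E M 2) : tensor_field E M 2 :=
  fun c => g c - otimes (alpha c) (alpha c).

Definition reeb_field (xi : vector_field E M) : Prop :=
  is_vector_field A xi /\
  forall c x, atlas A c -> cimg c x ->
    alpha c x [tuple xi c x] = 1 /\ (forall Z, w1 c x [tuple xi c x; Z] = 0).

Definition transverse_J1 (g : tensor_field E M 2) (xi : vector_field E M)
    (J1 : endo_field E M) : Prop :=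
  is_endo_field A J1 /\
  forall c x, atlas A c -> cimg c x ->
    [/\ J1 c x (xi c x) = 0,
        (forall Y, alpha c x [tuple Y] = 0 -> alpha c x [tuple J1 c x Y] = 0) &
        (forall X Y, alpha c x [tuple X] = 0 -> alpha c x [tuple Y] = 0 ->
          w1 c x [tuple X; J1 c x Y] = transverse_metric g c x [tuple X; Y])].

(* The charts c x id, c in the atlas of M, form an atlas of the cone; the model
   space is E * R and a tangent vector is (X, s), meaning X + s d/dt. *)
Definition cone_img (c : chart E M) : set (E * R) := cimg c `*` [set t | 0 < t].

Definition pullback_fst k (T : tensor E k) : tensor (E * R)%type k :=
  fun y v => T y.1 [tuple (tnth v i).1 | i < k].

Definition cone_dt : tensor (E * R)%type 1 := fun y v => (tnth v 0).2.

Definition cone_form (c : chart E M) : tensor (E * R)%type 2 :=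
  fun y v => y.2 ^+ 2 * pullback_fst (w1 c) y v
             + y.2 * wedge (pullback_fst (alpha c)) cone_dt y v.

(* The almost complex structure equal to J1 on ker alpha and sending the Reeb
   field xi to t d/dt, hence t d/dt to - xi. *)
Definition cone_J (xi : vector_field E M) (J1 : endo_field E M)
    (c : chart E M) : E * R -> E * R -> E * R :=
  fun y u => let a := alpha c y.1 [tuple u.1] in
    (J1 c y.1 (u.1 - a *: xi c y.1) - (u.2 / y.2) *: xi c y.1, a * y.2).

Definition sasakian (xi : vector_field E M) (J1 : endo_field E M) : Prop :=
  forall c, atlas A c -> kahler_on (cone_img c) (cone_form c) (cone_J xi J1 c).

(* lambda is the g^T-trace of Ric on ker alpha, computed in a g^T-orthonormal
   basis f of ker alpha. *)
Definition transverse_ricci_trace (g : tensor_field E M 2) (c : chart E M)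
    (x : E) (lambda : R) : Prop :=
  exists f : 'I_4 -> E,
    [/\ (forall i, alpha c x [tuple f i] = 0),
        (forall i j, transverse_metric g c x [tuple f i; f j] = (i == j)%:R) &
        lambda = \sum_i ricci (g c) x (f i) (f i)].

Definition alpha_einstein (g : tensor_field E M 2) (xi : vector_field E M) :
    Prop :=
  forall c x, atlas A c -> cimg c x ->
  exists2 lambda, transverse_ricci_trace g c x lambda &
    let mu := ricci (g c) x (xi c x) (xi c x) in
    forall X Y : E, ricci (g c) x X Y =
      lambda / 4 * transverse_metric g c x [tuple X; Y]
      + mu * otimes (alpha c) (alpha c) x [tuple X; Y].

End SU2.
End Manifolds.

(* Main.v *)
Require Import Defs.
From HB Require Import structures.
From mathcomp Require Import all_boot all_order all_fingroup all_algebra.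
From mathcomp Require Import all_classical all_reals.
From mathcomp Require Import topology normedtype derive.
From mathcomp Require Import ring lra.
Set Implicit Arguments.
Unset Strict Implicit.
Unset Printing Implicit Defensive.
Import Order.TTheory GRing.Theory Num.Theory.
Import numFieldNormedType.Exports.
Local Open Scope classical_set_scope.
Local Open Scope ring_scope.

(** The statement is local, so fix an adapted coframe e^0, ..., e^4 with
e^4 = alpha (indices run from 0 to 4 throughout, and the first four are called
horizontal), the dual frame E_0, ..., E_4 with E_4 = xi the Reeb field, and the
Levi-Civita connection forms A_ab, determined by de^a = - A_ab /\ e^b and
A_ab = - A_ba.  Everything is then an identity between the functions
A_ab(E_c), their derivatives, and the constant coefficients of
omega_1, omega_2, omega_3.

The first step shows that xi is a Killing field.  The equation
d alpha = -2 omega_1 says that the skew part of nabla xi is the matrix W_1 of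
omega_1, so that nabla xi = W_1 + S with S symmetric.  Since omega_1 is exact
it is closed, and contracting d omega_1 = 0 with omega_1 gives tr S = 0
(shape_trace0).  The Reeb field is geodesic and divergence free, so the
derivative terms of Ric(xi, xi) vanish and
Ric(xi, xi) = - tr((nabla xi)^2) = 4 - |S|^2 (shape_square).  The hypothesis
Ric(xi, xi) = 4 forces S = 0 (shape_rigid), that is, nabla xi = - J_1.

The second step determines the part of the connection that acts on the span of
omega_1, omega_2, omega_3.  Because iota_xi d alpha = 0, the equations
d(alpha /\ omega_i) = 0, i = 2, 3, say exactly that d omega_i vanishes on
horizontal vectors (wedge_alpha_frame).  Together with d omega_1 = 0 they give
A_02 = A_13, A_03 = - A_12 and A_01 + A_23 = f alpha for a function f
(transverse_kahler_horizontal, transverse_kahler_vertical): transversally,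
omega_1 is parallel and omega_2 + i omega_3 is rotated by f alpha only.

Both conclusions follow.  The covariant derivative of J_1 is
(nabla_u J_1) v = g(u, v) xi - alpha(v) u (derive_J), which makes the almost
complex structure of the cone parallel for the Levi-Civita connection of the
cone metric (derive_cone_endo); an almost complex structure that is parallel
for a torsion-free connection has vanishing Nijenhuis tensor
(nijenhuis_torsion_free), and kappa is closed because d alpha = -2 omega_1
(cone_form_closed).  Differentiating the relations between the A_ab expresses
the curvature contracted with omega_1, omega_2, omega_3 through f and the
omega_i (curv_W1, curv_W2, curv_W3); the first Bianchi identity then yields
Ric = (2 - 2 f) g^T + 4 alpha (x) alpha (ricci_alpha_einstein).

Relating these computations to the Christoffel symbols takes a gauge
transformation: if d theta = theta Gamma - A theta, then symmetry of second
derivatives gives theta R = Omega theta for the two curvatures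
(gauge_curvature).  The calculus behind it (products, quotients, linearity and
symmetry of iterated directional derivatives) is built on the mean value
theorem. *)

(** * Smooth functions and their directional derivatives *)

Section Smooth.
Variable R : realType.
Implicit Types E F G : normedModType R.

Definition cont_derivable_on E F (U : set E) (f : E -> F) : Prop :=
  forall x, U x -> {for x, continuous f} /\ forall v, derivable f x v.

(** Smoothness quantifies over all sequences of directions at once, which gives
no induction hypothesis for products: a derivative of f *: h is a sum of
products of derivatives of lower order.  Bounding the order makes closure
properties provable by induction on n. *)
Fixpoint Ck (n : nat) E F (U : set E) (f : E -> F) : Prop :=
  cont_derivable_on U f /\ (if n is m.+1 then forall v, Ck m U ('D_v f) else True).

Lemma smooth_onD E F (U : set E) (f : E -> F) v :
  smooth_on U f -> smooth_on U ('D_v f).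
Proof.
move=> sf s x Ux; have := sf (rcons s v) x Ux.
by rewrite /iter_derive foldr_rcons.
Qed.

Lemma smooth_onP E F (U : set E) (f : E -> F) :
  smooth_on U f <-> forall n, Ck n U f.
Proof.
split=> [sf n|].
  elim: n f sf => [|n IHn] f sf; split=> //; try by move=> x /(sf [::]).
  by move=> v; apply: IHn; apply: smooth_onD.
move=> + s; elim/last_ind: s f => [|s v IHs] f cf x Ux.
  by have [/(_ x Ux)] := cf 0.
rewrite /iter_derive foldr_rcons; apply: IHs => // n.
by have [_ /(_ v)] := cf n.+1.
Qed.

Lemma CkW n E F (U : set E) (f : E -> F) : Ck n.+1 U f -> Ck n U f.
Proof.
elim: n f => [|n IHn] f [cf df]; first by split.
by split=> // v; apply/IHn/df.
Qed.

Lemma near_eq_on E F (U : set E) (f h : E -> F) x :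
  open U -> eq_on U f h -> U x -> \near x, f x = h x.
Proof.
move=> oU fh Ux.
by near=> y; apply: fh; near: y; exact: open_nbhs_nbhs.
Unshelve. all: by end_near. Qed.

Lemma derive_eq_on E F (U : set E) (f h : E -> F) v x :
  open U -> eq_on U f h -> U x -> 'D_v f x = 'D_v h x.
Proof. by move=> oU fh Ux; apply/near_eq_derive/(near_eq_on oU). Qed.

Lemma cont_derivable_eq_on E F (U : set E) (f h : E -> F) :
  open U -> eq_on U f h -> cont_derivable_on U f -> cont_derivable_on U h.
Proof.
move=> oU fh cf x Ux; have [c d] := cf x Ux; split.
  rewrite /prop_for /continuous_at -(fh _ Ux).
  by apply: cvg_trans c; apply/near_eq_cvg/(near_eq_on oU).
by move=> v; apply: near_eq_derivable (d v); exact: (near_eq_on oU).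
Qed.

Lemma Ck_eq n E F (U : set E) (f h : E -> F) :
  open U -> eq_on U f h -> Ck n U f -> Ck n U h.
Proof.
move=> oU; elim: n f h => [|n IHn] f h fh [cf df]; split=> //;
  try exact: (cont_derivable_eq_on oU fh).
by move=> v; apply: IHn (df v) => x Ux; exact: (derive_eq_on _ oU).
Qed.

Lemma Ck_cst n E F (U : set E) (a : F) : open U -> Ck n U (fun _ => a).
Proof.
have cd (b : F) : cont_derivable_on U (fun _ => b).
  move=> x Ux; split; first exact: cst_continuous.
  by move=> v; exact: derivable_cst.
move=> oU; elim: n a => [|n IHn] a; split=> // v.
by apply: (Ck_eq _ _ (IHn 0)) => // x Ux; rewrite derive_cst.
Qed.

Lemma Ck_add n E F (U : set E) (f h : E -> F) : open U ->
  Ck n U f -> Ck n U h -> Ck n U (fun x => f x + h x).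
Proof.
move=> oU; elim: n f h => [|n IHn] f h [cf df] [ch dh].
  split=> // x Ux; have [c d] := cf x Ux; have [c' d'] := ch x Ux.
  by split=> [|v]; [exact: continuousD|exact: derivableD].
split=> [x Ux|v].
  have [c d] := cf x Ux; have [c' d'] := ch x Ux.
  by split=> [|v]; [exact: continuousD|exact: derivableD].
apply: (Ck_eq oU _ (IHn _ _ (df v) (dh v))) => x Ux.
have [_ d] := cf x Ux; have [_ d'] := ch x Ux.
by rewrite -deriveD.
Qed.

(** Leibniz rule for directional derivatives.  Only differentiability along the
line x + R v is available, so continuity of the first factor is used along that
line. *)
Lemma is_derive_scale E F (f : E -> R) (h : E -> F) x v :
  derivable f x v -> derivable h x v ->
  is_derive x v (fun y => f y *: h y) ('D_v f x *: h x + f x *: 'D_v h x).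
Proof.
move=> df dh.
set D := fun k : R => k^-1 *: (((fun y => f y *: h y) \o shift x) (k *: v)
   - f x *: h x).
suff H : D @ 0^' --> 'D_v f x *: h x + f x *: 'D_v h x.
  apply: DeriveDef; first by apply/cvg_ex; eexists; exact: H.
  exact: (cvg_lim _ H).
have -> : D = fun k : R => (k^-1 *: ((f \o shift x) (k *: v) - f x)) *: h x +
   f (k *: v + x) *: (k^-1 *: ((h \o shift x) (k *: v) - h x)).
  apply/funext=> k; rewrite /D /=.
  set a := f (k *: v + x); set b := h (k *: v + x).
  rewrite scalerA mulrC -!scalerA -scalerDr; congr (_ *: _).
  by rewrite scalerBl scalerBr [RHS]addrC subrKA.
apply: cvgD; first exact: cvgZr_tmp df.
apply: cvgZ; last exact: dh.
have /derivable1P/derivable1_diffP/differentiable_continuous := df.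
rewrite /prop_for /continuous_at /= scale0r add0r => H.
by apply: cvg_trans H; apply: cvg_app; exact: cvg_within.
Qed.

Lemma Ck_scale n E F (U : set E) (f : E -> R) (h : E -> F) : open U ->
  Ck n U f -> Ck n U h -> Ck n U (fun x => f x *: h x).
Proof.
have cd (f' : E -> R) (h' : E -> F) : cont_derivable_on U f' ->
    cont_derivable_on U h' -> cont_derivable_on U (fun x => f' x *: h' x).
  move=> cf ch x Ux; have [c d] := cf x Ux; have [c' d'] := ch x Ux.
  split=> [|v]; first exact: continuousZ.
  by have [] := is_derive_scale (d v) (d' v).
move=> oU; elim: n f h => [|n IHn] f h Cf Ch; have [cf df] := Cf; have [ch dh] := Ch.
  by split=> //; apply: cd.
split=> [|v]; first exact: cd.
apply: (@Ck_eq n _ _ U (fun x => 'D_v f x *: h x + f x *: 'D_v h x)) => //.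
  move=> x Ux; have [_ d] := cf x Ux; have [_ d'] := ch x Ux.
  by have [_ ->] := is_derive_scale (d v) (d' v).
by apply: Ck_add => //; apply: IHn; first [exact: CkW | exact: df | exact: dh].
Qed.

(** The derivative of 1/f is - f^-2 D_v f, in which 1/f occurs again; the
induction hypothesis at the lower order covers that occurrence. *)
Lemma Ck_inv n E (U : set E) (f : E -> R) : open U ->
  (forall x, U x -> f x != 0) ->
  Ck n U f -> Ck n U (fun x => (f x)^-1).
Proof.
move=> oU f0.
have cd : cont_derivable_on U f -> cont_derivable_on U (fun x => (f x)^-1).
  move=> cf x Ux; have [c d] := cf x Ux.
  split=> [|v]; last by apply: derivableV => //; exact: f0.
  by apply: cvgV => //; exact: f0.
elim: n => [|n IHn] Cf; have [cf df] := Cf; first by split=> //; apply: cd.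
split=> [|v]; first exact: cd.
apply: (@Ck_eq n _ _ U (fun x => (-1) *: ((f x)^-1 *: ((f x)^-1 *: 'D_v f x)))) => //.
  move=> x Ux; have [_ d] := cf x Ux.
  rewrite (deriveV (f0 _ Ux) (d v)).
  by rewrite scalerA scaleN1r scaleNr expr2 invfM.
have If : Ck n U (fun x => (f x)^-1) by apply: IHn; exact: CkW.
apply: Ck_scale => //; first exact: Ck_cst.
by apply: Ck_scale => //; apply: Ck_scale => //; exact: df.
Qed.

Lemma is_derive_linear E F G (f : E -> F) (L : {linear F -> G}) x v :
  continuous L -> derivable f x v -> is_derive x v (L \o f) (L ('D_v f x)).
Proof.
move=> cL df.
set D := fun k : R => k^-1 *: (((L \o f) \o shift x) (k *: v) - (L \o f) x).
suff H : D @ 0^' --> L ('D_v f x).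
  apply: DeriveDef; first by apply/cvg_ex; eexists; exact: H.
  exact: (cvg_lim _ H).
have -> : D = L \o fun k : R => (k^-1 *: ((f \o shift x) (k *: v) - f x)).
  apply/funext=> k; rewrite /D /= [RHS]linearZ_LR; congr (_ *: _).
  by rewrite [RHS]linearB.
by apply: (cvg_comp _ _ df); exact: cL.
Qed.

Lemma Ck_linear n E F G (U : set E) (f : E -> F) (L : {linear F -> G}) :
  continuous L -> open U -> Ck n U f -> Ck n U (L \o f).
Proof.
move=> cL oU.
have cd (h : E -> F) : cont_derivable_on U h -> cont_derivable_on U (L \o h).
  move=> ch x Ux; have [c d] := ch x Ux; split=> [|v].
    by apply: continuous_comp => //; exact: cL.
  by have [] := is_derive_linear cL (d v).
elim: n f => [|n IHn] f [cf df]; first by split=> //; apply: cd.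
split=> [|v]; first exact: cd.
apply: (Ck_eq oU _ (IHn _ (df v))) => x Ux; have [_ d] := cf x Ux.
by have [_ ->] := is_derive_linear cL (d v).
Qed.
End Smooth.

Section SecondOrder.
Variables (R : realType) (E : normedModType R).
Implicit Types (f : E -> R) (U : set E).

Lemma is_derive_line f x v (s : R) : derivable f (s *: v + x) v ->
  is_derive s 1 (fun r : R => f (r *: v + x)) ('D_v f (s *: v + x)).
Proof.
have e : (fun h : R => h^-1 *: (((fun r : R => f (r *: v + x)) \o shift s) (h *: 1)
    - f (s *: v + x))) =
  (fun h : R => h^-1 *: ((f \o shift (s *: v + x)) (h *: v) - f (s *: v + x))).
  by apply/funext=> h /=; rewrite [h%:A]mulr1 scalerDl addrA.
by move=> d; apply: DeriveDef; rewrite /derive /derivable e.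
Qed.

Lemma mvt_zero (p dp : R -> R) (h : R) : 0 < h ->
  (forall s : R, 0 <= s <= h -> is_derive s 1 p (dp s)) ->
  exists2 c : R, 0 <= c <= h & p h - p 0 = h * dp c.
Proof.
move=> h0 dpE; have [|| c] := @MVT R p dp 0 h h0.
- by move=> s; rewrite in_itv /= => /andP[a b]; apply: dpE; rewrite !ltW.
- apply: derivable_within_continuous => s; rewrite in_itv /= => sh.
  by have [] := dpE s sh.
- rewrite in_itv /= subr0 mulrC => /andP[a b] ->.
  by exists c => //; rewrite !ltW.
Qed.

(** Mean value arguments in the two directions u and v stay inside a small
parallelogram based at x. *)
Lemma near_plane (P : E -> Prop) x u v : (\near x, P x) ->
  exists2 d : R, 0 < d & forall a b : R, 0 <= a <= d -> 0 <= b <= d ->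
    P (a *: u + (b *: v + x)).
Proof.
move=> /nbhs_normP[r /= r0 rP].
(* Moving by at most r / 2 / k in each direction moves x by at most r / 2; the
   summand 1 keeps k positive when u = v = 0. *)
set k := `|u| + `|v| + 1.
have k0 : 0 < k by rewrite /k; have := normr_ge0 u; have := normr_ge0 v; lra.
exists (r / 2 / k); first by rewrite !divr_gt0.
move=> a b /andP[a0 ar] /andP[b0 br]; apply: rP => /=.
rewrite addrA addrC opprD addrA subrr sub0r normrN.
apply: (@le_lt_trans _ _ (r / 2)); last by lra.
apply: le_trans (ler_normD _ _) _; rewrite !normrZ !ger0_norm //.
have -> : r / 2 = r / 2 / k * `|u| + r / 2 / k * `|v| + r / 2 / k.
  by rewrite -mulrDr -[X in _ = _ + X]mulr1 -mulrDr -/k divfK ?gt_eqF.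
rewrite -[leLHS]addr0 !lerD ?ler_wpM2r //.
by rewrite !divr_ge0 // ltW.
Qed.

Lemma eq_of_dist_le (a b : R) : (forall e, 0 < e -> `|a - b| <= e) -> a = b.
Proof.
move=> H; apply/eqP; rewrite -subr_eq0 -normr_le0; apply/ler_addgt0Pr => e e0; rewrite add0r.
by apply: H.
Qed.

Lemma derivable_of_cd U f : cont_derivable_on U f ->
  forall x v, U x -> derivable f x v.
Proof. by move=> cf x v /cf[]. Qed.

(** Additivity in the direction fails for merely Gateaux-differentiable
functions.  With continuous first derivatives, the increment along u + v is
split into an increment along v followed by one along u, and each is a
directional derivative at a nearby point by the mean value theorem. *)
Lemma deriveDr U f x u v : open U -> U x -> Ck 1 U f ->
  'D_(u + v) f x = 'D_u f x + 'D_v f x.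
Proof.
move=> oU Ux [cf df]; apply: eq_of_dist_le => e e0.
have dU := derivable_of_cd cf.
have duv := dU x (u + v) Ux.
have /cvgrPdist_lt/(_ (e / 4))[] := duv; first by rewrite divr_gt0.
move=> d0 /= d0_gt0 Hd0.
have cuv w : {for x, continuous ('D_w f)}.
  by have [/(_ x Ux) []] := df w.
have /cvgrPdist_lt/(_ (e / 4)) cu := cuv u.
have /cvgrPdist_lt/(_ (e / 4)) cv := cuv v.
have e4 : 0 < e / 4 by rewrite divr_gt0.
have Unear : \near x, U x by exact: open_nbhs_nbhs.
have near3 : \forall y \near x, [/\ U y, `|'D_u f x - 'D_u f y| < e / 4 &
    `|'D_v f x - 'D_v f y| < e / 4].
  by apply: filterS3 Unear (cu e4) (cv e4) => y; split.
have [d1 d1_gt0 Hd1] := near_plane u v near3.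
(* One step h serves both limits: below d0 the difference quotient along u + v
   is close to its limit, below d1 the parallelogram stays where the derivatives
   along u and v are close to their values at x. *)
pose h := Num.min (d0 / 2) d1.
have h0 : 0 < h by rewrite lt_min divr_gt0.
have hd1 : h <= d1 by rewrite ge_min lexx orbT.
have hd0 : h < d0.
  by apply: le_lt_trans (_ : d0 / 2 < _); [rewrite ge_min lexx|lra].
have in0 (s : R) : 0 <= s <= h -> 0 <= s <= d1.
  by move=> /andP[-> /le_trans->].
have z0 : 0 <= (0 : R) <= d1 by rewrite lexx ltW.
have hh : 0 <= h <= d1 by rewrite hd1 ltW.
have [c1 c1h E1] : exists2 c : R, 0 <= c <= h &
    f (h *: u + (h *: v + x)) - f (h *: v + x)
    = h * 'D_u f (c *: u + (h *: v + x)).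
  have [|c ch] := @mvt_zero (fun s => f (s *: u + (h *: v + x)))
    (fun s => 'D_u f (s *: u + (h *: v + x))) h h0.
    move=> s sh; apply: is_derive_line.
    by apply: dU; have [] := Hd1 s h (in0 _ sh) hh.
  by rewrite /= scale0r add0r => H; exists c.
have [c2 c2h E2] : exists2 c : R, 0 <= c <= h &
    f (h *: v + x) - f x = h * 'D_v f (c *: v + x).
  have [|c ch] := @mvt_zero (fun s => f (s *: v + x))
    (fun s => 'D_v f (s *: v + x)) h h0.
    move=> s sh; apply: is_derive_line.
    apply: dU; have [+ _ _] := Hd1 0 s z0 (in0 _ sh).
    by rewrite scale0r add0r.
  by rewrite /= scale0r add0r => H; exists c.
have := Hd0 h; rewrite /ball /= sub0r normrN ger0_norm ?(ltW h0) // => /(_ hd0).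
rewrite gt_eqF // => /(_ isT).
have -> : h *: (u + v) + x = h *: u + (h *: v + x) by rewrite scalerDr addrA.
have -> : f (h *: u + (h *: v + x)) - f x =
   h *: ('D_u f (c1 *: u + (h *: v + x)) + 'D_v f (c2 *: v + x)).
  by rewrite [RHS]mulrDr -E1 -E2; ring.
rewrite scalerA mulVf ?gt_eqF // scale1r.
have [_ + _] := Hd1 c1 h (in0 _ c1h) hh.
have [_ _ +] := Hd1 0 c2 z0 (in0 _ c2h).
rewrite scale0r add0r -/('D_(u + v) f x).
rewrite !ltr_norml ler_norml.
by move=> /andP[a1 a2] /andP[b1 b2] /andP[d2 d3]; lra.
Qed.

(** The second difference of f over a parallelogram is a mixed second derivative
at some point of it: apply the mean value theorem to f(. + h v) - f in the
direction u, then to D_u f in the direction v. *)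
Lemma second_difference U f x u v (h : R) (P : E -> Prop) : Ck 2 U f -> 0 < h ->
  (forall a b : R, 0 <= a <= h -> 0 <= b <= h ->
     U (a *: u + (b *: v + x)) /\ P (a *: u + (b *: v + x))) ->
  exists2 y, P y &
  f (h *: u + (h *: v + x)) - f (h *: u + x) - (f (h *: v + x) - f x) =
    h * (h * 'D_v ('D_u f) y).
Proof.
move=> [cf df] h0 Uh; have dU := derivable_of_cd cf.
have hh : 0 <= h <= h by rewrite lexx ltW.
have zh : 0 <= (0 : R) <= h by rewrite lexx ltW.
(* The point a of the first mean value is then fixed and the second one is
   taken along the segment through a *: u + x. *)
have [|a ah Ea] := @mvt_zero
    ((fun s => f (s *: u + (h *: v + x))) - (fun s => f (s *: u + x)))
    (fun s => 'D_u f (s *: u + (h *: v + x)) - 'D_u f (s *: u + x)) h h0.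
  move=> s sh; apply: is_deriveB; apply: is_derive_line.
    by apply: dU; have [] := Uh s h sh hh.
  by apply: dU; have [+ _] := Uh s 0 sh zh; rewrite scale0r add0r.
have cA (s : R) : s *: v + (a *: u + x) = a *: u + (s *: v + x).
  by rewrite addrCA.
have [|b bh Eb] := @mvt_zero (fun s => 'D_u f (s *: v + (a *: u + x)))
    (fun s => 'D_v ('D_u f) (s *: v + (a *: u + x))) h h0.
  move=> s sh; apply: is_derive_line.
  have [du _] := df u; apply: (derivable_of_cd du).
  by rewrite cA; have [] := Uh a s ah sh.
exists (a *: u + (b *: v + x)); first by have [] := Uh a b ah bh.
rewrite -cA -Eb cA scale0r add0r -Ea.
rewrite -[RHS]/(f (h *: u + (h *: v + x)) - f (h *: u + x) -
  (f (0 *: u + (h *: v + x)) - f (0 *: u + x))).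
by rewrite !scale0r !add0r.
Qed.

Lemma dist_half_eq (A B p q e : R) : `|A - p| < e / 2 -> `|B - q| < e / 2 ->
  p = q -> `|A - B| <= e.
Proof.
rewrite !ltr_norml ler_norml => /andP[a1 a2] /andP[b1 b2] pq.
by rewrite -pq in b1 b2; lra.
Qed.

(** Schwarz: the second difference over the parallelogram spanned by h u and h v
is symmetric in u and v, and both mixed derivatives are its limits. *)
Lemma deriveC U f x u v : open U -> U x -> Ck 2 U f ->
  'D_v ('D_u f) x = 'D_u ('D_v f) x.
Proof.
move=> oU Ux C2; have [cf df] := C2; apply: eq_of_dist_le => e e0.
have e2 : 0 < e / 2 by rewrite divr_gt0.
have cuv w w' : \forall y \near x,
    `|'D_w ('D_w' f) x - 'D_w ('D_w' f) y| < e / 2.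
  have [_ /(_ w) [/(_ x Ux) [c _] _]] := df w'.
  by move/cvgrPdist_lt : c; apply.
have near3 : \forall y \near x, [/\ U y,
    `|'D_u ('D_v f) x - 'D_u ('D_v f) y| < e / 2 &
    `|'D_v ('D_u f) x - 'D_v ('D_u f) y| < e / 2].
  have Unear : \near x, U x by exact: open_nbhs_nbhs.
  by apply: filterS3 Unear (cuv u v) (cuv v u) => y; split.
have [h h0 Hh] := near_plane u v near3.
have [|y Py E1] := @second_difference U f x u v h
    (fun y => `|'D_v ('D_u f) x - 'D_v ('D_u f) y| < e / 2) C2 h0.
  move=> a b ah bh; have [U1 _ P1] := Hh a b ah bh.
  split; [exact: U1 | exact: P1].
have cA (a b : R) : a *: v + (b *: u + x) = b *: u + (a *: v + x).
  by rewrite addrCA.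
have [|z Pz E2] := @second_difference U f x v u h
    (fun y => `|'D_u ('D_v f) x - 'D_u ('D_v f) y| < e / 2) C2 h0.
  move=> b a bh ah; rewrite (cA b a); have [U1 P1 _] := Hh a b ah bh.
  split; [exact: U1 | exact: P1].
apply: dist_half_eq Py Pz _.
have hn : h != 0 by rewrite gt_eqF.
apply: (mulfI hn); apply: (mulfI hn).
rewrite (cA h h) in E2; move: E1 E2.
move: ('D_v ('D_u f) y) ('D_u ('D_v f) z) => p q <- <-.
move: (f _) (f (h *: u + x)) (f (h *: v + x)) (f x) => a b c d; ring.
Qed.

End SecondOrder.

Section SmoothClosure.
Variable R : realType.
Implicit Types E F G : normedModType R.

Lemma smooth_eq_on E F (U : set E) (f h : E -> F) :
  open U -> eq_on U f h -> smooth_on U f -> smooth_on U h.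
Proof.
by move=> oU fh /smooth_onP sf; apply/smooth_onP => n; exact: Ck_eq (sf n).
Qed.

Lemma smooth_cst E F (U : set E) (a : F) : open U -> smooth_on U (fun _ => a).
Proof. by move=> oU; apply/smooth_onP => n; exact: Ck_cst. Qed.

Lemma smooth_add E F (U : set E) (f h : E -> F) : open U ->
  smooth_on U f -> smooth_on U h -> smooth_on U (fun x => f x + h x).
Proof.
move=> oU /smooth_onP sf /smooth_onP sh; apply/smooth_onP => n.
exact: Ck_add.
Qed.

Lemma smooth_scale E F (U : set E) (f : E -> R) (h : E -> F) : open U ->
  smooth_on U f -> smooth_on U h -> smooth_on U (fun x => f x *: h x).
Proof.
move=> oU /smooth_onP sf /smooth_onP sh; apply/smooth_onP => n.
exact: Ck_scale.
Qed.

Lemma smooth_mul E (U : set E) (f h : E -> R) : open U ->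
  smooth_on U f -> smooth_on U h -> smooth_on U (fun x => f x * h x).
Proof. exact: smooth_scale. Qed.

Lemma smooth_opp E F (U : set E) (f : E -> F) : open U ->
  smooth_on U f -> smooth_on U (fun x => - f x).
Proof.
move=> oU sf; have s1 : smooth_on U (fun _ : E => -1 : R) by exact: smooth_cst.
by apply: smooth_eq_on (smooth_scale oU s1 sf) => // x _; rewrite scaleN1r.
Qed.

Lemma smooth_sub E F (U : set E) (f h : E -> F) : open U ->
  smooth_on U f -> smooth_on U h -> smooth_on U (fun x => f x - h x).
Proof. by move=> oU sf sh; apply: smooth_add => //; exact: smooth_opp. Qed.

Lemma smooth_inv E (U : set E) (f : E -> R) : open U ->
  (forall x, U x -> f x != 0) ->
  smooth_on U f -> smooth_on U (fun x => (f x)^-1).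
Proof.
move=> oU f0 /smooth_onP sf; apply/smooth_onP => n.
exact: Ck_inv.
Qed.

Lemma smooth_linear E F G (U : set E) (f : E -> F) (L : {linear F -> G}) :
  continuous L -> open U -> smooth_on U f -> smooth_on U (L \o f).
Proof.
move=> cL oU /smooth_onP sf; apply/smooth_onP => n.
exact: Ck_linear.
Qed.

Lemma smooth_sum E F (U : set E) I (r : seq I) (P : pred I) (f : I -> E -> F) :
  open U -> (forall i, P i -> smooth_on U (f i)) ->
  smooth_on U (fun x => \sum_(i <- r | P i) f i x).
Proof.
move=> oU sf; elim: r => [|i r IHr].
  by apply: smooth_eq_on (smooth_cst 0 oU) => // x _; rewrite big_nil.
have [Pi|nPi] := boolP (P i).
  apply: (smooth_eq_on oU _ (smooth_add oU (sf i Pi) IHr)) => x _.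
  by rewrite big_cons Pi.
by apply: smooth_eq_on IHr => // x _; rewrite big_cons (negbTE nPi).
Qed.

Lemma smooth_prod E (U : set E) I (r : seq I) (P : pred I) (f : I -> E -> R) :
  open U -> (forall i, P i -> smooth_on U (f i)) ->
  smooth_on U (fun x => \prod_(i <- r | P i) f i x).
Proof.
move=> oU sf; elim: r => [|i r IHr].
  have s1 : smooth_on U (fun _ : E => 1 : R) by exact: smooth_cst.
  by apply: smooth_eq_on s1 => // x _; rewrite big_nil.
have [Pi|nPi] := boolP (P i).
  apply: (smooth_eq_on oU _ (smooth_mul oU (sf i Pi) IHr)) => x _.
  by rewrite big_cons Pi.
by apply: smooth_eq_on IHr => // x _; rewrite big_cons (negbTE nPi).
Qed.

Lemma smooth_derivable E F (U : set E) (f : E -> F) x v :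
  smooth_on U f -> U x -> derivable f x v.
Proof. by move=> sf /(sf [::])[]. Qed.

Lemma deriveM_on E (U : set E) (f h : E -> R) x v :
  smooth_on U f -> smooth_on U h -> U x ->
  'D_v (fun y => f y * h y) x = 'D_v f x * h x + f x * 'D_v h x.
Proof.
move=> sf sh Ux.
have df := smooth_derivable (v := v) sf Ux; have dh := smooth_derivable (v := v) sh Ux.
by have [_ ->] := is_derive_scale df dh.
Qed.

Lemma deriveD_on E F (U : set E) (f h : E -> F) x v :
  smooth_on U f -> smooth_on U h -> U x ->
  'D_v (fun y => f y + h y) x = 'D_v f x + 'D_v h x.
Proof.
by move=> sf sh Ux; apply: deriveD; apply: smooth_derivable Ux.
Qed.

Lemma deriveN_on E F (U : set E) (f : E -> F) x v :
  smooth_on U f -> U x -> 'D_v (fun y => - f y) x = - 'D_v f x.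
Proof.
by move=> sf Ux; apply: deriveN; apply: smooth_derivable Ux.
Qed.

Lemma deriveB_on E F (U : set E) (f h : E -> F) x v :
  smooth_on U f -> smooth_on U h -> U x ->
  'D_v (fun y => f y - h y) x = 'D_v f x - 'D_v h x.
Proof.
by move=> sf sh Ux; apply: deriveB; apply: smooth_derivable Ux.
Qed.

Lemma derive_sum_on E F (U : set E) I (r : seq I) (P : pred I) (f : I -> E -> F) x v :
  open U -> (forall i, P i -> smooth_on U (f i)) -> U x ->
  'D_v (fun y => \sum_(i <- r | P i) f i y) x = \sum_(i <- r | P i) 'D_v (f i) x.
Proof.
move=> oU sf Ux; elim: r => [|i r IHr].
  rewrite big_nil -[RHS](derive_cst (0 : F) x v).
  by apply: (derive_eq_on _ oU) => // y _; rewrite big_nil.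
have [Pi|nPi] := boolP (P i); rewrite big_cons ?Pi ?(negbTE nPi) -IHr.
  rewrite -(deriveD_on v (sf i Pi) (smooth_sum r oU sf) Ux).
  by apply: (derive_eq_on _ oU) => // y _; rewrite big_cons Pi.
by apply: (derive_eq_on _ oU) => // y _; rewrite big_cons (negbTE nPi).
Qed.

Lemma derive_smoothC E (U : set E) (f : E -> R) x u v :
  open U -> smooth_on U f -> U x -> 'D_v ('D_u f) x = 'D_u ('D_v f) x.
Proof.
by move=> oU /smooth_onP sf Ux; exact: (deriveC _ _ oU Ux (sf 2)).
Qed.

Lemma derive_smoothD E (U : set E) (f : E -> R) x u v :
  open U -> smooth_on U f -> U x -> 'D_(u + v) f x = 'D_u f x + 'D_v f x.
Proof.
by move=> oU /smooth_onP sf Ux; exact: (deriveDr _ _ oU Ux (sf 1%N)).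
Qed.

Lemma derive_scaler E (f : E -> R) x (a : R) v : derivable f x v ->
  'D_(a *: v) f x = a * 'D_v f x.
Proof.
move=> dv; set g := fun h : R => f (h *: v + x).
have df : differentiable g 0.
  have dg : derivable g 0 1 by move/derivable1P : dv.
  exact/(derivable1_diffP g 0).
have e (b : R) : 'D_(b *: v) f x = 'D_b g 0.
  have E0 : (fun h : R => h^-1 *: ((f \o shift x) (h *: (b *: v)) - f x)) =
      (fun h : R => h^-1 *: ((g \o shift 0) (h *: b) - g 0)).
    by apply/funext => h; rewrite /g /= addr0 scale0r add0r scalerA.
  by rewrite /derive E0.
rewrite e -[in RHS](scale1r v) e !deriveE //.
by rewrite -[a in LHS]mulr1 -[a * 1]/(a *: 1) linearZ.
Qed.

End SmoothClosure.

(** * Matrix-valued functions in coordinates *)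

Section Coordinates.
Variables (R : realType) (n : nat).
Local Notation E := 'rV[R]_n.+1.
Variable V : set E.
Hypothesis oV : open V.
Implicit Types f : E -> R.

Lemma derive_partial f x v : smooth_on V f -> V x ->
  'D_v f x = \sum_i v 0 i * partial i f x.
Proof.
move=> sf Vx; rewrite {1}[v]row_sum_delta.
have -> (r : seq 'I_n.+1) : 'D_(\sum_(i <- r) v 0 i *: delta_mx 0 i) f x =
    \sum_(i <- r) v 0 i * partial i f x.
  elim: r => [|i r IHr]; first by rewrite !big_nil derive0.
  rewrite !big_cons (derive_smoothD _ _ oV) // IHr derive_scaler //.
  exact: smooth_derivable Vx.
by [].
Qed.

(** An inductive wrapper, so that comparing two such statements does not unfold
into comparing iterated derivatives of entries. *)
Variant smooth_mx p q (M : E -> 'M[R]_(p, q)) : Prop :=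
  SmoothMx of forall a b, smooth_on V (fun x => M x a b).

Fact dmx_exists p q (i : 'I_n.+1) (M : E -> 'M[R]_(p, q)) (x : E) :
  {N : 'M[R]_(p, q) | forall a b, N a b = partial i (fun y => M y a b) x}.
Proof.
by exists (\matrix_(a, b) partial i (fun y => M y a b) x) => a b; rewrite mxE.
Qed.

(** The entrywise partial derivative.  It is the matrix provided by an opaque
existence statement, so that matrix identities involving it are treated
algebraically and its entries are only seen through dmxE. *)
Definition dmx p q i (M : E -> 'M[R]_(p, q)) x := sval (dmx_exists i M x).

Lemma dmxE p q i (M : E -> 'M[R]_(p, q)) x a b :
  dmx i M x a b = partial i (fun y => M y a b) x.
Proof. exact: (svalP (dmx_exists i M x)). Qed.

Lemma smooth_mxP p q (M : E -> 'M[R]_(p, q)) :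
  smooth_mx M <-> forall a b, smooth_on V (fun x => M x a b).
Proof. by split=> [[]|]. Qed.

Lemma smooth_mx_eq p q (M N : E -> 'M[R]_(p, q)) :
  eq_on V M N -> smooth_mx M -> smooth_mx N.
Proof.
move=> MN [sM]; split=> a b; apply: smooth_eq_on (sM a b) => // x Vx.
by rewrite (MN x Vx).
Qed.

Lemma dmx_eq p q (M N : E -> 'M[R]_(p, q)) i x :
  eq_on V M N -> V x -> dmx i M x = dmx i N x.
Proof.
move=> MN Vx; apply/matrixP => a b; rewrite !dmxE.
by apply: (derive_eq_on _ oV) => // y Vy; rewrite (MN y Vy).
Qed.

Lemma smooth_mx_mul p q r (M : E -> 'M[R]_(p, q)) (N : E -> 'M[R]_(q, r)) :
  smooth_mx M -> smooth_mx N -> smooth_mx (fun x => M x *m N x).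
Proof.
move=> [sM] [sN]; split=> a b.
apply: (@smooth_eq_on _ _ _ _ (fun x => \sum_c M x a c * N x c b)) => //.
  by move=> x _; rewrite mxE.
by apply: smooth_sum => // c _; exact: smooth_mul.
Qed.

Lemma dmx_mul p q r (M : E -> 'M[R]_(p, q)) (N : E -> 'M[R]_(q, r)) i x :
  smooth_mx M -> smooth_mx N -> V x ->
  dmx i (fun x => M x *m N x) x = dmx i M x *m N x + M x *m dmx i N x.
Proof.
move=> [sM] [sN] Vx; apply/matrixP => a b; rewrite dmxE mxE [X in _ = X + _]mxE [X in _ = _ + X]mxE.
rewrite /partial (@derive_eq_on _ _ _ V _ (fun x => \sum_c M x a c * N x c b)) //;
  last by move=> y _; rewrite mxE.
rewrite (derive_sum_on _ _ oV) //; last by move=> c _; exact: smooth_mul.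
rewrite -big_split /=; apply: eq_bigr => c _.
by rewrite (deriveM_on _ (sM a c) (sN c b)) // !dmxE.
Qed.

Lemma smooth_mx_sub p q (M N : E -> 'M[R]_(p, q)) :
  smooth_mx M -> smooth_mx N -> smooth_mx (fun x => M x - N x).
Proof.
move=> [sM] [sN]; split=> a b.
apply: (@smooth_eq_on _ _ _ _ (fun x => M x a b - N x a b)) => //.
  by move=> x _; rewrite !mxE.
exact: smooth_sub.
Qed.

Lemma dmx_sub p q (M N : E -> 'M[R]_(p, q)) i x :
  smooth_mx M -> smooth_mx N -> V x ->
  dmx i (fun x => M x - N x) x = dmx i M x - dmx i N x.
Proof.
move=> [sM] [sN] Vx; apply/matrixP => a b; rewrite dmxE [RHS]mxE [X in _ = _ + X]mxE !dmxE.
rewrite /partial -(deriveB_on _ (sM a b) (sN a b)) //.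
by apply: (derive_eq_on _ oV) => // y _; rewrite !mxE.
Qed.

Lemma smooth_mx_tr p q (M : E -> 'M[R]_(p, q)) :
  smooth_mx M -> smooth_mx (fun x => (M x)^T).
Proof.
move=> [sM]; split=> a b; apply: smooth_eq_on (sM b a) => // x _.
by rewrite mxE.
Qed.

Lemma dmx_tr p q (M : E -> 'M[R]_(p, q)) i x :
  V x -> dmx i (fun x => (M x)^T) x = (dmx i M x)^T.
Proof.
move=> Vx; apply/matrixP => a b; rewrite [RHS]mxE !dmxE.
by apply: (derive_eq_on _ oV) => // y _; rewrite !mxE.
Qed.

Lemma smooth_dmx p q (M : E -> 'M[R]_(p, q)) i : smooth_mx M -> smooth_mx (dmx i M).
Proof.
move=> [sM]; split=> a b; apply: smooth_eq_on (smooth_onD (ebase R i) (sM a b)) => // x _.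
by rewrite dmxE.
Qed.

Lemma dmxC p q (M : E -> 'M[R]_(p, q)) i j x : smooth_mx M -> V x ->
  dmx i (dmx j M) x = dmx j (dmx i M) x.
Proof.
move=> [sM] Vx; apply/matrixP => a b.
have e k l : dmx k (dmx l M) x a b =
    'D_(ebase R k) ('D_(ebase R l) (fun y => M y a b)) x.
  rewrite dmxE; apply: (derive_eq_on _ oV) => // y Vy; exact: dmxE.
exact: (etrans (e i j) (etrans (derive_smoothC _ _ oV (sM a b) Vx) (esym (e j i)))).
Qed.

Lemma smooth_det p (M : E -> 'M[R]_p) :
  smooth_mx M -> smooth_on V (fun x => \det (M x)).
Proof.
move=> [sM]; rewrite /determinant; apply: smooth_sum => // s _.
apply: smooth_mul => //; first exact: smooth_cst.
by apply: smooth_prod.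
Qed.

(** Cramer's rule: the entries of the inverse are cofactors divided by the
determinant. *)
Lemma smooth_mx_inv p (M : E -> 'M[R]_p) : (forall x, V x -> M x \in unitmx) ->
  smooth_mx M -> smooth_mx (fun x => invmx (M x)).
Proof.
move=> uM sM'; have [sM] := sM'; split=> a b.
apply: (@smooth_eq_on _ _ _ _ (fun x => (\det (M x))^-1 * cofactor (M x) b a)) => //.
  by move=> x Vx; rewrite /invmx uM // !mxE.
apply: smooth_mul => //.
  apply: smooth_inv => //; last exact: smooth_det.
  by move=> x Vx; have := uM x Vx; rewrite unitmxE unitfE.
apply: smooth_mul => //; first exact: smooth_cst.
apply: smooth_det; split=> c d.
by apply: smooth_eq_on (sM (lift b c) (lift a d)) => // x _; rewrite !mxE.
Qed.

End Coordinates.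

(** * The Levi-Civita connection and its curvature in a moving frame *)

Lemma sub_common (R : realType) (a b p q r : R) :
  a = p - q -> b = p - r -> a - b = r - q.
Proof. by move=> -> ->; ring. Qed.

(** The matrix identity left once the second derivatives of a gauge
transformation are written out; the hypothesis is the equality of its two mixed
second derivatives. *)
Lemma gauge_algebra (R : realType) n (th Gi Gj Ai Aj dGj dGi dAj dAi : 'M[R]_n) :
  th *m Gi *m Gj - Ai *m th *m Gj + th *m dGj - dAj *m th -
    (Aj *m (th *m Gi) - Aj *m (Ai *m th)) =
  th *m Gj *m Gi - Aj *m th *m Gi + th *m dGi - dAi *m th -
    (Ai *m (th *m Gj) - Ai *m (Aj *m th)) ->
  th *m (dGj - dGi + (Gi *m Gj - Gj *m Gi)) =
  (dAj - dAi + (Ai *m Aj - Aj *m Ai)) *m th.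
Proof.
rewrite !mulmxDr !mulmxDl !mulmxN !mulNmx !mulmxA.
move: (th *m Gi *m Gj) (Ai *m th *m Gj) (th *m dGj) (dAj *m th)
  (Aj *m th *m Gi) (Aj *m Ai *m th) (th *m Gj *m Gi) (th *m dGi) (dAi *m th)
  (Ai *m Aj *m th) => a1 a2 a3 a4 a5 a6 b1 b3 b4 b6 H.
apply/matrixP => p q; have /matrixP/(_ p q) := H; rewrite !mxE => e.
by lra.
Qed.

Section Gauge.
Variables (R : realType) (n : nat).
Local Notation E := 'rV[R]_n.+1.
Variables (V : set E) (th : E -> 'M[R]_n.+1) (G A : 'I_n.+1 -> E -> 'M[R]_n.+1).
Hypothesis oV : open V.
Hypothesis sth : smooth_mx V th.
Hypothesis sG : forall i, smooth_mx V (G i).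
Hypothesis sA : forall i, smooth_mx V (A i).
Hypothesis dth : forall i x, V x -> dmx i th x = th x *m G i x - A i x *m th x.

(** If th intertwines the connections G and A, it intertwines their curvatures:
differentiate d_i th = th G_i - A_i th once more and antisymmetrise, so that the
second derivatives of th cancel. *)
Lemma gauge_curvature i j x : V x ->
  th x *m (dmx i (G j) x - dmx j (G i) x + (G i x *m G j x - G j x *m G i x)) =
  (dmx i (A j) x - dmx j (A i) x + (A i x *m A j x - A j x *m A i x)) *m th x.
Proof.
move=> Vx; apply: gauge_algebra.
have E1 k l : dmx k (dmx l th) x =
    th x *m G k x *m G l x - A k x *m th x *m G l x +
    th x *m dmx k (G l) x - dmx k (A l) x *m th x -
    (A l x *m (th x *m G k x) - A l x *m (A k x *m th x)).
  rewrite (@dmx_eq _ _ _ oV _ _ _ (fun y => th y *m G l y - A l y *m th y) _ _ (dth l) Vx).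
  rewrite (dmx_sub oV _ (smooth_mx_mul oV sth (sG l)) (smooth_mx_mul oV (sA l) sth) Vx).
  rewrite (dmx_mul oV _ sth (sG l) Vx) (dmx_mul oV _ (sA l) sth Vx) (dth k Vx).
  by rewrite mulmxBl mulmxBr opprD addrA.
exact: (etrans (esym (E1 i j)) (etrans (dmxC oV i j sth Vx) (E1 j i))).
Qed.

End Gauge.

Section MovingFrame.
Variables (R : realType) (n : nat).
Local Notation E := 'rV[R]_n.+1.
Variables (V : set E) (th : E -> 'M[R]_n.+1) (g : tensor E 2).
Hypothesis oV : open V.
Hypothesis sth : smooth_mx V th.
Hypothesis uth : forall x, V x -> th x \in unitmx.
Hypothesis gramE : forall x, V x -> gram g x = (th x)^T *m th x.

Definition dual_frame (x : E) : 'M[R]_n.+1 := invmx (th x).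
Local Notation F := dual_frame.

Definition lc_coord (i : 'I_n.+1) (x : E) : 'M[R]_n.+1 :=
  \matrix_(k, j) christoffel g k i j x.
Local Notation Gam := lc_coord.

(** The connection matrix of the Levi-Civita connection in the frame dual to
th, that is, the gauge transform of the Christoffel symbols by th; the entry
(a, b) of lc_frame i is A_ab(d_i). *)
Definition lc_frame (i : 'I_n.+1) (x : E) : 'M[R]_n.+1 :=
  (th x *m Gam i x - dmx i th x) *m F x.
Local Notation A := lc_frame.

Lemma frame_mul_coframe x : V x -> F x *m th x = 1%:M.
Proof. by move=> Vx; rewrite mulVmx ?uth. Qed.

Lemma coframe_mul_frame x : V x -> th x *m F x = 1%:M.
Proof. by move=> Vx; rewrite mulmxV ?uth. Qed.

Lemma gram_sym x i j : V x -> gram g x i j = gram g x j i.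
Proof.
move=> Vx; rewrite gramE // !mxE; apply: eq_bigr => k _.
by rewrite !mxE mulrC.
Qed.

Lemma smooth_gram : smooth_mx V (gram g).
Proof.
apply: (@smooth_mx_eq _ _ _ oV _ _ (fun x => (th x)^T *m th x)).
  by move=> x Vx; rewrite gramE.
by apply: smooth_mx_mul => //; exact: smooth_mx_tr.
Qed.

Lemma smooth_frame : smooth_mx V F.
Proof. exact: smooth_mx_inv. Qed.

Lemma invmx_gram x : V x -> invmx (gram g x) = F x *m (F x)^T.
Proof.
move=> Vx; rewrite gramE //.
have u : (th x)^T *m th x \in unitmx by rewrite unitmx_mul unitmx_tr uth.
apply: (can_inj (mulmxK u)); rewrite mulVmx // -mulmxA (mulmxA _^T).
by rewrite -trmx_mul coframe_mul_frame // trmx1 mul1mx frame_mul_coframe.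
Qed.

(** The Christoffel symbols of the first kind. *)
Definition lc_low (i : 'I_n.+1) (x : E) : 'M[R]_n.+1 := \matrix_(l, j)
  (2^-1 * (partial i (fun y => gram g y j l) x + partial j (fun y => gram g y i l) x
     - partial l (fun y => gram g y i j) x)).

Lemma lc_coordE i x : Gam i x = invmx (gram g x) *m lc_low i x.
Proof.
apply/matrixP => k j; rewrite [LHS]mxE [RHS]mxE /christoffel mulr_sumr.
by apply: eq_bigr => l _; rewrite [lc_low _ _ _ _]mxE mulrCA.
Qed.

Lemma partial_gram_sym l i j x : V x ->
  partial l (fun y => gram g y i j) x = partial l (fun y => gram g y j i) x.
Proof. by move=> Vx; apply: (derive_eq_on _ oV) => // y Vy; exact: gram_sym. Qed.

Lemma christoffel_sym k i j x : V x -> christoffel g k i j x = christoffel g k j i x.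
Proof.
move=> Vx; rewrite /christoffel; congr (_ * _); apply: eq_bigr => l _.
congr (_ * _); rewrite (partial_gram_sym l i j Vx).
by congr (_ - _); rewrite addrC.
Qed.

Lemma smooth_lc_coord i : smooth_mx V (Gam i).
Proof.
apply: (@smooth_mx_eq _ _ _ oV _ _ (fun x => (F x *m (F x)^T) *m lc_low i x)).
  by move=> x Vx; rewrite lc_coordE invmx_gram.
have sF := smooth_frame.
apply: smooth_mx_mul => //.
  by apply: smooth_mx_mul => //; exact: smooth_mx_tr.
apply/smooth_mxP => l j.
have sp a b c : smooth_on V (partial a (fun y => gram g y b c)).
  exact: (smooth_onD (ebase R a) ((smooth_mxP V _).1 smooth_gram b c)).
apply: (@smooth_eq_on _ _ _ _ (fun x => 2^-1 *
    (partial i (fun y => gram g y j l) x + partial j (fun y => gram g y i l) x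
     - partial l (fun y => gram g y i j) x))) => //.
  by move=> x _; rewrite [RHS]mxE.
apply: smooth_mul => //; first exact: smooth_cst.
by apply: smooth_sub => //; apply: smooth_add.
Qed.

(** The Levi-Civita connection is metric. *)
Lemma dmx_gram l x : V x ->
  dmx l (gram g) x = (Gam l x)^T *m gram g x + gram g x *m Gam l x.
Proof.
move=> Vx.
have u : gram g x \in unitmx by rewrite gramE // unitmx_mul unitmx_tr uth.
have E1 : gram g x *m Gam l x = lc_low l x by rewrite lc_coordE mulKVmx.
have E2 : (Gam l x)^T *m gram g x = (lc_low l x)^T.
  have s : (gram g x)^T = gram g x.
    by apply/matrixP => i j; rewrite mxE gram_sym.
  by rewrite -{1}s -trmx_mul E1.
rewrite E1 E2; apply/matrixP => i j.
rewrite dmxE [RHS]mxE [_^T _ _]mxE [lc_low _ _ _ _]mxE [in X in _ = _ + X]mxE.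
rewrite (partial_gram_sym l j i Vx).
set a := partial l _ x; set b := partial i _ x; set c := partial j _ x.
by field.
Qed.

Lemma dmx_coframe i x : V x -> dmx i th x = th x *m Gam i x - A i x *m th x.
Proof.
move=> Vx; rewrite /lc_frame -mulmxA frame_mul_coframe // mulmx1.
by rewrite opprB addrC subrK.
Qed.

Lemma smooth_lc_frame i : smooth_mx V (A i).
Proof.
apply: smooth_mx_mul smooth_frame => //.
apply: smooth_mx_sub => //; last exact: smooth_dmx.
by apply: smooth_mx_mul => //; exact: smooth_lc_coord.
Qed.

(** Compare the two expressions of the derivative of gram = th^T th: one from
metricity of the Christoffel symbols, the other from the gauge relation
dmx_coframe.  They differ by th^T (A^T + A) th, and th is invertible. *)
Lemma lc_frame_antisym i x a b : V x -> A i x a b = - A i x b a.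
Proof.
move=> Vx.
have H : (A i x)^T + A i x = 0.
  have E1 : (dmx i th x)^T *m th x + (th x)^T *m dmx i th x =
      (Gam i x)^T *m ((th x)^T *m th x) + (th x)^T *m th x *m Gam i x.
    rewrite -(gramE Vx) -(dmx_gram i Vx) -(dmx_tr oV) // -(dmx_mul oV) //;
      last exact: smooth_mx_tr.
    by apply: (dmx_eq oV) => // y Vy; rewrite gramE.
  rewrite dmx_coframe // in E1; move: E1; move: (A i x) => B.
  rewrite linearB /= !trmx_mul mulmxBl mulmxBr.
  set p := _ *m _ *m th x; set q := _ *m (_ *m Gam i x).
  have -> : (Gam i x)^T *m ((th x)^T *m th x) = p by rewrite /p mulmxA.
  have -> : (th x)^T *m th x *m Gam i x = q by rewrite /q mulmxA.
  rewrite addrACA -[RHS]addr0 => /addrI /eqP.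
  rewrite -opprD oppr_eq0 -mulmxA -mulmxDr -mulmxDl => /eqP H.
  have : (F x)^T *m ((th x)^T *m ((B^T + B) *m th x)) *m F x = 0.
    by rewrite H mulmx0 mul0mx.
  rewrite (mulmxA (F x)^T) -trmx_mul coframe_mul_frame // trmx1 mul1mx.
  by rewrite -mulmxA coframe_mul_frame // mulmx1.
have /matrixP/(_ b a) := H; rewrite [LHS]mxE [_^T _ _]mxE [RHS]mxE => /eqP.
by rewrite addr_eq0 => /eqP.
Qed.

(** First structure equation de^a = - A_ab /\ e^b, which is the symmetry of the
Christoffel symbols read in the coframe. *)
Lemma torsion_free i j x a : V x ->
  partial i (fun y => th y a j) x - partial j (fun y => th y a i) x =
  (A j x *m th x) a i - (A i x *m th x) a j.
Proof.
move=> Vx.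
have H k l : partial k (fun y => th y a l) x =
    (th x *m Gam k x) a l - (A k x *m th x) a l.
  have /matrixP/(_ a l) := dmx_coframe k Vx.
  by rewrite dmxE => ->; rewrite [LHS]mxE [X in _ + X]mxE.
(* The Christoffel part of the derivative is symmetric and drops out. *)
have s : (th x *m Gam i x) a j = (th x *m Gam j x) a i.
  rewrite [LHS]mxE [RHS]mxE; apply: eq_bigr => k _; congr (_ * _).
  by rewrite [LHS]mxE [RHS]mxE christoffel_sym.
have Hji := H j i; rewrite -s in Hji.
exact: (sub_common (H i j) Hji).
Qed.

Definition curv_coord (i j : 'I_n.+1) (x : E) : 'M[R]_n.+1 :=
  \matrix_(l, k) riemann g l k i j x.

Definition curv_frame (i j : 'I_n.+1) (x : E) : 'M[R]_n.+1 :=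
  dmx i (A j) x - dmx j (A i) x + (A i x *m A j x - A j x *m A i x).

Lemma curv_coordE i j x : curv_coord i j x =
  dmx i (Gam j) x - dmx j (Gam i) x + (Gam i x *m Gam j x - Gam j x *m Gam i x).
Proof.
apply/matrixP => l k; rewrite [LHS]mxE /riemann.
have e a b : partial a (christoffel g l b k) x = dmx a (Gam b) x l k.
  rewrite dmxE; congr (partial _ _ _); apply/funext => y.
  by rewrite [RHS]mxE.
rewrite [RHS]mxE (e i j) (e j i) [X in _ = X + _]mxE [X in _ = _ + X]mxE.
rewrite [(- dmx j (Gam i) x) l k]mxE [(- (_ *m _)) l k]mxE.
congr (_ + _); rewrite [(Gam i x *m _) l k]mxE [(Gam j x *m _) l k]mxE.
rewrite -sumrB; apply: eq_bigr => m _.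
by rewrite [Gam i x l m]mxE [Gam j x m k]mxE [Gam j x l m]mxE [Gam i x m k]mxE.
Qed.

Lemma curv_gauge i j x : V x -> th x *m curv_coord i j x = curv_frame i j x *m th x.
Proof.
move=> Vx; rewrite curv_coordE.
exact: (gauge_curvature oV sth smooth_lc_coord smooth_lc_frame dmx_coframe).
Qed.
End MovingFrame.

Section PointCurvature.
Variables (R : realType) (n : nat) (th F : 'M[R]_n).
Variables (r : 'I_n -> 'I_n -> 'I_n -> 'I_n -> R) (Om : 'I_n -> 'I_n -> 'M[R]_n).
Hypothesis Fth : F *m th = 1%:M.
Hypothesis thF : th *m F = 1%:M.
Hypothesis gauge : forall i j, th *m (\matrix_(l, k) r l k i j) = Om i j *m th.
Hypothesis bianchi : forall l k i j, r l k i j + r l i j k + r l j k i = 0.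
Hypothesis Om_skew : forall i j a b, Om i j a b = - Om i j b a.
Hypothesis Om_alt : forall i j a b, Om i j a b = - Om j i a b.

Definition contract2 (T : 'I_n -> 'I_n -> R) (c d : 'I_n) : R :=
  \sum_i \sum_j F i c * F j d * T i j.

(** The curvature tensor e^a(R(E_c, E_d) E_b), when Om i j is the curvature
matrix on the coordinate vectors i and j and F the matrix of the frame. *)
Definition frame_curv (a b c d : 'I_n) : R :=
  contract2 (fun i j => Om i j a b) c d.

Lemma frame_curv_skew a b c d : frame_curv a b c d = - frame_curv b a c d.
Proof.
rewrite /frame_curv /contract2 -sumrN; apply: eq_bigr => i _.
rewrite -sumrN; apply: eq_bigr => j _.
by rewrite Om_skew mulrN.
Qed.

Lemma frame_curv_alt a b c d : frame_curv a b c d = - frame_curv a b d c.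
Proof.
rewrite /frame_curv /contract2 [in RHS]exchange_big -sumrN; apply: eq_bigr => i _.
rewrite -sumrN; apply: eq_bigr => j _.
by rewrite Om_alt mulrN [F i c * _]mulrC.
Qed.

Lemma frame_curv_coord a b c d : frame_curv a b c d =
  \sum_l th a l * \sum_k \sum_i \sum_j F k b * F i c * F j d * r l k i j.
Proof.
have OmE i j : Om i j a b = \sum_l \sum_k th a l * F k b * r l k i j.
  have -> : Om i j = th *m (\matrix_(l, k) r l k i j) *m F.
    by rewrite gauge -mulmxA thF mulmx1.
  rewrite -mulmxA mxE; apply: eq_bigr => l _.
  rewrite mxE mulr_sumr; apply: eq_bigr => k _.
  by rewrite mxE; ring.
rewrite /frame_curv /contract2.
under eq_bigr do under eq_bigr do rewrite OmE mulr_sumr.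
under eq_bigr do rewrite exchange_big.
rewrite exchange_big; apply: eq_bigr => l _; rewrite mulr_sumr.
under eq_bigr do under eq_bigr do rewrite mulr_sumr.
under eq_bigr do rewrite exchange_big.
rewrite exchange_big; apply: eq_bigr => k _; rewrite mulr_sumr.
apply: eq_bigr => i _; rewrite mulr_sumr; apply: eq_bigr => j _.
by ring.
Qed.

(** In coordinates the cyclic sum is a sum over renamed indices of the
coordinate Bianchi identity. *)
Lemma frame_curv_bianchi a b c d :
  frame_curv a b c d + frame_curv a c d b + frame_curv a d b c = 0.
Proof.
rewrite !frame_curv_coord -!big_split big1 // => l _ /=.
rewrite -!mulrDr; apply/eqP; rewrite mulf_eq0; apply/orP; right; apply/eqP.
have -> : \sum_k \sum_i \sum_j F k c * F i d * F j b * r l k i j =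
    \sum_k \sum_i \sum_j F k b * F i c * F j d * r l i j k.
  under eq_bigr do rewrite exchange_big; rewrite exchange_big.
  apply: eq_bigr => k _; apply: eq_bigr => i _; apply: eq_bigr => j _.
  by ring.
have -> : \sum_k \sum_i \sum_j F k d * F i b * F j c * r l k i j =
    \sum_k \sum_i \sum_j F k b * F i c * F j d * r l j k i.
  rewrite exchange_big; under eq_bigr do rewrite exchange_big.
  apply: eq_bigr => k _; apply: eq_bigr => i _; apply: eq_bigr => j _.
  by ring.
rewrite -!big_split big1 // => k _ /=.
rewrite -!big_split big1 // => i _ /=.
rewrite -!big_split big1 // => j _ /=.
by rewrite -!mulrDr bianchi mulr0.
Qed.

(** The usual octahedron argument: the four cyclic sums, one for each choice of
the first index, combine with the two antisymmetries into the pair symmetry. *)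
Lemma frame_curv_pair a b c d : frame_curv a b c d = frame_curv c d a b.
Proof.
have B1 := frame_curv_bianchi a b c d.
have B2 := frame_curv_bianchi b c d a.
have B3 := frame_curv_bianchi c d a b.
have B4 := frame_curv_bianchi d a b c.
have s1 := frame_curv_skew; have s2 := frame_curv_alt.
move: (s1 b a c d) (s1 b a d c) (s1 b c d a) (s1 c a d b) (s1 c a b d)
 (s1 d a b c) (s1 d b c a) (s1 d b a c) (s1 d c a b) (s1 c b a d)
 (s1 d c b a) (s1 b d a c)
 (s2 a b d c) (s2 a c b d) (s2 a c d b)(s2 a d c b) (s2 a d b c) (s2 b c a d) (s2 b c d a)
 (s2 b d c a) (s2 b d a c) (s2 c d b a) (s2 c d a b) (s2 b a d c) (s2 c b a d).
by lra.
Qed.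

(** The Ricci tensor is a trace, hence may be computed in the frame. *)
Lemma ricci_frame (u w : 'I_n -> R) :
  \sum_j \sum_k u j * w k * (\sum_i r i k i j) =
  \sum_d \sum_b (\sum_j th d j * u j) * (\sum_k th b k * w k) *
    \sum_c frame_curv c b c d.
Proof.
(* S is the coordinate Ricci matrix; it transforms by congruence with F. *)
pose S : 'M[R]_n := \matrix_(j, k) \sum_i r i k i j.
have QE d b : \sum_c frame_curv c b c d = (F^T *m S *m F) d b.
  rewrite /frame_curv /contract2.
  have tr i j : \sum_c F i c * Om i j c b = \sum_k r i k i j * F k b.
    have := congr1 (fun M : 'M[R]_n => (F *m M *m F) i b) (gauge i j).
    rewrite /= !mulmxA Fth mul1mx -mulmxA -mulmxA thF mulmx1.
    rewrite [LHS]mxE [RHS]mxE => <-; apply: eq_bigr => k _.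
    by rewrite mxE.
  rewrite exchange_big /=.
  under eq_bigr do rewrite exchange_big.
  rewrite exchange_big /= mxE.
  have -> : \sum_j (F^T *m S) d j * F j b = \sum_k \sum_j \sum_i F j d * (r i k i j * F k b).
    apply: eq_bigr => k _; rewrite mxE mulr_suml; apply: eq_bigr => j _.
    rewrite !mxE mulr_sumr mulr_suml; apply: eq_bigr => i _; ring.
  rewrite [RHS]exchange_big; apply: eq_bigr => j _.
  rewrite [RHS]exchange_big; apply: eq_bigr => i _.
  rewrite -mulr_sumr -tr mulr_sumr; apply: eq_bigr => c _; ring.
pose U : 'cV[R]_n := \col_j u j; pose W : 'cV[R]_n := \col_k w k.
have -> : \sum_j \sum_k u j * w k * (\sum_i r i k i j) = (U^T *m S *m W) 0 0.
  rewrite mxE exchange_big; apply: eq_bigr => k _; rewrite mxE mulr_suml.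
  by apply: eq_bigr => j _; rewrite !mxE; ring.
have -> : U^T *m S *m W = (th *m U)^T *m (F^T *m S *m F) *m (th *m W).
  have FthT : th^T *m F^T = 1%:M by rewrite -trmx_mul Fth trmx1.
  by rewrite trmx_mul !mulmxA -(mulmxA U^T th^T) FthT mulmx1
    -(mulmxA _ F th) Fth mulmx1.
rewrite mxE exchange_big; apply: eq_bigr => b _; rewrite mxE mulr_suml.
apply: eq_bigr => d _; rewrite QE.
have -> : \sum_j th d j * u j = (th *m U) d 0.
  by rewrite mxE; apply: eq_bigr => j _; rewrite mxE.
have -> : \sum_k th b k * w k = (th *m W) b 0.
  by rewrite mxE; apply: eq_bigr => j _; rewrite mxE.
by rewrite [(_^T) 0 d]mxE; ring.
Qed.

End PointCurvature.

Section Contract.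
Variables (R : realType) (n : nat) (F : 'M[R]_n).
Local Notation contract2 := (contract2 F).

Definition contract1 (p : 'I_n -> R) (c : 'I_n) : R := \sum_i F i c * p i.

Lemma contract2D T T' c d :
  contract2 (fun i j => T i j + T' i j) c d = contract2 T c d + contract2 T' c d.
Proof.
rewrite /contract2 -big_split; apply: eq_bigr => i _ /=.
by rewrite -big_split; apply: eq_bigr => j _ /=; rewrite mulrDr.
Qed.

Lemma contract2_eq T T' c d : (forall i j, T i j = T' i j) ->
  contract2 T c d = contract2 T' c d.
Proof. by move=> e; do 2 (apply: eq_bigr => ? _); rewrite e. Qed.

Lemma contract2N T c d : contract2 (fun i j => - T i j) c d = - contract2 T c d.
Proof.
rewrite /contract2 -sumrN; apply: eq_bigr => i _.
by rewrite -sumrN; apply: eq_bigr => j _; rewrite mulrN.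
Qed.

Lemma contract2_tr T c d : contract2 (fun i j => T j i) c d = contract2 T d c.
Proof.
rewrite /contract2 exchange_big; apply: eq_bigr => i _; apply: eq_bigr => j _.
by rewrite [F j c * _]mulrC.
Qed.

Lemma contract2_sum I (r : seq I) (T : I -> 'I_n -> 'I_n -> R) c d :
  contract2 (fun i j => \sum_(e <- r) T e i j) c d = \sum_(e <- r) contract2 (T e) c d.
Proof.
rewrite /contract2 [RHS]exchange_big; apply: eq_bigr => i _.
by rewrite [RHS]exchange_big; apply: eq_bigr => j _; rewrite mulr_sumr.
Qed.

Lemma contract2M p q c d :
  contract2 (fun i j => p i * q j) c d = contract1 p c * contract1 q d.
Proof.
rewrite /contract2 /contract1 mulr_suml; apply: eq_bigr => i _.
by rewrite mulr_sumr; apply: eq_bigr => j _; ring.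
Qed.

Lemma contract2Z a T c d : contract2 (fun i j => a * T i j) c d = a * contract2 T c d.
Proof.
rewrite /contract2 mulr_sumr; apply: eq_bigr => i _.
by rewrite mulr_sumr; apply: eq_bigr => j _; ring.
Qed.

End Contract.

Section PointFrameCurvature.
Variables (R : realType) (n : nat) (th F : 'M[R]_n).
Hypothesis thF : th *m F = 1%:M.
Variables (A dth : 'I_n -> 'M[R]_n) (dA : 'I_n -> 'I_n -> 'M[R]_n).
Variable dAf : 'I_n -> 'I_n -> 'I_n -> 'I_n -> R.

Definition conn_coeff (a b c : 'I_n) : R := contract1 F (fun i => A i a b) c.
Local Notation Af := conn_coeff.

Hypothesis dAE : forall i j a b,
  dA i j a b = \sum_e (dAf i a b e * th e j + Af a b e * dth i e j).
Hypothesis torsion : forall i j a,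
  dth i a j - dth j a i = (A j *m th) a i - (A i *m th) a j.

Lemma contract1_coframe a c : contract1 F (fun i => th a i) c = (a == c)%:R.
Proof.
have /matrixP/(_ a c) := thF; rewrite !mxE => <-.
by apply: eq_bigr => i _; rewrite mulrC.
Qed.

(** On frame vectors, de^a(E_c, E_d) = A_ac(E_d) - A_ad(E_c). *)
Lemma contract2_torsion e c d :
  contract2 F (fun i j => dth i e j - dth j e i) c d = Af e c d - Af e d c.
Proof.
have H c' d' : contract2 F (fun i j => (A j *m th) e i) c' d' = Af e c' d'.
  rewrite (@contract2_eq _ _ _ _ (fun i j => \sum_k th k i * A j e k)); last first.
    by move=> i j; rewrite mxE; apply: eq_bigr => k _; rewrite mulrC.
  rewrite contract2_sum (bigD1 c') //= [X in _ + X]big1 => [|k kc].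
    by rewrite contract2M contract1_coframe eqxx mul1r addr0.
  by rewrite contract2M contract1_coframe (negbTE kc) mul0r.
rewrite (contract2_eq _ _ _ (fun i j => torsion i j e)) contract2D H contract2N.
by rewrite (contract2_tr F (fun i j => (A j *m th) e i)) H.
Qed.

(** Second structure equation Omega = dA + A /\ A evaluated on frame vectors,
where A = A(E_e) e^e: the derivatives of the coefficients A(E_e) give the first
two terms, the differentials of the e^e give the first sum through the torsion
equation, and the commutator gives the last sum. *)
Lemma frame_curv_formula a b c d :
  frame_curv F (fun i j => dA i j - dA j i + (A i *m A j - A j *m A i)) a b c d =
  contract1 F (fun i => dAf i a b d) c - contract1 F (fun i => dAf i a b c) d
  + \sum_e Af a b e * (Af e c d - Af e d c)
  + \sum_e (Af a e c * Af e b d - Af a e d * Af e b c).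
Proof.
have H : forall i j, (dA i j - dA j i + (A i *m A j - A j *m A i)) a b =
    (\sum_e dAf i a b e * th e j + - \sum_e dAf j a b e * th e i)
    + \sum_e Af a b e * (dth i e j - dth j e i)
    + \sum_e (A i a e * A j e b + - (A j a e * A i e b)).
  move=> i j; rewrite !mxE !dAE -!sumrN -!big_split /=.
  by apply: eq_bigr => e _; ring.
have D c' d' : contract2 F (fun i j => \sum_e dAf i a b e * th e j) c' d' =
    contract1 F (fun i => dAf i a b d') c'.
  rewrite contract2_sum (bigD1 d') //= [X in _ + X]big1 => [|k kc].
    by rewrite contract2M contract1_coframe eqxx mulr1 addr0.
  by rewrite contract2M contract1_coframe (negbTE kc) mulr0.
rewrite /frame_curv (contract2_eq _ _ _ H) !contract2D contract2N D.
rewrite (contract2_tr F (fun i j => \sum_e dAf i a b e * th e j)) D.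
congr (_ + _ + _); rewrite contract2_sum; apply: eq_bigr => e _.
  by rewrite contract2Z contract2_torsion.
rewrite contract2D contract2N contract2M.
by rewrite (contract2_tr F (fun i j => A i a e * A j e b)) contract2M.
Qed.

End PointFrameCurvature.

(** The first Bianchi identity for Christoffel symbols c and their derivatives
p depends only on their symmetry in the two lower indices. *)
Lemma bianchi_algebra (R : realType) n (c : 'I_n -> 'I_n -> 'I_n -> R)
    (p : 'I_n -> 'I_n -> 'I_n -> 'I_n -> R) l k i j :
  (forall m a b, c m a b = c m b a) -> (forall d m a b, p d m a b = p d m b a) ->
  (p i l j k - p j l i k + \sum_m (c l i m * c m j k - c l j m * c m i k)) +
  (p j l k i - p k l j i + \sum_m (c l j m * c m k i - c l k m * c m j i)) +
  (p k l i j - p i l k j + \sum_m (c l k m * c m i j - c l i m * c m k j)) = 0.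
Proof.
move=> sc sp; rewrite (sp i l k j) (sp j l i k) (sp k l j i) !sumrB.
have e a b d : \sum_m c l a m * c m b d = \sum_m c l a m * c m d b.
  by apply: eq_bigr => m _; rewrite (sc m b d).
rewrite (e i k j) (e j i k) (e k j i); ring.
Qed.

Lemma skew_curvature (R : realType) n (P Q dP dQ : 'M[R]_n) a b :
  (forall a b, P a b = - P b a) -> (forall a b, Q a b = - Q b a) ->
  (forall a b, dP a b = - dP b a) -> (forall a b, dQ a b = - dQ b a) ->
  (dQ - dP + (P *m Q - Q *m P)) a b = - (dQ - dP + (P *m Q - Q *m P)) b a.
Proof.
move=> sP sQ sdP sdQ; rewrite !mxE (sdP a b) (sdQ a b).
have -> : \sum_j P a j * Q j b = \sum_j Q b j * P j a.
  by apply: eq_bigr => j _; rewrite (sP a j) (sQ j b); ring.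
have -> : \sum_j Q a j * P j b = \sum_j P b j * Q j a.
  by apply: eq_bigr => j _; rewrite (sQ a j) (sP j b); ring.
ring.
Qed.

Lemma sub_swap_entry (R : realType) n (P Q S T : 'M[R]_n) a b :
  (P - Q + (S - T)) a b = - (Q - P + (T - S)) a b.
Proof. by rewrite !mxE; ring. Qed.

Section FrameCurvature.
Variables (R : realType) (n : nat).
Local Notation E := 'rV[R]_n.+1.
Variables (V : set E) (th : E -> 'M[R]_n.+1) (g : tensor E 2).
Hypothesis oV : open V.
Hypothesis sth : smooth_mx V th.
Hypothesis uth : forall x, V x -> th x \in unitmx.
Hypothesis gramE : forall x, V x -> gram g x = (th x)^T *m th x.
Local Notation F := (dual_frame th).
Local Notation Gam := (lc_coord g).
Local Notation A := (lc_frame th g).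

(** The function A_ab(E_c). *)
Definition conn_fun (a b c : 'I_n.+1) (x : E) : R :=
  conn_coeff (F x) (fun i => A i x) a b c.

Definition curv_fun (x : E) := frame_curv (F x) (fun i j => curv_frame th g i j x).

(** The function E_c(A_ab(E_d)). *)
Definition dir_conn (x : E) (c a b d : 'I_n.+1) : R :=
  contract1 (F x) (fun i => partial i (conn_fun a b d) x) c.

Lemma riemann_bianchi l k i j x : V x ->
  riemann g l k i j x + riemann g l i j k x + riemann g l j k i x = 0.
Proof.
move=> Vx.
apply: (@bianchi_algebra R n.+1 (fun m a b => christoffel g m a b x)
  (fun d m a b => partial d (christoffel g m a b) x)).
  by move=> m a b; exact: (christoffel_sym oV gramE).
move=> d m a b; apply: (derive_eq_on _ oV) => // y Vy.
exact: (christoffel_sym oV gramE).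
Qed.

Lemma conn_fun_skew a b c x : V x -> conn_fun a b c x = - conn_fun b a c x.
Proof.
move=> Vx; rewrite /conn_fun /conn_coeff /contract1 -sumrN; apply: eq_bigr => i _.
by rewrite (lc_frame_antisym oV sth uth gramE) // mulrN.
Qed.

Lemma smooth_conn_fun a b c : smooth_on V (conn_fun a b c).
Proof.
apply: smooth_sum => // i _; apply: smooth_mul => //.
  exact: ((smooth_mxP V _).1 (smooth_frame oV sth uth)).
exact: ((smooth_mxP V _).1 (smooth_lc_frame oV sth uth gramE i)).
Qed.

Lemma lc_frame_expand j a b x : V x ->
  A j x a b = \sum_e conn_fun a b e x * th x e j.
Proof.
move=> Vx; rewrite /conn_fun /conn_coeff /contract1.
under eq_bigr do rewrite mulr_suml.
rewrite exchange_big (bigD1 j) //= [X in _ + X]big1 => [|i ij].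
  have e : \sum_k F x j k * th x k j = 1.
    by have /matrixP/(_ j j) := frame_mul_coframe uth Vx; rewrite !mxE eqxx.
  rewrite addr0 -[LHS]mulr1 -e mulr_sumr; apply: eq_bigr => k _; ring.
have e : \sum_k F x i k * th x k j = 0.
  by have /matrixP/(_ i j) := frame_mul_coframe uth Vx; rewrite !mxE (negbTE ij).
rewrite -[RHS](mulr0 (A i x a b)) -[in RHS]e mulr_sumr; apply: eq_bigr => k _; ring.
Qed.

Lemma curv_fun_formula a b c d x : V x -> curv_fun x a b c d =
  dir_conn x c a b d - dir_conn x d a b c
  + \sum_e conn_fun a b e x * (conn_fun e c d x - conn_fun e d c x)
  + \sum_e (conn_fun a e c x * conn_fun e b d x - conn_fun a e d x * conn_fun e b c x).
Proof.
move=> Vx.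
apply: (@frame_curv_formula _ _ (th x) (F x) (coframe_mul_frame uth Vx)
  (fun i => A i x) (fun i => dmx i th x) (fun i j => dmx i (A j) x)
  (fun i a b e => partial i (conn_fun a b e) x)).
- move=> i j a' b'; rewrite dmxE.
  rewrite /partial (@derive_eq_on _ _ _ V _
    (fun y => \sum_e conn_fun a' b' e y * th y e j)) //; last first.
    by move=> y Vy; exact: lc_frame_expand.
  have st := (smooth_mxP V th).1 sth.
  rewrite (derive_sum_on _ _ oV) //; last first.
    by move=> e _; apply: smooth_mul => //; exact: smooth_conn_fun.
  apply: eq_bigr => e _; rewrite (deriveM_on _ (smooth_conn_fun a' b' e) (st e j)) //.
  by rewrite dmxE.
- move=> i j e; rewrite !dmxE.
  exact: (torsion_free oV uth gramE).
Qed.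

Lemma curv_gauge_riemann i j x : V x ->
  th x *m (\matrix_(l, k) riemann g l k i j x) = curv_frame th g i j x *m th x.
Proof. by move=> Vx; exact: (curv_gauge oV sth uth gramE). Qed.

Lemma curv_frame_skew i j a b x : V x ->
  curv_frame th g i j x a b = - curv_frame th g i j x b a.
Proof.
move=> Vx.
have s k p q : A k x p q = - A k x q p by exact: (lc_frame_antisym oV sth uth gramE).
have ds k l p q : dmx k (A l) x p q = - dmx k (A l) x q p.
  rewrite !dmxE /partial -(deriveN_on _ _ Vx); last first.
    exact: ((smooth_mxP V _).1 (smooth_lc_frame oV sth uth gramE l)).
  by apply: (derive_eq_on _ oV) => // y Vy; exact: (lc_frame_antisym oV sth uth gramE).
exact: (skew_curvature _ _ (s i) (s j) (ds j i) (ds i j)).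
Qed.

Lemma curv_frame_alt i j a b x :
  curv_frame th g i j x a b = - curv_frame th g j i x a b.
Proof.
exact: sub_swap_entry.
Qed.

Lemma curv_fun_skew x a b c d : V x -> curv_fun x a b c d = - curv_fun x b a c d.
Proof. by move=> Vx; apply: frame_curv_skew => *; exact: curv_frame_skew. Qed.

Lemma curv_fun_alt x a b c d : V x -> curv_fun x a b c d = - curv_fun x a b d c.
Proof. by move=> Vx; apply: frame_curv_alt => *; exact: curv_frame_alt. Qed.

Lemma curv_fun_bianchi x a b c d : V x ->
  curv_fun x a b c d + curv_fun x a c d b + curv_fun x a d b c = 0.
Proof.
move=> Vx; apply: (frame_curv_bianchi (coframe_mul_frame uth Vx)
  (fun i j => curv_gauge_riemann i j Vx)) => l k i j.
exact: riemann_bianchi.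
Qed.

Lemma curv_fun_pair x a b c d : V x -> curv_fun x a b c d = curv_fun x c d a b.
Proof.
move=> Vx; apply: (frame_curv_pair (coframe_mul_frame uth Vx)
  (fun i j => curv_gauge_riemann i j Vx)).
- by move=> l k i j; exact: riemann_bianchi.
- by move=> *; exact: curv_frame_skew.
- by move=> *; exact: curv_frame_alt.
Qed.

Lemma ricci_in_frame x u w : V x -> ricci g x u w =
  \sum_d \sum_b (\sum_j th x d j * u 0 j) * (\sum_k th x b k * w 0 k) *
    \sum_c curv_fun x c b c d.
Proof.
move=> Vx.
exact: (ricci_frame (frame_mul_coframe uth Vx) (coframe_mul_frame uth Vx)
  (fun i j => curv_gauge_riemann i j Vx) (u 0) (w 0)).
Qed.

End FrameCurvature.

(** * Evaluation of exterior products and derivatives *)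

(** A permutation of n + 1 elements is the image of 0 together with a
permutation of the remaining n. *)
Lemma sum_perm_lift (V : nmodType) n (f : 'S_n.+1 -> V) :
  \sum_s f s = \sum_i \sum_(t : 'S_n) f (lift_perm ord0 i t).
Proof.
pose h (p : 'I_n.+1 * 'S_n) := lift_perm ord0 p.1 p.2.
have h_inj : injective h.
  move=> [i t] [j u]; rewrite /h /= => e.
  have ij : i = j by have := congr1 (fun s : 'S__ => s ord0) e; rewrite !lift_perm_id.
  rewrite ij in e *; congr (_, _); apply/permP => k.
  have := congr1 (fun s : 'S__ => s (lift ord0 k)) e.
  by rewrite !lift_perm_lift; exact: lift_inj.
have h_bij : bijective h.
  by apply: inj_card_bij => //; rewrite card_prod card_ord !card_Sn factS.
by rewrite (reindex h) /=; [rewrite -(pair_bigA _ (fun i t => f (lift_perm ord0 i t)))|exact: onW_bij].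
Qed.

Lemma sum_perm1 (V : nmodType) (f : 'S_1 -> V) : \sum_s f s = f 1%g.
Proof.
rewrite (big_pred1 1%g) // => s /=; apply/esym/eqP/permP => i.
by rewrite !ord1.
Qed.

Section EvalForms.
Variables (R : realType) (E : normedModType R).

(** Expanding along the slot filled by the 1-form turns the normalised sum over
permutations into the familiar alternating sum. *)
Lemma wedge1q q (a : tensor E 1) (b : tensor E q) x (v : (1 + q).-tuple E) :
  wedge a b x v = (q`!)%:R^-1 * \sum_(j : 'I_q.+1) \sum_(t : 'S_q) (-1) ^+ j * (-1) ^+ t *
    (a x [tuple tnth v j] * b x [tuple tnth v (lift j (t k)) | k < q]).
Proof.
rewrite /wedge mul1n; congr (_ * _); rewrite sum_perm_lift.
apply: eq_bigr => j _; apply: eq_bigr => t _.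
rewrite odd_lift_perm /= signr_addb signr_odd; congr (_ * _).
rewrite /otimes; congr (a x _ * b x _); apply: eq_from_tnth => i.
  have -> : i = ord0 by case: i => [[|//] lt]; exact: val_inj.
  rewrite !tnth_mktuple tnth0; congr (tnth v _).
  have -> : lshift q (ord0 : 'I_1) = ord0 :> 'I_(1 + q) by apply: val_inj.
  by rewrite lift_perm_id.
rewrite !tnth_mktuple; congr (tnth v _).
have -> : rshift 1 i = lift ord0 i :> 'I_(1 + q) by apply: val_inj.
by rewrite lift_perm_lift.
Qed.

Lemma wedge11 (a b : tensor E 1) x u w : wedge a b x [tuple u; w] =
  a x [tuple u] * b x [tuple w] - a x [tuple w] * b x [tuple u].
Proof.
rewrite wedge1q invr1 mul1r !big_ord_recl big_ord0 addr0 !sum_perm1.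
rewrite /bump /= odd_perm1 !expr1 !expr0 !mul1r mulr1 mulN1r.
by congr (a x _ * b x _ - a x _ * b x _); apply: eq_from_tnth => i;
  rewrite ?tnth_mktuple ?perm1 !ord1.
Qed.

Lemma wedge12 (a : tensor E 1) (b : tensor E 2) x u v w :
  (forall p q, b x [tuple p; q] = - b x [tuple q; p]) ->
  wedge a b x [tuple u; v; w] =
  a x [tuple u] * b x [tuple v; w] - a x [tuple v] * b x [tuple u; w]
  + a x [tuple w] * b x [tuple u; v].
Proof.
move=> bN; rewrite wedge1q.
have e (j : 'I_3) :
  \sum_(t : 'S_2) (-1) ^+ j * (-1) ^+ t * (a x [tuple tnth [tuple u; v; w] j] *
     b x [tuple tnth [tuple u; v; w] (lift j (t k)) | k < 2]) =
  2 * (-1) ^+ j * (a x [tuple tnth [tuple u; v; w] j] *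
    b x [tuple tnth [tuple u; v; w] (lift j ord0);
               tnth [tuple u; v; w] (lift j (lift ord0 ord0))]).
  rewrite sum_perm_lift !big_ord_recl big_ord0 addr0 !sum_perm1 !odd_lift_perm odd_perm1 /=.
  set z := tnth [tuple u; v; w].
  have -> : [tuple z (lift j (lift_perm ord0 ord0 (1%g : 'S_1) k)) | k < 2] =
      [tuple z (lift j ord0); z (lift j (lift ord0 ord0))].
    apply: eq_from_tnth => -[[|[|//]] lt]; rewrite tnth_mktuple.
      have -> : Ordinal lt = ord0 by apply: val_inj.
      by rewrite lift_perm_id tnth0.
    have -> : Ordinal lt = lift ord0 ord0 by apply: val_inj.
    by rewrite lift_perm_lift perm1.
  have -> : [tuple z (lift j (lift_perm ord0 (lift ord0 ord0) (1%g : 'S_1) k)) | k < 2] =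
      [tuple z (lift j (lift ord0 ord0)); z (lift j ord0)].
    apply: eq_from_tnth => -[[|[|//]] lt]; rewrite tnth_mktuple.
      have -> : Ordinal lt = ord0 by apply: val_inj.
      by rewrite lift_perm_id tnth0.
    have -> : Ordinal lt = lift ord0 ord0 by apply: val_inj.
    rewrite lift_perm_lift perm1 [RHS]/tnth /=; congr z; congr (lift j _).
    exact: val_inj.
  by rewrite [in X in _ + X]bN; ring.
under eq_bigr do rewrite e.
have -> : (2`!)%:R = 2 :> R by [].
rewrite !big_ord_recl big_ord0 addr0 /tnth /=.
by rewrite !expr1 !expr0 [(-1) ^+ _]sqrrN expr1n; field.
Qed.

Lemma tuple2_eta (v : 2.-tuple E) : v = [tuple tnth v 0; tnth v 1].
Proof.
by apply: eq_from_tnth => -[[|[|//]] lt]; rewrite [RHS](tnth_nth 0) /=;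
  congr (tnth v _); apply: val_inj.
Qed.

Lemma tuple3_eta (v : 3.-tuple E) : exists p q r, v = [tuple p; q; r].
Proof.
exists (tnth v 0), (tnth v 1), (tnth v 2%:R).
by apply: eq_from_tnth => -[[|[|[|//]]] lt]; rewrite [RHS](tnth_nth 0) /=;
  congr (tnth v _); apply: val_inj.
Qed.

Lemma otimes11 (a b : tensor E 1) x u w :
  otimes a b x [tuple u; w] = a x [tuple u] * b x [tuple w].
Proof.
by rewrite /otimes; congr (a x _ * b x _); apply: eq_from_tnth => i;
  rewrite !ord1 tnth_mktuple.
Qed.

Lemma face_eq k (a : tensor E k) (v : k.+1.-tuple E) j (w : k.-tuple E) :
  (forall i, tnth v (lift j i) = tnth w i) ->
  (fun y => a y [tuple tnth v (lift j i) | i < k]) = (fun y => a y w).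
Proof.
move=> vw; apply/funext => y; congr (a y _); apply: eq_from_tnth => i.
by rewrite tnth_mktuple.
Qed.

Lemma extd1 (a : tensor E 1) x u w : extd a x [tuple u; w] =
  'D_u (fun y => a y [tuple w]) x - 'D_w (fun y => a y [tuple u]) x.
Proof.
rewrite /extd !big_ord_recl big_ord0 addr0 expr0 expr1 mul1r mulN1r.
rewrite (@face_eq _ a _ _ [tuple w]); last by case=> [[|//] lt].
by rewrite (@face_eq _ a _ _ [tuple u]) //; case=> [[|//] lt].
Qed.

Lemma extd2 (a : tensor E 2) x u v w : extd a x [tuple u; v; w] =
  'D_u (fun y => a y [tuple v; w]) x - 'D_v (fun y => a y [tuple u; w]) x
  + 'D_w (fun y => a y [tuple u; v]) x.
Proof.
rewrite /extd !big_ord_recl big_ord0 addr0 addrA.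
rewrite expr0 expr1 mul1r mulN1r [(-1) ^+ _]sqrrN expr1n mul1r.
rewrite (@face_eq _ a _ _ [tuple v; w]); last by case=> [[|[|//]] lt].
rewrite (@face_eq _ a _ _ [tuple u; w]); last by case=> [[|[|//]] lt].
by rewrite (@face_eq _ a _ _ [tuple u; v]) //; case=> [[|[|//]] lt].
Qed.

Lemma extd3 (a : tensor E 3) x u v w z : extd a x [tuple u; v; w; z] =
  'D_u (fun y => a y [tuple v; w; z]) x - 'D_v (fun y => a y [tuple u; w; z]) x
  + 'D_w (fun y => a y [tuple u; v; z]) x - 'D_z (fun y => a y [tuple u; v; w]) x.
Proof.
rewrite /extd !big_ord_recl big_ord0 addr0 !addrA.
rewrite expr0 expr1 mul1r mulN1r [(-1) ^+ lift _ (lift _ _)]sqrrN expr1n mul1r.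
rewrite [(-1) ^+ _]exprS sqrrN expr1n mulr1 mulN1r.
rewrite (@face_eq _ a _ _ [tuple v; w; z]); last by case=> [[|[|[|//]]] lt].
rewrite (@face_eq _ a _ _ [tuple u; w; z]); last by case=> [[|[|[|//]]] lt].
rewrite (@face_eq _ a _ _ [tuple u; v; z]); last by case=> [[|[|[|//]]] lt].
by rewrite (@face_eq _ a _ _ [tuple u; v; w]) //; case=> [[|[|[|//]]] lt].
Qed.

End EvalForms.

(** * Orthonormal coframes *)

Section RowCoordinates.
Variables (R : realType) (n : nat).
Local Notation E := 'rV[R]_n.+1.

(** A named coordinate function, which can carry a linear structure. *)
Definition row_coord (j : 'I_n.+1) (v : E) : R := v 0 j.

Fact row_coord_is_linear j : linear (row_coord j).
Proof. by move=> a u v; rewrite /row_coord !mxE. Qed.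

HB.instance Definition _ j :=
  GRing.isLinear.Build R E R *%R (row_coord j) (row_coord_is_linear j).

Lemma row_coord_continuous j : continuous (row_coord j).
Proof. exact: coord_continuous. Qed.

Lemma smooth_row_coord (F : normedModType R) (U : set F) (Y : F -> E) j :
  open U -> smooth_on U Y -> smooth_on U (fun x => Y x 0 j).
Proof.
move=> oU sY.
exact: (@smooth_linear _ _ _ _ _ _ (row_coord j) (@row_coord_continuous j) oU sY).
Qed.

Lemma derive_row_coord (F : normedModType R) (U : set F) (Y : F -> E) j x v :
  smooth_on U Y -> U x -> ('D_v Y x) 0 j = 'D_v (fun x => Y x 0 j) x.
Proof.
move=> sY Ux.
have dY := smooth_derivable (v := v) sY Ux.
have [_ e] := is_derive_linear (L := row_coord j) (@row_coord_continuous j) dY.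
by rewrite -[LHS]/(row_coord j _) -e.
Qed.

End RowCoordinates.

Section LinearForms.
Variables (R : realType) (n : nat).
Local Notation E := 'rV[R]_n.+1.
Variable T : 1.-tuple E -> R.
Hypothesis mT : multilinear T.

Lemma tset1 (v : 1.-tuple E) (u : E) : tset v ord0 u = [tuple u].
Proof.
by apply: eq_from_tnth => i; rewrite !ord1 tnth_mktuple eqxx.
Qed.

Lemma form1_linear a u w : T [tuple a *: u + w] = a * T [tuple u] + T [tuple w].
Proof. by have := mT [tuple 0] ord0 a u w; rewrite !tset1. Qed.

Lemma form1D u w : T [tuple u + w] = T [tuple u] + T [tuple w].
Proof. by have := form1_linear 1 u w; rewrite scale1r mul1r. Qed.

Lemma form10 : T [tuple 0] = 0.
Proof. by have := form1D 0 0; rewrite addr0; lra. Qed.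

Lemma form1Z a u : T [tuple a *: u] = a * T [tuple u].
Proof. by have := form1_linear a u 0; rewrite addr0 form10 addr0. Qed.

Lemma form1N u : T [tuple - u] = - T [tuple u].
Proof. by rewrite -scaleN1r form1Z mulN1r. Qed.

Lemma form1_sum I (r : seq I) (f : I -> E) :
  T [tuple \sum_(i <- r) f i] = \sum_(i <- r) T [tuple f i].
Proof.
elim: r => [|i r IHr]; first by rewrite !big_nil form10.
by rewrite !big_cons form1D IHr.
Qed.

Lemma form1_coord u : T [tuple u] = \sum_i T [tuple ebase R i] * u 0 i.
Proof.
have -> : T [tuple u] = T [tuple \sum_i u 0 i *: ebase R i].
  have u_sum : u = \sum_i u 0 i *: ebase R i := row_sum_delta u.
  exact: (congr1 (fun w => T [tuple w]) u_sum).
rewrite form1_sum; apply: eq_bigr => i _; by rewrite form1Z mulrC.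
Qed.

End LinearForms.

Section Coframe.
Variables (R : realType) (n : nat).
Local Notation E := 'rV[R]_n.+1.
Variables (V : set E) (e : 'I_n.+1 -> tensor E 1) (g : tensor E 2).
Hypothesis oV : open V.
Hypothesis se : forall a, smooth_tensor_on V (e a).
Hypothesis free_e : forall x, V x -> forall u, (forall a, e a x [tuple u] = 0) -> u = 0.
Hypothesis gE : forall x u w, V x ->
  g x [tuple u; w] = \sum_a e a x [tuple u] * e a x [tuple w].

Definition coframe_mx (x : E) : 'M[R]_n.+1 :=
  \matrix_(a, i) e a x [tuple ebase R i].
Local Notation th := coframe_mx.

Lemma coframe_lin a x : V x -> multilinear (e a x).
Proof. by move=> Vx; have [+ _] := se a; apply. Qed.

Lemma coframeE a x u : V x -> e a x [tuple u] = \sum_i th x a i * u 0 i.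
Proof.
move=> Vx; rewrite (form1_coord (coframe_lin a Vx)).
by apply: eq_bigr => i _; rewrite mxE.
Qed.

Lemma smooth_coframe a v : smooth_on V (fun x => e a x [tuple v]).
Proof. by have [_] := se a; apply. Qed.

Lemma smooth_coframe_mx : smooth_mx V th.
Proof.
split=> a i; apply: smooth_eq_on (smooth_coframe a (ebase R i)) => // x _.
by rewrite mxE.
Qed.

Lemma coframe_mx_unit x : V x -> th x \in unitmx.
Proof.
move=> Vx; rewrite -unitmx_tr -row_free_unit.
apply: inj_row_free => v vth; apply: (free_e Vx) => a.
rewrite coframeE //; have /matrixP/(_ 0 a) := vth; rewrite !mxE => vth0.
by apply: etrans vth0; apply: eq_bigr => i _; rewrite !mxE mulrC.
Qed.

Lemma gram_coframe x : V x -> gram g x = (th x)^T *m th x.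
Proof.
move=> Vx; apply/matrixP => i j; rewrite !mxE gE //.
by apply: eq_bigr => a _; rewrite !mxE.
Qed.

Definition frame_vec (a : 'I_n.+1) (x : E) : E := \row_i dual_frame th x i a.
Local Notation fv := frame_vec.

Lemma coframe_frame_vec a b x : V x -> e a x [tuple fv b x] = (a == b)%:R.
Proof.
move=> Vx; rewrite coframeE //.
have /matrixP/(_ a b) := coframe_mul_frame coframe_mx_unit Vx; rewrite !mxE => thF.
by apply: etrans thF; apply: eq_bigr => i _; rewrite !mxE.
Qed.

Lemma coframe_inj x u w : V x -> (forall a, e a x [tuple u] = e a x [tuple w]) -> u = w.
Proof.
move=> Vx uw; apply/eqP; rewrite -subr_eq0; apply/eqP; apply: (free_e Vx) => a.
rewrite (form1D (coframe_lin a Vx)) (form1N (coframe_lin a Vx)) uw; exact: subrr.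
Qed.

Lemma frame_expand x u : V x -> u = \sum_a e a x [tuple u] *: fv a x.
Proof.
move=> Vx; apply: (coframe_inj Vx) => a.
rewrite (form1_sum (coframe_lin a Vx)) (bigD1 a) //= [X in _ + X]big1 => [|b ba];
  rewrite (form1Z (coframe_lin a Vx)) coframe_frame_vec //.
  by rewrite (eqxx a) mulr1 addr0.
by rewrite (eq_sym a b) (negbTE ba) mulr0.
Qed.

Local Notation cf := (conn_fun th g).

(** The difference between the Levi-Civita connection of g and the flat
derivative: nabla_u v = D_u v + gamma u v. *)
Definition gamma (x u v : E) : E :=
  \row_k \sum_i \sum_j u 0 i * v 0 j * christoffel g k i j x.

Lemma gamma_sym x u v : V x -> gamma x u v = gamma x v u.
Proof.
move=> Vx; apply/rowP => k; rewrite !mxE exchange_big; apply: eq_bigr => j _.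
apply: eq_bigr => i _.
by rewrite (christoffel_sym oV gram_coframe) // [u 0 i * _]mulrC.
Qed.

Lemma gammaDl x u v w : gamma x (u + v) w = gamma x u w + gamma x v w.
Proof.
apply/rowP => k; rewrite !mxE -big_split; apply: eq_bigr => i _ /=.
by rewrite -big_split; apply: eq_bigr => j _ /=; rewrite !mxE; ring.
Qed.

Lemma gammaZl x a u w : gamma x (a *: u) w = a *: gamma x u w.
Proof.
apply/rowP => k; rewrite !mxE mulr_sumr; apply: eq_bigr => i _ /=.
by rewrite mulr_sumr; apply: eq_bigr => j _ /=; rewrite !mxE; ring.
Qed.

(** nabla e^a = - A_ab e^b, with the flat derivative in place of nabla and the
constant vector v. *)
Lemma derive_coframe a x u v : V x ->
  'D_u (fun y => e a y [tuple v]) x = e a x [tuple gamma x u v] -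
    \sum_c \sum_b e c x [tuple u] * e b x [tuple v] * cf a b c x.
Proof.
move=> Vx; rewrite (derive_partial oV _ (smooth_coframe a v) Vx).
have H i : partial i (fun y => e a y [tuple v]) x =
    \sum_j (th x *m lc_coord g i x) a j * v 0 j -
    \sum_b lc_frame th g i x a b * e b x [tuple v].
  rewrite /partial (@derive_eq_on _ _ _ V _ (fun y => \sum_j v 0 j * th y a j)) //;
    last by move=> y Vy; rewrite coframeE //; apply: eq_bigr => j _; rewrite mulrC.
  have sth := (smooth_mxP V th).1 smooth_coframe_mx.
  rewrite (derive_sum_on _ _ oV) //; last first.
    by move=> j _; apply: smooth_mul => //; exact: smooth_cst.
  have -> : \sum_b lc_frame th g i x a b * e b x [tuple v] =
      \sum_j (lc_frame th g i x *m th x) a j * v 0 j.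
    under eq_bigr do rewrite coframeE // mulr_sumr.
    rewrite exchange_big; apply: eq_bigr => j _; rewrite mxE mulr_suml.
    by apply: eq_bigr => b _; rewrite mulrA.
  rewrite -sumrB; apply: eq_bigr => j _.
  rewrite (deriveM_on _ (smooth_cst (v 0 j : R) oV) (sth a j) Vx) derive_cst mul0r add0r.
  have /matrixP/(_ a j) := dmx_coframe g coframe_mx_unit i Vx.
  rewrite dmxE [RHS]mxE [X in _ + X]mxE /partial => ->.
  by rewrite mulrC mulrBl.
under eq_bigr do rewrite H mulrBr.
rewrite sumrB; congr (_ - _).
  rewrite coframeE //.
  under [RHS]eq_bigr => k _ do rewrite [gamma x u v 0 k]mxE mulr_sumr.
  rewrite [RHS]exchange_big; apply: eq_bigr => i _.
  under [RHS]eq_bigr do rewrite mulr_sumr.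
  rewrite [RHS]exchange_big mulr_sumr; apply: eq_bigr => j _.
  rewrite mxE mulr_suml mulr_sumr; apply: eq_bigr => k _.
  by rewrite [lc_coord _ _ _ _ _]mxE; ring.
under eq_bigr do rewrite mulr_sumr.
rewrite exchange_big [RHS]exchange_big; apply: eq_bigr => b _ /=.
under eq_bigr do rewrite (lc_frame_expand g coframe_mx_unit) // mulr_suml mulr_sumr.
rewrite exchange_big; apply: eq_bigr => c _ /=.
rewrite (coframeE c u Vx) !mulr_suml; apply: eq_bigr => i _; ring.
Qed.

End Coframe.

(** * Linear algebra of the connection of an SU(2)-coframe *)

Local Notation i0 := (@Ordinal 5 0 isT).
Local Notation i1 := (@Ordinal 5 1 isT).
Local Notation i2 := (@Ordinal 5 2 isT).
Local Notation i3 := (@Ordinal 5 3 isT).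
Local Notation i4 := (@Ordinal 5 4 isT).

Lemma ord5_ind (P : 'I_5 -> Prop) :
  P i0 -> P i1 -> P i2 -> P i3 -> P i4 -> forall a, P a.
Proof.
move=> p0 p1 p2 p3 p4 [[|[|[|[|[|m]]]]] lt_m] //;
by rewrite (bool_irrelevance lt_m isT).
Qed.

Lemma ord5_horizontal_ind (P : 'I_5 -> Prop) :
  P i0 -> P i1 -> P i2 -> P i3 -> forall a, a != i4 -> P a.
Proof. by move=> p0 p1 p2 p3; elim/ord5_ind. Qed.

Lemma sum5 (V : nmodType) (f : 'I_5 -> V) :
  \sum_e f e = f i0 + f i1 + f i2 + f i3 + f i4.
Proof.
rewrite !big_ord_recl big_ord0 addr0 !addrA.
by congr (_ + _ + _ + _ + _); congr f; apply: val_inj.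
Qed.

Section Algebra5.
Variable R : realType.

(** W1, W2, W3 are the coefficients of omega_1 = e^01 + e^23,
omega_2 = e^02 - e^13 and omega_3 = e^03 + e^12. *)
Definition W1 (a b : 'I_5) : R := match val a, val b with
  | 0%N, 1%N => 1 | 1%N, 0%N => -1 | 2%N, 3%N => 1 | 3%N, 2%N => -1 | _, _ => 0 end.
Definition W2 (a b : 'I_5) : R := match val a, val b with
  | 0%N, 2%N => 1 | 2%N, 0%N => -1 | 1%N, 3%N => -1 | 3%N, 1%N => 1 | _, _ => 0 end.
Definition W3 (a b : 'I_5) : R := match val a, val b with
  | 0%N, 3%N => 1 | 3%N, 0%N => -1 | 1%N, 2%N => 1 | 2%N, 1%N => -1 | _, _ => 0 end.

Lemma W1_skew a b : W1 a b = - W1 b a.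
Proof. by elim/ord5_ind: a; elim/ord5_ind: b; rewrite /W1 /= ?opprK ?oppr0. Qed.

Lemma W2_skew a b : W2 a b = - W2 b a.
Proof. by elim/ord5_ind: a; elim/ord5_ind: b; rewrite /W2 /= ?opprK ?oppr0. Qed.

Lemma W3_skew a b : W3 a b = - W3 b a.
Proof. by elim/ord5_ind: a; elim/ord5_ind: b; rewrite /W3 /= ?opprK ?oppr0. Qed.

Variable A : 'I_5 -> 'I_5 -> 'I_5 -> R.
Hypothesis A_skew : forall a b c, A a b c = - A b a c.

(** When A a b c = A_ab(E_c), this is (nabla_{E_p} w)(E_q, E_r) for the 2-form w
with constant coefficients W. *)
Definition nabla_form (W : 'I_5 -> 'I_5 -> R) (p q r : 'I_5) : R :=
  \sum_a (A q a p * W a r - W q a * A a r p).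
(** By vanishing torsion this is dw(E_p, E_q, E_r). *)
Definition cyc (W : 'I_5 -> 'I_5 -> R) (p q r : 'I_5) : R :=
  nabla_form W p q r + nabla_form W q r p + nabla_form W r p q.

Hypothesis H1 : forall b c, A i4 b c - A i4 c b = - 2 * W1 b c.
Hypothesis H2 : forall p q r, cyc W1 p q r = 0.

Lemma A_diag a c : A a a c = 0.
Proof. by have := A_skew a a c; lra. Qed.

(** With H1, the sum of d omega_1 = 0 over the planes (0, 1) and (2, 3)
completed by the Reeb direction is the trace of nabla xi; all transverse
connection coefficients cancel. *)
Lemma shape_trace0 : \sum_c A c i4 c = 0.
Proof.
(* These are the two planes on which omega_1 does not vanish. *)
have := H2 i0 i1 i4; have := H2 i2 i3 i4.
have := H1 i0 i1; have := H1 i2 i3.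
rewrite /cyc /nabla_form !sum5 /W1 /=.
rewrite !A_diag !(A_skew i4 i0) !(A_skew i4 i1) !(A_skew i4 i2) !(A_skew i4 i3) !(A_skew i1 i0)
  !(A_skew i2 i0) !(A_skew i2 i1)
 !(A_skew i3 i0) !(A_skew i3 i1) !(A_skew i3 i2).
by lra.
Qed.

(** The Reeb field is geodesic, since iota_xi d alpha = 0 and |xi| = 1. *)
Lemma shape_vertical a : A a i4 i4 = 0.
Proof.
have := H1 a i4; rewrite A_diag (A_skew i4 a).
have -> : W1 a i4 = 0 by rewrite /W1; elim/ord5_ind: a.
by lra.
Qed.

(** Write nabla xi = W1 + S; H1 makes S symmetric.  Then tr(W1 S) = 0, so
tr((nabla xi)^2) = tr(W1^2) + tr(S^2) = -4 + |S|^2, and the value -4 forces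
S = 0. *)
Lemma shape_rigid : \sum_a \sum_c A a i4 c * A c i4 a = -4 ->
  forall a c, A a i4 c = W1 a c.
Proof.
move=> H; pose S a c := A a i4 c - W1 a c.
have W1s a c : W1 a c = - W1 c a.
  by elim/ord5_ind: a; elim/ord5_ind: c; rewrite /W1 /=; lra.
have Ss a c : S a c = S c a.
  rewrite /S; have := H1 a c; rewrite (A_skew i4 a) (A_skew i4 c).
  by have := W1s a c; lra.
have AE a c : A a i4 c = W1 a c + S a c by rewrite /S; ring.
have S2 : \sum_a \sum_c S a c ^+ 2 = 0.
  have WW : \sum_a \sum_c W1 a c * W1 c a = -4.
    by rewrite !sum5 /W1 /=; lra.
  have WS : \sum_a \sum_c W1 a c * S c a = 0.
    rewrite !sum5 /W1 /=.
    have := Ss i0 i1; have := Ss i2 i3; lra.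
  have WS' : \sum_a \sum_c S a c * W1 c a = 0.
    rewrite !sum5 /W1 /=.
    have := Ss i0 i1; have := Ss i2 i3; lra.
  have : \sum_a \sum_c A a i4 c * A c i4 a =
     \sum_a \sum_c W1 a c * W1 c a + \sum_a \sum_c W1 a c * S c a +
     \sum_a \sum_c S a c * W1 c a + \sum_a \sum_c S a c ^+ 2.
    rewrite -!big_split; apply: eq_bigr => a _; rewrite -!big_split.
    by apply: eq_bigr => c _ /=; rewrite !AE (Ss c a); ring.
  by rewrite H WW WS WS'; lra.
move=> a c; rewrite AE.
have /psumr_eq0P := S2 => /(_ (fun a _ => sumr_ge0 _ (fun c _ => sqr_ge0 _))).
move=> /(_ a isT) /psumr_eq0P => /(_ (fun c _ => sqr_ge0 _)) /(_ c isT) /eqP.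
by rewrite sqrf_eq0 => /eqP ->; rewrite addr0.
Qed.

Hypothesis A4 : forall a c, A a i4 c = W1 a c.
Hypothesis H3 : forall p q r, p != i4 -> q != i4 -> r != i4 ->
  cyc W2 p q r = 0 /\ cyc W3 p q r = 0.

Let A_low := (A_diag, A_skew i4 i0, A_skew i4 i1, A_skew i4 i2, A_skew i4 i3,
  A_skew i1 i0, A_skew i2 i0, A_skew i2 i1, A_skew i3 i0, A_skew i3 i1, A_skew i3 i2).

(** Three closed forms on the four-dimensional horizontal space give twelve
linear equations for the twelve horizontal values of the three self-dual
combinations A_02 - A_13, A_03 + A_12, A_01 + A_23 of the connection forms, and
this system has only the zero solution. *)
Lemma transverse_kahler_horizontal c : c != i4 ->
  [/\ A i0 i2 c = A i1 i3 c, A i0 i3 c = - A i1 i2 c & A i0 i1 c + A i2 i3 c = 0].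
Proof.
move=> c4; (* One equation for each of the four horizontal triples and each form. *)
have [p2 p3] := H3 (p := i0) (q := i1) (r := i2) isT isT isT.
have [q2 q3] := H3 (p := i0) (q := i1) (r := i3) isT isT isT.
have [r2 r3] := H3 (p := i0) (q := i2) (r := i3) isT isT isT.
have [s2 s3] := H3 (p := i1) (q := i2) (r := i3) isT isT isT.
move: p2 p3 q2 q3 r2 r3 s2 s3.
move: (H2 i0 i1 i2) (H2 i0 i1 i3) (H2 i0 i2 i3) (H2 i1 i2 i3).
rewrite /cyc /nabla_form !sum5 !A_low !A4 /W1 /W2 /W3 /=.
move=> *; move: c c4; apply: ord5_horizontal_ind; split; lra.
Qed.

(** In the Reeb direction only omega_1 is closed, which leaves A_01 + A_23
undetermined. *)
Lemma transverse_kahler_vertical :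
  A i0 i2 i4 = A i1 i3 i4 /\ A i0 i3 i4 = - A i1 i2 i4.
Proof.
move: (H2 i0 i2 i4) (H2 i0 i3 i4).
rewrite /cyc /nabla_form !sum5 !A_low !A4 /W1 /=.
by move=> *; split=> //; lra.
Qed.

End Algebra5.

Section CurvatureAlgebra.
Variables (R : realType) (A : 'I_5 -> 'I_5 -> 'I_5 -> R).
Variable D : 'I_5 -> 'I_5 -> 'I_5 -> 'I_5 -> R.
Variable K : 'I_5 -> 'I_5 -> 'I_5 -> 'I_5 -> R.
Hypothesis A_skew : forall a b c, A a b c = - A b a c.
Hypothesis A4 : forall a c, A a i4 c = W1 R a c.
Hypothesis A13 : forall c, A i1 i3 c = A i0 i2 c.
Hypothesis A12 : forall c, A i1 i2 c = - A i0 i3 c.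
Hypothesis A23 : forall c, c != i4 -> A i2 i3 c = - A i0 i1 c.
Hypothesis D4 : forall c a d, D c a i4 d = 0.
Hypothesis D13 : forall c d, D c i1 i3 d = D c i0 i2 d.
Hypothesis D12 : forall c d, D c i1 i2 d = - D c i0 i3 d.
Hypothesis D23 : forall c d, d != i4 -> D c i2 i3 d = - D c i0 i1 d.
Hypothesis KE : forall a b c d, K a b c d =
  D c a b d - D d a b c + \sum_e A a b e * (A e c d - A e d c)
  + \sum_e (A a e c * A e b d - A a e d * A e b c).
Hypothesis K_skew : forall a b c d, K a b c d = - K b a c d.
Hypothesis K_alt : forall a b c d, K a b c d = - K a b d c.
Hypothesis K_pair : forall a b c d, K a b c d = K c d a b.
Hypothesis K_bianchi : forall a b c d, K a b c d + K a c d b + K a d b c = 0.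

Let f : R := A i0 i1 i4 + A i2 i3 i4.

Let A23' : (A i2 i3 i0 = - A i0 i1 i0) * (A i2 i3 i1 = - A i0 i1 i1) *
  (A i2 i3 i2 = - A i0 i1 i2) * (A i2 i3 i3 = - A i0 i1 i3) *
  (A i2 i3 i4 = f - A i0 i1 i4).
Proof. by split; [do 3?split; rewrite A23 | rewrite /f; ring]. Qed.

Let A_low := (A_diag A_skew, A_skew i4 i0, A_skew i4 i1, A_skew i4 i2, A_skew i4 i3,
  A_skew i1 i0, A_skew i2 i0, A_skew i2 i1, A_skew i3 i0, A_skew i3 i1, A_skew i3 i2).
Let A_norm := (A4, A13, A12, A23').

(** R(E_c, E_d) xi = alpha(E_d) E_c - alpha(E_c) E_d.  As nabla xi has
constant coefficients W1, no derivative of the connection occurs. *)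
Lemma curv_reeb a c d : a != i4 ->
  K a i4 c d = ((a == c) && (d == i4))%:R - ((a == d) && (c == i4))%:R.
Proof.
move=> a4; rewrite KE !D4 subrr add0r.
under eq_bigr do rewrite A4.
under [X in _ + X = _]eq_bigr do rewrite !A4.
rewrite !sum5; move: a a4.
apply: ord5_horizontal_ind; elim/ord5_ind: c; elim/ord5_ind: d;
  rewrite /W1 /= ?A_low ?A_norm /W1 /=; ring.
Qed.

(** curv_W2, curv_W3 and curv_W1 compute the curvature paired with omega_2,
omega_3 and omega_1.  Here A_02 - A_13 = 0, so neither derivatives nor torsion
contribute; the curvature consists of the commutator term, in which the
contribution of the Reeb direction, A_a4 = W1, is what remains. *)
Lemma curv_W2 c d : K i0 i2 c d - K i1 i3 c d = W2 R c d.
Proof.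
rewrite !KE !D13.
under [X in _ - (_ + X + _)]eq_bigr do rewrite A13.
rewrite !sum5 ?A_low ?A_norm.
elim/ord5_ind: c; elim/ord5_ind: d; rewrite ?A_norm /W1 /W2 /=; ring.
Qed.

Lemma curv_W3 c d : K i0 i3 c d + K i1 i2 c d = W3 R c d.
Proof.
rewrite !KE !D12 !sum5 ?A_low ?A_norm.
elim/ord5_ind: c; elim/ord5_ind: d; rewrite ?A_norm /W1 /W3 /=; ring.
Qed.

(** Here A_01 + A_23 = f alpha, whose differential is - 2 f omega_1 on
horizontal vectors; the commutator with the Reeb direction contributes the
remaining - omega_1. *)
Lemma curv_W1 c d : c != i4 -> d != i4 ->
  K i0 i1 c d + K i2 i3 c d = - (2 * f + 1) * W1 R c d.
Proof.
move=> c4 d4; rewrite !KE !D23 // !sum5.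
move: c c4; apply: ord5_horizontal_ind; move: d d4; apply: ord5_horizontal_ind;
rewrite ?A_low ?A_norm /W1 /=; ring.
Qed.

Lemma ricci_reeb c d : K c i4 c d = ((c != i4) && (d == i4))%:R.
Proof.
have [->|c4] := eqVneq c i4; first by have := K_skew i4 i4 i4 d; rewrite /=; lra.
by rewrite curv_reeb // (negbTE c4) eqxx andbF subr0.
Qed.

Lemma K_diag a c d : K a a c d = 0.
Proof. by have := K_skew a a c d; lra. Qed.

Lemma K_alt_diag a b c : K a b c c = 0.
Proof. by have := K_alt a b c c; lra. Qed.

Let K13 c d : K i1 i3 c d = K i0 i2 c d - W2 R c d.
Proof. by rewrite -(curv_W2 c d); ring. Qed.

Let K12 c d : K i1 i2 c d = W3 R c d - K i0 i3 c d.
Proof. by rewrite -(curv_W3 c d); ring. Qed.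

Let K23 c d : c != i4 -> d != i4 -> K i2 i3 c d = - (2 * f + 1) * W1 R c d - K i0 i1 c d.
Proof. by move=> c4 d4; rewrite -(curv_W1 c4 d4); ring. Qed.

Let K13' c d : K c d i1 i3 = K i0 i2 c d - W2 R c d.
Proof. by rewrite K_pair K13. Qed.

Let K12' c d : K c d i1 i2 = W3 R c d - K i0 i3 c d.
Proof. by rewrite K_pair K12. Qed.

Let K23' c d : c != i4 -> d != i4 -> K c d i2 i3 = - (2 * f + 1) * W1 R c d - K i0 i1 c d.
Proof. by move=> c4 d4; rewrite K_pair K23. Qed.

(** By curv_W2, curv_W3, curv_W1 and pair symmetry, all transverse components
are expressed through K_01.., K_02.., K_03.. .  Off the diagonal the
horizontal trace then cancels, and each diagonal entry is a combination of the
components K_0123, K_0231, K_0312 that the first Bianchi identity evaluates. *)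
Lemma ricci_horizontal d b : d != i4 -> b != i4 ->
  \sum_c K c b c d = (if d == b then 2 - 2 * f else 0).
Proof.
move=> d4 b4; rewrite sum5.
have -> : K i4 b i4 d = (b == d)%:R.
  by rewrite K_skew K_alt opprK curv_reeb // eqxx andbT (negbTE d4) andbF subr0.
have := K_bianchi i0 i1 i2 i3.
rewrite K23' // (K_alt i0 i2 i3 i1) K13' K12' /W1 /W2 /W3 /=.
have := K_pair i0 i1 i0 i2; have := K_pair i0 i1 i0 i3; have := K_pair i0 i2 i0 i3.
move: d d4; apply: ord5_horizontal_ind; move: b b4; apply: ord5_horizontal_ind;
  rewrite ?K_diag ?K_alt_diag ?(K_skew i1 i0) ?(K_skew i2 i0) ?(K_skew i2 i1)
   ?(K_skew i3 i0) ?(K_skew i3 i1) ?(K_skew i3 i2) ?(K_alt _ _ i1 i0)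
   ?(K_alt _ _ i2 i0) ?(K_alt _ _ i2 i1) ?(K_alt _ _ i3 i0) ?(K_alt _ _ i3 i1)
   ?(K_alt _ _ i3 i2) ?K13 ?K12
   ?K23 // ?K13' ?K12' ?K23' // /W1 /W2 /W3 /=; lra.
Qed.

Lemma ricci_alpha_einstein d b : \sum_c K c b c d =
  (if d == b then if d == i4 then 4 else 2 - 2 * f else 0).
Proof.
have reeb e : \sum_c K c i4 c e = if e == i4 then 4 else 0.
  under eq_bigr do rewrite ricci_reeb.
  by rewrite sum5 /=; case: (e == i4) => /=; lra.
have [->|b4] := eqVneq b i4; first by rewrite reeb; case: (d == i4).
have [->|d4] := eqVneq d i4; last by rewrite ricci_horizontal.
rewrite eq_sym (negbTE b4); under eq_bigr do rewrite K_pair.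
by rewrite reeb (negbTE b4).
Qed.

(** (nabla_u omega_1)(v, w) = g(u, v) alpha(w) - alpha(v) g(u, w): transversally
omega_1 is parallel, because rotating by A_01 + A_23 fixes it, and the mixed
components come from nabla xi. *)
Lemma nabla_W1 a d c : \sum_b (A a b c * W1 R b d - W1 R a b * A b d c) =
  (a == c)%:R * (d == i4)%:R - (a == i4)%:R * (c == d)%:R.
Proof.
rewrite sum5; elim/ord5_ind: a; elim/ord5_ind: d; rewrite ?A_low ?A_norm;
  elim/ord5_ind: c; rewrite ?A_norm /W1 /=; ring.
Qed.

End CurvatureAlgebra.

(** * Adapted coframes of a contact-Hypo structure *)

Section CyclicAlgebra.
Variables (R : realType) (A G X : 'I_5 -> 'I_5 -> 'I_5 -> R) (W : 'I_5 -> 'I_5 -> R).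
Hypothesis A_skew : forall a b c, A a b c = - A b a c.
Hypothesis G_sym : forall a b c, G a b c = G a c b.
Hypothesis XE : forall a b c, X a b c = G a b c - A a b c.
Hypothesis W_skew : forall a b, W a b = - W b a.

(** The flat derivative along E_p of a 2-form with constant coefficients W, at
the pair (E_q, E_r), when X a b c = E_c(e^a(E_b)) with E_b frozen at the
point. *)
Definition frame_derivative (p q r : 'I_5) : R :=
  \sum_a \sum_b W a b * (X a q p * (b == r)%:R + (a == q)%:R * X b r p).

Lemma frame_derivativeE p q r :
  frame_derivative p q r = \sum_a (W a r * X a q p + W q a * X a r p).
Proof.
rewrite /frame_derivative big_split /=.
under eq_bigr do under eq_bigr do rewrite mulrDr.
under eq_bigr do rewrite big_split.
rewrite big_split /=; congr (_ + _).
  apply: eq_bigr => a _; rewrite (bigD1 r) //= eqxx mulr1 big1 ?addr0 //.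
  by move=> b br; rewrite (negbTE br) !mulr0.
rewrite exchange_big; apply: eq_bigr => b _ /=.
rewrite (bigD1 q) //= eqxx mul1r big1 ?addr0 //.
by move=> a aq; rewrite (negbTE aq) mul0r mulr0.
Qed.

(** In a cyclic sum the symmetric part G of X drops out, so the exterior
derivative sees only the connection forms. *)
Lemma frame_derivative_cyc p q r :
  frame_derivative p q r - frame_derivative q p r + frame_derivative r p q =
  cyc A W p q r.
Proof.
rewrite !frame_derivativeE /cyc /nabla_form -sumrB -!big_split.
apply: eq_bigr => a _ /=; rewrite !XE.
rewrite (G_sym a q p) (G_sym a r p) (G_sym a q r).
rewrite (W_skew r a) (W_skew q a) (W_skew p a) (A_skew q a) (A_skew r a) (A_skew p a).
ring.
Qed.

End CyclicAlgebra.

Lemma one_survivor (R : realType) (x1 x2 x3 y3 d1 d2 d3 : R) :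
  x1 * 0 + false%:R * d1 - (x2 * 0 + false%:R * d2) + (x3 * y3 + true%:R * d3) =
  x3 * y3 + d3.
Proof. by rewrite /=; ring. Qed.

Lemma no_survivor (R : realType) (x1 x2 x3 y1 y2 y3 d1 d2 d3 : R) :
  x1 * y1 + false%:R * d1 - (x2 * y2 + false%:R * d2) + (x3 * y3 + false%:R * d3) =
  x1 * y1 - x2 * y2 + x3 * y3.
Proof. by rewrite /=; ring. Qed.

Section AdaptedFrame.
Variable R : realType.
Local Notation E := 'rV[R]_5.
Variables (V : set E) (e : 'I_5 -> tensor E 1) (g w1 w2 w3 : tensor E 2).
Hypothesis oV : open V.
Hypothesis se : forall a, smooth_tensor_on V (e a).
Hypothesis free_e : forall x, V x -> forall u, (forall a, e a x [tuple u] = 0) -> u = 0.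
Hypothesis gE : forall x u w, V x ->
  g x [tuple u; w] = \sum_a e a x [tuple u] * e a x [tuple w].

Definition has_coeffs (w : tensor E 2) (W : 'I_5 -> 'I_5 -> R) :=
  forall x u v, V x ->
  w x [tuple u; v] = \sum_a \sum_b W a b * (e a x [tuple u] * e b x [tuple v]).

Hypothesis w1E : has_coeffs w1 (W1 R).
Hypothesis w2E : has_coeffs w2 (W2 R).
Hypothesis w3E : has_coeffs w3 (W3 R).
Local Notation alpha := (e i4).
Hypothesis d_alpha : forall x u v, V x ->
  extd alpha x [tuple u; v] = - 2 * w1 x [tuple u; v].
Hypothesis d_w1 : forall x u v w, V x -> extd w1 x [tuple u; v; w] = 0.
Hypothesis d_alpha_w2 : forall x u v w z, V x ->
  extd (wedge alpha w2) x [tuple u; v; w; z] = 0.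
Hypothesis d_alpha_w3 : forall x u v w z, V x ->
  extd (wedge alpha w3) x [tuple u; v; w; z] = 0.

Local Notation th := (coframe_mx e).
Local Notation fv := (frame_vec e).
Local Notation A x := (fun a b c => conn_fun th g a b c x).

Let sth := smooth_coframe_mx oV se.
Let uth := coframe_mx_unit se free_e.
Let gramE := gram_coframe gE.

Let A_skew x : V x -> forall a b c, A x a b c = - A x b a c.
Proof. by move=> Vx a b c; exact: (conn_fun_skew oV sth uth gramE). Qed.

Definition frame_gamma x (a b c : 'I_5) := e a x [tuple gamma g x (fv c x) (fv b x)].
Definition frame_deriv x (a b c : 'I_5) :=
  'D_(fv c x) (fun y => e a y [tuple fv b x]) x.

Lemma frame_gamma_sym x a b c : V x -> frame_gamma x a b c = frame_gamma x a c b.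
Proof. by move=> Vx; rewrite /frame_gamma (gamma_sym oV gE). Qed.

Lemma frame_derivE x a b c : V x ->
  frame_deriv x a b c = frame_gamma x a b c - A x a b c.
Proof.
move=> Vx; rewrite /frame_deriv (derive_coframe g oV se free_e) //.
congr (_ - _); rewrite (bigD1 c) //= [X in _ + X]big1 => [|c' cc'].
  rewrite (bigD1 b) //= [X in _ + X + _]big1 => [|b' bb'].
    rewrite !(coframe_frame_vec se free_e) //.
    by rewrite (eqxx b) (eqxx c) !mul1r !addr0.
  by rewrite !(coframe_frame_vec se free_e) // (negbTE bb') mulr0 mul0r.
apply: big1 => b' _; rewrite !(coframe_frame_vec se free_e) //.
by rewrite (negbTE cc') !mul0r.
Qed.

Lemma derive_form2 w W x u v z : has_coeffs w W -> V x ->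
  'D_z (fun y => w y [tuple u; v]) x = \sum_a \sum_b W a b *
    ('D_z (fun y => e a y [tuple u]) x * e b x [tuple v] +
     e a x [tuple u] * 'D_z (fun y => e b y [tuple v]) x).
Proof.
move=> wE Vx.
rewrite (@derive_eq_on _ _ _ V _ (fun y =>
  \sum_a \sum_b W a b * (e a y [tuple u] * e b y [tuple v]))) //; last first.
  by move=> y Vy; rewrite wE.
have sc (r : R) : smooth_on V (fun _ : E => r) by exact: smooth_cst.
have sev a t := smooth_coframe se a t.
have sab a b : smooth_on V (fun y => W a b * (e a y [tuple u] * e b y [tuple v])).
  by apply: smooth_mul => //; apply: smooth_mul.
rewrite (derive_sum_on _ _ oV) //; last by move=> a _; exact: smooth_sum.
apply: eq_bigr => a _; rewrite (derive_sum_on _ _ oV) //; apply: eq_bigr => b _.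
rewrite (deriveM_on _ (sc (W a b))) //; last exact: smooth_mul.
by rewrite derive_cst mul0r add0r (deriveM_on _ (sev a u) (sev b v)).
Qed.

Lemma derive_form2_frame w W x p q r : has_coeffs w W -> V x ->
  'D_(fv p x) (fun y => w y [tuple fv q x; fv r x]) x =
  frame_derivative (frame_deriv x) W p q r.
Proof.
move=> wE Vx; rewrite (derive_form2 _ _ _ wE Vx).
apply: eq_bigr => a _; apply: eq_bigr => b _.
by rewrite !(coframe_frame_vec se free_e).
Qed.

Lemma extd_frame w W x p q r : has_coeffs w W -> V x ->
  (forall a b, W a b = - W b a) ->
  extd w x [tuple fv p x; fv q x; fv r x] = cyc (A x) W p q r.
Proof.
move=> wE Vx W_skew; rewrite extd2 !(derive_form2_frame _ _ _ wE Vx).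
apply: (frame_derivative_cyc (G := frame_gamma x)) => //.
- exact: A_skew.
- by move=> *; exact: frame_gamma_sym.
- by move=> *; exact: frame_derivE.
Qed.

Lemma form2_frame w W x a b : has_coeffs w W -> V x ->
  w x [tuple fv a x; fv b x] = W a b.
Proof.
move=> wE Vx; rewrite wE //.
rewrite (bigD1 a) //= [X in _ + X]big1 => [|a' aa'].
  rewrite (bigD1 b) //= [X in _ + X + _]big1 => [|b' bb'].
    rewrite !(coframe_frame_vec se free_e) //.
    by rewrite (eqxx a) (eqxx b) !mulr1 !addr0.
  by rewrite !(coframe_frame_vec se free_e) // (negbTE bb') !mulr0.
apply: big1 => b' _; rewrite !(coframe_frame_vec se free_e) //.
by rewrite (negbTE aa') mul0r mulr0.
Qed.

(** The kernel of omega_1 is spanned by E_4, and alpha fixes the multiple. *)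
Lemma reeb_frame x z : V x -> alpha x [tuple z] = 1 ->
  (forall v, w1 x [tuple z; v] = 0) -> z = fv i4 x.
Proof.
move=> Vx az wz; apply: (coframe_inj se free_e Vx) => a.
rewrite (coframe_frame_vec se free_e) //.
have H b : \sum_a W1 R a b * e a x [tuple z] = 0.
  rewrite -[RHS](wz (fv b x)) w1E //; apply: eq_bigr => c _.
  rewrite (bigD1 b) //= big1 => [|d db].
    by rewrite (coframe_frame_vec se free_e) // (eqxx b) mulr1 addr0.
  by rewrite (coframe_frame_vec se free_e) // (negbTE db) !mulr0.
elim/ord5_ind: a => //=.
- by have := H i1; rewrite sum5 /W1 /=; lra.
- by have := H i0; rewrite sum5 /W1 /=; lra.
- by have := H i3; rewrite sum5 /W1 /=; lra.
- by have := H i2; rewrite sum5 /W1 /=; lra.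
Qed.

(** The defining property omega_1(u, J_1 v) = g^T(u, v) determines the horizontal
part of J_1 v, because W1 is invertible there with W1^2 = -1. *)
Lemma transverse_J_frame x (Jx : E -> E) : V x ->
  (forall c u v, Jx (c *: u + v) = c *: Jx u + Jx v) -> Jx (fv i4 x) = 0 ->
  (forall v, alpha x [tuple v] = 0 -> alpha x [tuple Jx v] = 0) ->
  (forall u v, alpha x [tuple u] = 0 -> alpha x [tuple v] = 0 ->
     w1 x [tuple u; Jx v] = g x [tuple u; v] - alpha x [tuple u] * alpha x [tuple v]) ->
  forall v a, e a x [tuple Jx v] = - \sum_b W1 R a b * e b x [tuple v].
Proof.
move=> Vx Jlin J4 alJ wJ.
have J0 : Jx 0 = 0.
  have := Jlin 1 0 0; rewrite !scale1r addr0 => /eqP.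
  by rewrite -subr_eq subrr eq_sym => /eqP.
have Jsum a (r : seq 'I_5) (h : 'I_5 -> R) :
    e a x [tuple Jx (\sum_(b <- r) h b *: fv b x)] =
    \sum_(b <- r) h b * e a x [tuple Jx (fv b x)].
  have la := coframe_lin se a Vx.
  elim: r => [|b r IHr]; first by rewrite !big_nil J0 (form10 la).
  by rewrite !big_cons Jlin (form1_linear la) IHr.
have al4 b : b != i4 -> alpha x [tuple fv b x] = 0.
  by move=> b4; rewrite (coframe_frame_vec se free_e) // eq_sym (negbTE b4).
have wfv c z : w1 x [tuple fv c x; z] = \sum_d W1 R c d * e d x [tuple z].
  rewrite w1E // (bigD1 c) //= [X in _ + X]big1 => [|c' cc'].
    rewrite addr0; apply: eq_bigr => d _.
    by rewrite (coframe_frame_vec se free_e) // (eqxx c) mul1r.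
  by apply: big1 => d _; rewrite (coframe_frame_vec se free_e) // (negbTE cc') mul0r mulr0.
have H c b : c != i4 -> b != i4 ->
    \sum_d W1 R c d * e d x [tuple Jx (fv b x)] = (c == b)%:R.
  move=> c4 b4; rewrite -wfv wJ ?al4 // mul0r subr0 gE //.
  rewrite (bigD1 b) //= big1 => [|d db].
    by rewrite !(coframe_frame_vec se free_e) // (eqxx b) mulr1 addr0 eq_sym.
  by rewrite [X in _ * X](coframe_frame_vec se free_e) // (negbTE db) mulr0.
have JE' a b : e a x [tuple Jx (fv b x)] = - W1 R a b.
  have [->|b4] := eqVneq b i4.
    rewrite J4 (form10 (coframe_lin se a Vx)).
    by rewrite /W1; elim/ord5_ind: a; rewrite /= oppr0.
  move: (H i0 b isT b4) (H i1 b isT b4) (H i2 b isT b4) (H i3 b isT b4)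
    (alJ _ (al4 b b4)); rewrite !sum5 /W1.
  by elim/ord5_ind: a; move: b b4; apply: ord5_horizontal_ind => /=;
    move: (e i0 x _) (e i1 x _) (e i2 x _) (e i3 x _) (e i4 x _) => *; lra.
move=> v a; transitivity (e a x [tuple Jx (\sum_b e b x [tuple v] *: fv b x)]).
  by rewrite -(frame_expand se free_e v Vx).
rewrite Jsum -sumrN.
by apply: eq_bigr => b _; rewrite JE'; ring.
Qed.

Lemma contact_torsion x : V x ->
  forall b c, A x i4 b c - A x i4 c b = - 2 * W1 R b c.
Proof.
move=> Vx b c; have := d_alpha (fv b x) (fv c x) Vx.
rewrite extd1 (form2_frame _ _ w1E Vx) => <-.
rewrite -![X in X - _ = _ - _]/(A x i4 b c).
rewrite -[RHS]/(frame_deriv x i4 c b - frame_deriv x i4 b c) !frame_derivE //.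
rewrite (frame_gamma_sym i4 c b Vx).
by move: (frame_gamma _ _ _ _) (A x i4 b c) (A x i4 c b) => p q r; ring.
Qed.

Lemma cyc_w1 x : V x -> forall p q r, cyc (A x) (W1 R) p q r = 0.
Proof. by move=> Vx p q r; rewrite -(extd_frame _ _ _ w1E Vx (W1_skew R)) d_w1. Qed.

(** On (E_p, E_q, E_r, xi) the form d alpha /\ w vanishes, both factors being
annihilated by xi, and what remains of d(alpha /\ w) is - alpha /\ dw, that is,
dw(E_p, E_q, E_r). *)
Lemma wedge_alpha_frame w W x p q r : has_coeffs w W -> V x ->
  (forall a b, W a b = - W b a) -> (forall a, W a i4 = 0) ->
  p != i4 -> q != i4 -> r != i4 ->
  extd (wedge alpha w) x [tuple fv p x; fv q x; fv r x; fv i4 x] =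
  extd w x [tuple fv p x; fv q x; fv r x].
Proof.
move=> wE Vx W_skew W4 p4 q4 r4.
have wN y : V y -> forall u v, w y [tuple u; v] = - w y [tuple v; u].
  move=> Vy u v; rewrite !wE // exchange_big -sumrN; apply: eq_bigr => a _.
  rewrite -sumrN; apply: eq_bigr => b _; rewrite W_skew; ring.
have sw u v : smooth_on V (fun y => w y [tuple u; v]).
  apply: (@smooth_eq_on _ _ _ _ (fun y =>
    \sum_a \sum_b W a b * (e a y [tuple u] * e b y [tuple v]))) => //.
    by move=> y Vy; rewrite wE.
  apply: smooth_sum => // a _; apply: smooth_sum => // b _.
  have sev c t := smooth_coframe se c t.
  by apply: smooth_mul => //; [exact: smooth_cst | apply: smooth_mul].
have sal u : smooth_on V (fun y => alpha y [tuple u]) by exact: smooth_coframe.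
have D z u v t : 'D_z (fun y => wedge alpha w y [tuple u; v; t]) x =
   ('D_z (fun y => alpha y [tuple u]) x * w x [tuple v; t] +
    alpha x [tuple u] * 'D_z (fun y => w y [tuple v; t]) x) -
   ('D_z (fun y => alpha y [tuple v]) x * w x [tuple u; t] +
    alpha x [tuple v] * 'D_z (fun y => w y [tuple u; t]) x) +
   ('D_z (fun y => alpha y [tuple t]) x * w x [tuple u; v] +
    alpha x [tuple t] * 'D_z (fun y => w y [tuple u; v]) x).
  have sm a b c : smooth_on V (fun y => alpha y [tuple a] * w y [tuple b; c]).
    exact: (smooth_mul oV (sal a) (sw b c)).
  rewrite (@derive_eq_on _ _ _ V (fun y => wedge alpha w y [tuple u; v; t])
    (fun y => alpha y [tuple u] * w y [tuple v; t] - alpha y [tuple v] * w y [tuple u; t]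
      + alpha y [tuple t] * w y [tuple u; v]) _ _ oV _ Vx);
    last by move=> y Vy; rewrite wedge12 //; exact: wN.
  rewrite (deriveD_on _ (smooth_sub oV (sm u v t) (sm v u t)) (sm t u v) Vx).
  rewrite (deriveB_on _ (sm u v t) (sm v u t) Vx).
  rewrite (deriveM_on _ (sal u) (sw v t) Vx) (deriveM_on _ (sal v) (sw u t) Vx).
  by rewrite (deriveM_on _ (sal t) (sw u v) Vx).
have al a : alpha x [tuple fv a x] = (i4 == a)%:R.
  by rewrite (coframe_frame_vec se free_e).
have w4 a : w x [tuple fv a x; fv i4 x] = 0 by rewrite (form2_frame _ _ wE Vx).
(* This is iota_xi d alpha = 0. *)
have t4 a : a != i4 -> 'D_(fv a x) (fun y => alpha y [tuple fv i4 x]) x =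
    'D_(fv i4 x) (fun y => alpha y [tuple fv a x]) x.
  move=> a4; rewrite -[LHS]/(frame_deriv x i4 i4 a) -[RHS]/(frame_deriv x i4 a i4).
  rewrite !frame_derivE // (frame_gamma_sym i4 i4 a Vx).
  have := contact_torsion Vx i4 a.
  have -> : W1 R i4 a = 0 by rewrite /W1; elim/ord5_ind: a a4.
  by move: (frame_gamma _ _ _ _) (A x i4 i4 a) (A x i4 a i4) => b c d; lra.
have Dh a b c : b != i4 -> c != i4 ->
    'D_(fv a x) (fun y => wedge alpha w y [tuple fv b x; fv c x; fv i4 x]) x =
    'D_(fv a x) (fun y => alpha y [tuple fv i4 x]) x * w x [tuple fv b x; fv c x] +
    'D_(fv a x) (fun y => w y [tuple fv b x; fv c x]) x.
  move=> b4 c4; rewrite D !w4 !al (eqxx i4) ![i4 == _]eq_sym (negbTE b4) (negbTE c4).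
  exact: one_survivor.
have Dv : 'D_(fv i4 x) (fun y => wedge alpha w y [tuple fv p x; fv q x; fv r x]) x =
    'D_(fv i4 x) (fun y => alpha y [tuple fv p x]) x * w x [tuple fv q x; fv r x] -
    'D_(fv i4 x) (fun y => alpha y [tuple fv q x]) x * w x [tuple fv p x; fv r x] +
    'D_(fv i4 x) (fun y => alpha y [tuple fv r x]) x * w x [tuple fv p x; fv q x].
  rewrite D !al ![i4 == _]eq_sym (negbTE p4) (negbTE q4) (negbTE r4).
  exact: no_survivor.
rewrite extd3 extd2 (Dh p q r q4 r4) (Dh q p r p4 r4) (Dh r p q p4 q4) Dv.
rewrite (t4 p p4) (t4 q q4) (t4 r r4).
move: ('D_(fv p x) (fun y => w y [tuple fv q x; fv r x]) x)
 ('D_(fv q x) (fun y => w y [tuple fv p x; fv r x]) x)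
 ('D_(fv r x) (fun y => w y [tuple fv p x; fv q x]) x)
 ('D_(fv i4 x) (fun y => alpha y [tuple fv p x]) x * w x [tuple fv q x; fv r x])
 ('D_(fv i4 x) (fun y => alpha y [tuple fv q x]) x * w x [tuple fv p x; fv r x])
 ('D_(fv i4 x) (fun y => alpha y [tuple fv r x]) x * w x [tuple fv p x; fv q x])
 => d1 d2 d3 k1 k2 k3.
ring.
Qed.

Let K x := curv_fun th g x.
Let D x := dir_conn th g x.

Hypothesis ricci_reeb4 : forall x, V x -> ricci g x (fv i4 x) (fv i4 x) = 4.

Lemma dir_eq (f h : E -> R) x c : eq_on V f h -> V x ->
  contract1 (dual_frame th x) (fun i => partial i f x) c =
  contract1 (dual_frame th x) (fun i => partial i h x) c.
Proof.
move=> fh Vx; apply: eq_bigr => i _; congr (_ * _).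
exact: (derive_eq_on _ oV).
Qed.

Lemma dir_cst (r : R) x c :
  contract1 (dual_frame th x) (fun i => partial i (fun _ => r) x) c = 0.
Proof. by apply: big1 => i _; rewrite /partial derive_cst mulr0. Qed.

Lemma dir_neg (f : E -> R) x c : smooth_on V f -> V x ->
  contract1 (dual_frame th x) (fun i => partial i (fun y => - f y) x) c =
  - contract1 (dual_frame th x) (fun i => partial i f x) c.
Proof.
move=> sf Vx; rewrite /contract1 -sumrN; apply: eq_bigr => i _.
by rewrite /partial (deriveN_on _ sf Vx) mulrN.
Qed.

Let sA a b c : smooth_on V (conn_fun th g a b c).
Proof. exact: (smooth_conn_fun oV sth uth gramE). Qed.

Lemma dir_trace0 x d : V x -> \sum_c D x d c i4 c = 0.
Proof.
move=> Vx; rewrite /D /dir_conn /contract1 exchange_big; apply: big1 => i _.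
rewrite -mulr_sumr -(derive_sum_on _ _ oV (fun c _ => sA c i4 c) Vx).
rewrite (@derive_eq_on _ _ _ V _ (fun _ => 0)) // ?derive_cst ?mulr0 // => y Vy.
exact: (shape_trace0 (A_skew Vy) (contact_torsion Vy) (cyc_w1 Vy)).
Qed.

Lemma dir_vertical0 x c a : V x -> D x c a i4 i4 = 0.
Proof.
move=> Vx; rewrite /D /dir_conn -(dir_cst 0 x c); apply: dir_eq => // y Vy.
exact: (shape_vertical (A_skew Vy) (contact_torsion Vy)).
Qed.

Let KE x : V x -> forall a b c d, K x a b c d =
  D x c a b d - D x d a b c + \sum_e A x a b e * (A x e c d - A x e d c)
  + \sum_e (A x a e c * A x e b d - A x a e d * A x e b c).
Proof. by move=> Vx a b c d; exact: (curv_fun_formula oV sth uth gramE). Qed.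

Lemma ricci_fv x a b : V x -> ricci g x (fv a x) (fv b x) = \sum_c K x c b c a.
Proof.
move=> Vx; rewrite (ricci_in_frame oV sth uth gramE) //.
have H (d a' : 'I_5) : \sum_j th x d j * fv a' x 0 j = (d == a')%:R.
  by rewrite -(coframeE se) // (coframe_frame_vec se free_e).
rewrite (bigD1 a) //= [X in _ + X]big1 => [|d da].
  rewrite (bigD1 b) //= [X in _ + X + _]big1 => [|b' bb'].
    by rewrite !H (eqxx a) (eqxx b) !mul1r !addr0.
  by rewrite !H (negbTE bb') mulr0 mul0r.
by apply: big1 => b' _; rewrite !H (negbTE da) !mul0r.
Qed.

(** Ric(xi, xi) is the trace over c of the curvature components (c, 4, c, 4).
The terms differentiating the connection are E_c of the geodesic equation and
xi of the divergence of xi, both zero; the products left over sum to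
- tr((nabla xi)^2). *)
Lemma shape_square x : V x -> \sum_a \sum_c A x a i4 c * A x c i4 a = -4.
Proof.
move=> Vx; have := ricci_reeb4 Vx; rewrite ricci_fv //.
under eq_bigr do rewrite KE // dir_vertical0 // sub0r.
rewrite !big_split /= sumrN dir_trace0 // oppr0 add0r => H.
have v a : A x a i4 i4 = 0 by exact: (shape_vertical (A_skew Vx) (contact_torsion Vx)).
have E1 : \sum_c \sum_e A x c i4 e * (A x e c i4 - A x e i4 c) =
    \sum_c \sum_e A x c i4 e * A x e c i4 -
    \sum_c \sum_e A x c i4 e * A x e i4 c.
  rewrite -sumrB; apply: eq_bigr => c _; rewrite -sumrB.
  by apply: eq_bigr => b _; rewrite mulrBr.
(* The first product vanishes since xi is geodesic; the second one cancels the
   first half of E1, leaving the trace of the square. *)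
have E2 : \sum_c \sum_e (A x c e c * A x e i4 i4 - A x c e i4 * A x e i4 c) =
    - \sum_c \sum_e A x c i4 e * A x e c i4.
  rewrite -sumrN exchange_big; apply: eq_bigr => c _; rewrite -sumrN.
  by apply: eq_bigr => b _; rewrite v mulr0 sub0r mulrC.
move: H; rewrite E1 E2; move: (\sum_c \sum_e _) (\sum_c \sum_e _) => p q; lra.
Qed.

Lemma shape_W1 x : V x -> forall a c, A x a i4 c = W1 R a c.
Proof.
by move=> Vx; exact: (shape_rigid (A_skew Vx) (contact_torsion Vx) (shape_square Vx)).
Qed.

Lemma cyc_w23 x : V x -> forall p q r, p != i4 -> q != i4 -> r != i4 ->
  cyc (A x) (W2 R) p q r = 0 /\ cyc (A x) (W3 R) p q r = 0.
Proof.
move=> Vx p q r p4 q4 r4; split.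
  have W24 a : W2 R a i4 = 0 by rewrite /W2; elim/ord5_ind: a.
  rewrite -(extd_frame _ _ _ w2E Vx (W2_skew R)).
  by rewrite -(wedge_alpha_frame w2E Vx (W2_skew R) W24 p4 q4 r4) d_alpha_w2.
have W34 a : W3 R a i4 = 0 by rewrite /W3; elim/ord5_ind: a.
rewrite -(extd_frame _ _ _ w3E Vx (W3_skew R)).
by rewrite -(wedge_alpha_frame w3E Vx (W3_skew R) W34 p4 q4 r4) d_alpha_w3.
Qed.

Lemma conn_13 x c : V x -> A x i1 i3 c = A x i0 i2 c.
Proof.
move=> Vx; have [->|c4] := eqVneq c i4.
  by have [-> _] := transverse_kahler_vertical (A_skew Vx) (cyc_w1 Vx) (shape_W1 Vx).
by have [-> _ _] := transverse_kahler_horizontal (A_skew Vx) (cyc_w1 Vx) (shape_W1 Vx)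
  (cyc_w23 Vx) c4.
Qed.

Lemma conn_12 x c : V x -> A x i1 i2 c = - A x i0 i3 c.
Proof.
move=> Vx; have [->|c4] := eqVneq c i4.
  have [_ ->] := transverse_kahler_vertical (A_skew Vx) (cyc_w1 Vx) (shape_W1 Vx).
  by rewrite opprK.
have [_ -> _] := transverse_kahler_horizontal (A_skew Vx) (cyc_w1 Vx) (shape_W1 Vx)
  (cyc_w23 Vx) c4.
by rewrite opprK.
Qed.

Lemma conn_23 x c : V x -> c != i4 -> A x i2 i3 c = - A x i0 i1 c.
Proof.
move=> Vx c4.
have [_ _ H] := transverse_kahler_horizontal (A_skew Vx) (cyc_w1 Vx) (shape_W1 Vx)
  (cyc_w23 Vx) c4.
by apply/eqP; rewrite -addr_eq0 addrC H.
Qed.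

(** Relations between the connection functions that hold on the whole open set
may be differentiated; this supplies the hypotheses on derivatives of
ricci_alpha_einstein. *)
Lemma ricci_adapted x d b : V x -> \sum_c K x c b c d =
  if d == b then if d == i4 then 4
                 else 2 - 2 * (A x i0 i1 i4 + A x i2 i3 i4) else 0.
Proof.
move=> Vx.
apply: (@ricci_alpha_einstein R (A x) (D x) (K x)).
- exact: A_skew.
- exact: shape_W1.
- by move=> c; exact: conn_13.
- by move=> c; exact: conn_12.
- by move=> c; exact: conn_23.
- move=> c a d'; rewrite /D /dir_conn -(dir_cst (W1 R a d') x c).
  by apply: dir_eq => // y Vy; exact: shape_W1.
- by move=> c d'; apply: dir_eq => // y Vy; exact: conn_13.
- move=> c d'; rewrite /D /dir_conn -dir_neg //.
  by apply: dir_eq => // y Vy; exact: conn_12.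
- move=> c d' d4; rewrite /D /dir_conn -dir_neg //.
  by apply: dir_eq => // y Vy; exact: conn_23.
- exact: KE.
- by move=> *; exact: (curv_fun_skew oV sth uth gramE).
- by move=> *; exact: (curv_fun_alt th g).
- by move=> *; exact: (curv_fun_pair oV sth uth gramE).
- by move=> *; exact: (curv_fun_bianchi oV sth uth gramE).
Qed.

Lemma ricci_adapted_form x u w : V x -> ricci g x u w =
  (2 - 2 * (A x i0 i1 i4 + A x i2 i3 i4)) *
    (g x [tuple u; w] - alpha x [tuple u] * alpha x [tuple w]) +
  4 * (alpha x [tuple u] * alpha x [tuple w]).
Proof.
move=> Vx; rewrite (ricci_in_frame oV sth uth gramE) // gE //.
have H d (v : E) : \sum_j th x d j * v 0 j = e d x [tuple v] by rewrite -(coframeE se).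
under eq_bigr do under eq_bigr do rewrite !H (ricci_adapted _ _ Vx).
rewrite !sum5 /=; move: (A x i0 i1 i4 + _) => f.
move: (e i0 x _) (e i1 x _) (e i2 x _) (e i3 x _) (e i4 x _) (e i0 x [tuple w])
 (e i1 x [tuple w]) (e i2 x [tuple w]) (e i3 x [tuple w]) (e i4 x [tuple w]).
move=> *; ring.
Qed.

Variables (xi : E -> E) (J : E -> E -> E).
Hypothesis sxi : smooth_on V xi.
Hypothesis xiE : forall x, V x -> xi x = fv i4 x.
Hypothesis sJ : forall v, smooth_on V (fun x => J x v).
Hypothesis JE : forall x v a, V x ->
  e a x [tuple J x v] = - \sum_b W1 R a b * e b x [tuple v].

(** Product rule for e^a(Y), with Y expanded in the coordinate basis. *)
Lemma derive_pairing (Y : E -> E) x u a : smooth_on V Y -> V x ->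
  'D_u (fun y => e a y [tuple Y y]) x =
  'D_u (fun y => e a y [tuple Y x]) x + e a x [tuple 'D_u Y x].
Proof.
move=> sY Vx.
have sYj j : smooth_on V (fun y => Y y 0 j) by exact: smooth_row_coord.
have st j : smooth_on V (fun y => th y a j) by exact: (smooth_mxP V th).1.
have sc (r : R) : smooth_on V (fun _ : E => r) by exact: smooth_cst.
rewrite (@derive_eq_on _ _ _ V _ (fun y => \sum_j th y a j * Y y 0 j)) //;
  last by move=> y Vy; rewrite (coframeE se).
rewrite [X in _ = X + _](@derive_eq_on _ _ _ V _ (fun y => \sum_j th y a j * Y x 0 j)) //;
  last by move=> y Vy; rewrite (coframeE se).
rewrite (coframeE se) //.
rewrite !(derive_sum_on _ _ oV) //; try by move=> j _; exact: smooth_mul.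
rewrite -big_split; apply: eq_bigr => j _ /=.
rewrite (deriveM_on _ (st j) (sYj j)) // (deriveM_on _ (st j) (sc _)) //.
by rewrite derive_cst mulr0 addr0 (derive_row_coord _ _ sY Vx).
Qed.

Lemma coframe_xi x a : V x -> e a x [tuple xi x] = (a == i4)%:R.
Proof. by move=> Vx; rewrite xiE // (coframe_frame_vec se free_e). Qed.

(** nabla_u xi = - J_1 u. *)
Lemma derive_xi x u : V x -> 'D_u xi x = - gamma g x u (xi x) - J x u.
Proof.
move=> Vx; apply: (coframe_inj se free_e Vx) => a.
rewrite (form1D (coframe_lin se a Vx)) !(form1N (coframe_lin se a Vx)) JE // opprK.
have := derive_pairing u a sxi Vx.
rewrite (@derive_eq_on _ _ _ V _ (fun _ => (a == i4)%:R : R)) //; last first.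
  by move=> y Vy; rewrite coframe_xi.
rewrite derive_cst (derive_coframe g oV se free_e) //.
have -> : \sum_c \sum_b e c x [tuple u] * e b x [tuple xi x] * conn_fun th g a b c x =
    \sum_b W1 R a b * e b x [tuple u].
  apply: eq_bigr => c _; rewrite (bigD1 i4) //= big1 => [|b b4].
    by rewrite coframe_xi // (eqxx i4) mulr1 addr0 [LHS]mulrC -(shape_W1 Vx).
  by rewrite coframe_xi // (negbTE b4) mulr0 mul0r.
move: (e a x [tuple gamma _ _ _ _]) (e a x [tuple 'D_u _ _]) (\sum_b _) => p q r.
by move=> H; lra.
Qed.

(** (nabla_u alpha)(v) = - g(J_1 u, v). *)
Lemma derive_alpha x u v : V x -> 'D_u (fun y => alpha y [tuple v]) x =
  alpha x [tuple gamma g x u v] - g x [tuple J x u; v].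
Proof.
move=> Vx; rewrite (derive_coframe g oV se free_e) //; congr (_ - _).
rewrite gE // exchange_big; apply: eq_bigr => b _ /=.
rewrite JE // -sumrN mulr_suml; apply: eq_bigr => c _.
have -> : conn_fun th g i4 b c x = - W1 R b c by rewrite -(shape_W1 Vx) -A_skew.
ring.
Qed.

(** (nabla_u J_1) v = g(u, v) xi - alpha(v) u, the identity that characterises
Sasakian structures; it is nabla_W1 carried through the coframe. *)
Lemma derive_J x u v : V x -> 'D_u (fun y => J y v) x =
  J x (gamma g x u v) - gamma g x u (J x v) - alpha x [tuple v] *: u
  + g x [tuple u; v] *: xi x.
Proof.
move=> Vx; apply: (coframe_inj se free_e Vx) => a.
have la := coframe_lin se a Vx.
rewrite !(form1D la) !(form1N la) !(form1Z la) JE // coframe_xi //.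
have := derive_pairing u a (sJ v) Vx.
have sab b : smooth_on V (fun y => W1 R a b * e b y [tuple v]).
  by apply: smooth_mul => //; [exact: smooth_cst | exact: smooth_coframe].
rewrite (@derive_eq_on _ _ _ V _ (fun y => - \sum_b W1 R a b * e b y [tuple v])) //;
  last by move=> y Vy; rewrite JE.
rewrite (deriveN_on _ (smooth_sum _ oV (fun b _ => sab b)) Vx).
rewrite (derive_sum_on _ _ oV) //.
under eq_bigr => b _.
  rewrite (deriveM_on _ (smooth_cst (W1 R a b : R) oV) (smooth_coframe se b v) Vx).
  rewrite derive_cst mul0r add0r (derive_coframe g oV se free_e) // mulrBr.
  over.
rewrite sumrB (derive_coframe g oV se free_e) //.
have T c b : e c x [tuple u] * e b x [tuple J x v] * conn_fun th g a b c x =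
    \sum_d - (e c x [tuple u] * (W1 R b d * e d x [tuple v]) * conn_fun th g a b c x).
  rewrite JE //; move: (conn_fun _ _ _ _ _ _) => k.
  by rewrite sumrN -mulr_suml -mulr_sumr; ring.
(* The connection terms coming from nabla e^a and nabla e^b assemble into
   nabla omega_1. *)
have nab : \sum_b W1 R a b * (\sum_c \sum_d e c x [tuple u] * e d x [tuple v] *
      conn_fun th g b d c x) +
    \sum_c \sum_b e c x [tuple u] * e b x [tuple J x v] * conn_fun th g a b c x =
    - (alpha x [tuple v] * e a x [tuple u]) + g x [tuple u; v] * (a == i4)%:R.
  transitivity (- \sum_c \sum_d e c x [tuple u] * e d x [tuple v] *
      (\sum_b (A x a b c * W1 R b d - W1 R a b * A x b d c))).
    under eq_bigr do rewrite mulr_sumr.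
    rewrite exchange_big -big_split -sumrN; apply: eq_bigr => c _ /=.
    under eq_bigr do rewrite mulr_sumr.
    under [X in _ + X]eq_bigr do rewrite T.
    rewrite exchange_big [X in _ + X]exchange_big -big_split -sumrN.
    apply: eq_bigr => d _ /=; rewrite mulr_sumr -big_split -sumrN.
    by apply: eq_bigr => b _; rewrite /=; ring.
  have H c d := nabla_W1 (A_skew Vx) (shape_W1 Vx) (fun c => conn_13 c Vx)
    (fun c => conn_12 c Vx) (fun c c4 => conn_23 Vx c4) a d c.
  under eq_bigr do under eq_bigr do rewrite H.
  rewrite gE //; have [->|a4] := eqVneq a i4.
    rewrite !sum5 /=; move: (e i0 x _) (e i1 x _) (e i2 x _) (e i3 x _) (e i4 x _)
     (e i0 x [tuple v]) (e i1 x [tuple v]) (e i2 x [tuple v]) (e i3 x [tuple v])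
     (e i4 x [tuple v]) => *; ring.
  rewrite (bigD1 a) //= [X in _ + X]big1 => [|c ca].
    rewrite (bigD1 i4) //= [X in _ + X + _]big1 => [|d d4].
      by rewrite (eqxx a) /=; ring.
    by rewrite (negbTE d4) /=; ring.
  by apply: big1 => d _; rewrite (eq_sym a c) (negbTE ca) /=; ring.
move: nab; move: (\sum_b W1 R a b * e b x [tuple gamma g x u v]) (e a x [tuple gamma _ _ _ _])
  (e a x [tuple 'D_u _ _]) (\sum_b _) (\sum_c _) => p q r t z.
move: (_ * _) (_ * _) => k l; lra.
Qed.

Lemma alpha_J x u : V x -> alpha x [tuple J x u] = 0.
Proof. by move=> Vx; rewrite JE // sum5 /W1 /=; ring. Qed.

Lemma J_J x u : V x -> J x (J x u) = - u + alpha x [tuple u] *: xi x.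
Proof.
move=> Vx; apply: (coframe_inj se free_e Vx) => a.
have la := coframe_lin se a Vx.
rewrite (form1D la) (form1N la) (form1Z la) coframe_xi // JE // sum5 !JE // !sum5.
by elim/ord5_ind: a la => la; rewrite /W1 /=;
  move: (e i0 x _) (e i1 x _) (e i2 x _) (e i3 x _) (alpha x _) => *; ring.
Qed.

Lemma w1_J x u v : V x ->
  w1 x [tuple u; J x v] = g x [tuple u; v] - alpha x [tuple u] * alpha x [tuple v].
Proof.
by move=> Vx; rewrite w1E // gE // !sum5 !JE // !sum5 /W1 /=; ring.
Qed.

Lemma w1_xi x u : V x -> w1 x [tuple u; xi x] = 0.
Proof.
by move=> Vx; rewrite w1E // !sum5 !coframe_xi // /W1 /=; ring.
Qed.

Lemma g_J x u v : V x -> g x [tuple J x u; v] = - g x [tuple u; J x v].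
Proof. by move=> Vx; rewrite !gE // !sum5 !JE // !sum5 /W1 /=; ring. Qed.

Lemma g_xi x u : V x -> g x [tuple u; xi x] = alpha x [tuple u].
Proof. by move=> Vx; rewrite gE // sum5 !coframe_xi //=; ring. Qed.

Lemma g_sym x u v : V x -> g x [tuple u; v] = g x [tuple v; u].
Proof. by move=> Vx; rewrite !gE //; apply: eq_bigr => a _; rewrite mulrC. Qed.

Lemma g_linear x u v w c : V x ->
  g x [tuple u; c *: v + w] = c * g x [tuple u; v] + g x [tuple u; w].
Proof.
move=> Vx; rewrite !gE // mulr_sumr -big_split; apply: eq_bigr => a _ /=.
by rewrite (form1_linear (coframe_lin se a Vx)); ring.
Qed.

Lemma g_pos x u : V x -> u != 0 -> 0 < g x [tuple u; u].
Proof.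
move=> Vx u0; have S : g x [tuple u; u] = \sum_a e a x [tuple u] ^+ 2.
  by rewrite gE //; apply: eq_bigr => a _; rewrite expr2.
rewrite lt0r S sumr_ge0 ?andbT; last by move=> a _; exact: sqr_ge0.
apply: contra_neq u0 => /psumr_eq0P H; apply: (free_e Vx) => a.
by apply/eqP; rewrite -sqrf_eq0 H // => b _; exact: sqr_ge0.
Qed.

Lemma transverse_trace x : V x -> exists f : 'I_4 -> E,
  [/\ (forall i, alpha x [tuple f i] = 0),
      (forall i j, g x [tuple f i; f j] - alpha x [tuple f i] * alpha x [tuple f j] =
                   (i == j)%:R) &
      \sum_i ricci g x (f i) (f i) =
        4 * (2 - 2 * (A x i0 i1 i4 + A x i2 i3 i4))].
Proof.
move=> Vx; exists (fun i => fv (widen_ord (leqnSn 4) i) x).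
have a0 (i : 'I_4) : alpha x [tuple fv (widen_ord (leqnSn 4) i) x] = 0.
  rewrite (coframe_frame_vec se free_e) //.
  by have -> : (i4 == widen_ord (leqnSn 4) i) = false by rewrite -val_eqE /= gtn_eqF.
have gij (i j : 'I_4) : g x [tuple fv (widen_ord (leqnSn 4) i) x;
    fv (widen_ord (leqnSn 4) j) x] = (i == j)%:R.
  rewrite gE // (bigD1 (widen_ord (leqnSn 4) i)) //= [X in _ + X]big1 => [|b bi].
    by rewrite !(coframe_frame_vec se free_e) // (eqxx (widen_ord _ i)) mul1r addr0.
  by rewrite (coframe_frame_vec se free_e) // (negbTE bi) mul0r.
split=> // [i j|]; first by rewrite !a0 gij mul0r subr0.
rewrite (eq_bigr (fun _ => 2 - 2 * (A x i0 i1 i4 + A x i2 i3 i4))); last first.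
  by move=> i _; rewrite ricci_adapted_form // a0 gij (eqxx i) /= !mulr0 subr0 mulr1 addr0.
by rewrite sumr_const card_ord -[LHS]mulr_natl.
Qed.

End AdaptedFrame.

(** * The cone *)

Section ProductSpace.
Variable R : realType.
Implicit Types E F G : normedModType R.

Lemma is_derive_pair E F G (f : E -> F) (h : E -> G) x v :
  derivable f x v -> derivable h x v ->
  is_derive x v (fun y => (f y, h y)) ('D_v f x, 'D_v h x).
Proof.
move=> df dh.
set D := fun k : R => k^-1 *: (((fun y => (f y, h y)) \o shift x) (k *: v) - (f x, h x)).
suff H : D @ 0^' --> ('D_v f x, 'D_v h x).
  apply: DeriveDef; first by apply/cvg_ex; eexists; exact: H.
  exact: (cvg_lim _ H).
have -> : D = fun k : R => (k^-1 *: ((f \o shift x) (k *: v) - f x),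
   k^-1 *: ((h \o shift x) (k *: v) - h x)) by [].
exact: (cvg_pair df dh).
Qed.

Lemma Ck_pair n E F G (U : set E) (f : E -> F) (h : E -> G) : open U ->
  Ck n U f -> Ck n U h -> Ck n U (fun x => (f x, h x)).
Proof.
move=> oU.
have cd (f' : E -> F) (h' : E -> G) : cont_derivable_on U f' ->
    cont_derivable_on U h' -> cont_derivable_on U (fun x => (f' x, h' x)).
  move=> cf ch x Ux; have [c d] := cf x Ux; have [c' d'] := ch x Ux.
  split=> [|v]; first exact: (cvg_pair c c').
  by have [] := is_derive_pair (d v) (d' v).
elim: n f h => [|n IHn] f h [cf df] [ch dh].
  by split=> //; apply: cd.
split=> [|v]; first exact: cd.
apply: (Ck_eq oU _ (IHn _ _ (df v) (dh v))) => x Ux.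
have [_ d] := cf x Ux; have [_ d'] := ch x Ux.
by have [_ ->] := is_derive_pair (d v) (d' v).
Qed.

Lemma smooth_pair E F G (U : set E) (f : E -> F) (h : E -> G) : open U ->
  smooth_on U f -> smooth_on U h -> smooth_on U (fun x => (f x, h x)).
Proof.
move=> oU /smooth_onP sf /smooth_onP sh; apply/smooth_onP => n; exact: Ck_pair.
Qed.

Lemma derive_pair_on E F G (U : set E) (f : E -> F) (h : E -> G) x v :
  smooth_on U f -> smooth_on U h -> U x ->
  'D_v (fun y => (f y, h y)) x = ('D_v f x, 'D_v h x).
Proof.
move=> sf sh Ux.
have df := smooth_derivable (v := v) sf Ux.
have dh := smooth_derivable (v := v) sh Ux.
by have [_ ->] := is_derive_pair df dh.
Qed.

Lemma fst_continuousE E F : continuous (fst : E * F -> E).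
Proof. by move=> x; exact: cvg_fst. Qed.

Lemma snd_continuousE E F : continuous (snd : E * F -> F).
Proof. by move=> x; exact: cvg_snd. Qed.

Lemma Ck_fst n E F G (U : set E) (T : set F) (f : E -> G) : 
  Ck n U f -> Ck n (U `*` T) (fun y : E * F => f y.1).
Proof.
have cd (h : E -> G) : cont_derivable_on U h ->
    cont_derivable_on (U `*` T) (fun y : E * F => h y.1).
  move=> ch [x t] [/= Ux _]; have [c d] := ch x Ux; split=> [|v].
    by apply: continuous_comp; [exact: fst_continuousE | exact: c].
  exact: (d v.1).
elim: n f => [|n IHn] f [cf df]; split=> //; try exact: cd.
by move=> v; exact: (IHn _ (df v.1)).
Qed.

Lemma Ck_id n E (U : set E) : open U -> Ck n U (fun x : E => x).
Proof.
move=> oU; case: n => [|n].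
  split=> // x Ux; split=> [|v]; [exact: cvg_id|exact: derivable_id].
split=> [x Ux|v]; first by split=> [|v]; [exact: cvg_id|exact: derivable_id].
by apply: (Ck_eq oU _ (Ck_cst n v oU)) => x _; rewrite derive_id.
Qed.

Lemma smooth_snd E F (U : set (E * F)) : open U -> smooth_on U (fun y => y.2).
Proof.
move=> oU; apply/smooth_onP => n.
exact: (Ck_linear (L := snd) (@snd_continuousE E F) oU (Ck_id n oU)).
Qed.

Lemma derive_snd E F (y v : E * F) : 'D_v (fun y => y.2) y = v.2.
Proof.
have d : derivable (fun z : E * F => z) y v by exact: derivable_id.
have [_ ->] := is_derive_linear (L := snd) (@snd_continuousE E F) d.
by rewrite derive_id.
Qed.

Lemma derive_fst E F G (f : E -> G) (y v : E * F) :
  'D_v (fun y => f y.1) y = 'D_(v.1) f y.1.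
Proof. by []. Qed.

Lemma smooth_fst E F G (U : set E) (T : set F) (f : E -> G) :
  smooth_on U f -> smooth_on (U `*` T) (fun y => f y.1).
Proof. by move=> /smooth_onP sf; apply/smooth_onP => n; exact: Ck_fst. Qed.

Lemma openX E F (U : set E) (T : set F) : open U -> open T -> open (U `*` T).
Proof.
move=> oU oT; rewrite openE => -[x t] [/= Ux Tt].
by exists (U, T) => //; split; exact: open_nbhs_nbhs.
Qed.

Lemma open_pos : open [set t : R | 0 < t].
Proof. exact: open_gt. Qed.

End ProductSpace.

(** The third hypothesis says that J is parallel for the connection
D + G, which is torsion free by symmetry of G.  Replacing the flat derivatives
in the Nijenhuis tensor by covariant ones makes all its terms cancel. *)
Lemma nijenhuis_torsion_free (R : realType) (E : normedModType R)
    (J : E -> E -> E) (G : E -> E -> E) x u w :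
  (forall p q, G p q = G q p) -> (forall p q, J x (p - q) = J x p - J x q) ->
  (forall p q, 'D_p (fun y => J y q) x = J x (G p q) - G p (J x q)) ->
  nijenhuis J x u w = 0.
Proof.
move=> G_sym JB DJ; rewrite /nijenhuis /lie_bracket.
have D0 (p q : E) : 'D_p (cst q) x = 0 by exact: derive_cst.
have J0 : J x 0 = 0 by have := JB 0 0; rewrite !subrr.
have JN p : J x (- p) = - J x p by have := JB 0 p; rewrite J0 !sub0r.
rewrite !D0 !DJ !sub0r !subr0 JN !JB ?oppr0 ?subr0 ?addr0.
rewrite (G_sym (J x w) (J x u)) (G_sym (J x w) u) (G_sym w (J x u)) (G_sym w u).
by rewrite opprK opprB subrKA [X in X - _]addrC subrKA subrr.
Qed.

Lemma cyclic_cancel (R : realType) (k a a' b b' c c' : R) : a = a' -> b = b' -> c = c' ->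
  k * (a - b) - k * (a' - c) + k * (b' - c') = 0.
Proof. by move=> -> -> ->; ring. Qed.

(** The coefficients of d kappa = 2 t dt /\ (omega_1 + d alpha / 2) +
t^2 d omega_1, evaluated on three vectors. *)
Lemma cone_closed_algebra (R : realType) (t u v z wuv wuz wvz d1 d2 d3 a b c : R)
    (auv avu auz azu avz azv : R) :
  d1 - d2 + d3 = 0 -> auv - avu = -2 * wuv -> auz - azu = -2 * wuz ->
  avz - azv = -2 * wvz ->
  2 * t * u * wvz + t ^+ 2 * d1 + u * (b * z - c * v) + t * (auv * z - auz * v) -
  (2 * t * v * wuz + t ^+ 2 * d2 + v * (a * z - c * u) + t * (avu * z - avz * u)) +
  (2 * t * z * wuv + t ^+ 2 * d3 + z * (a * v - b * u) + t * (azu * v - azv * u)) = 0.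
Proof.
move=> e1 e2 e3 e4; have -> : d3 = d2 - d1 by lra.
have -> : auv = avu - 2 * wuv by lra.
have -> : auz = azu - 2 * wuz by lra.
have -> : avz = azv - 2 * wvz by lra.
ring.
Qed.

Section TwoForms.
Variables (R : realType) (E : normedModType R).

Lemma tset2l (a b u : E) : tset [tuple a; b] ord0 u = [tuple u; b].
Proof. by apply: eq_from_tnth => -[[|[|//]] lt]; rewrite tnth_mktuple. Qed.

Lemma tset2r (a b u : E) : tset [tuple a; b] (lift ord0 ord0) u = [tuple a; u].
Proof. by apply: eq_from_tnth => -[[|[|//]] lt]; rewrite tnth_mktuple. Qed.

Lemma multilinear2P (T : 2.-tuple E -> R) : multilinear T <->
  (forall a u w v, T [tuple a *: u + w; v] = a * T [tuple u; v] + T [tuple w; v]) /\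
  (forall a u w v, T [tuple v; a *: u + w] = a * T [tuple v; u] + T [tuple v; w]).
Proof.
split=> [mT|[ml mr]].
  split=> a u w v; first by have := mT [tuple 0; v] ord0 a u w; rewrite !tset2l.
  by have := mT [tuple v; 0] (lift ord0 ord0) a u w; rewrite !tset2r.
move=> v i a u w; rewrite (tuple2_eta v).
have [->|->] : i = ord0 \/ i = lift ord0 ord0.
    by case: i => -[|[|//]] lt; [left|right]; apply: val_inj.
  by rewrite !tset2l ml.
by rewrite !tset2r mr.
Qed.

Lemma alternating2P (T : 2.-tuple E -> R) :
  alternating T <-> forall u, T [tuple u; u] = 0.
Proof.
split=> [aT u|aT v i j ij vij]; first exact: (aT [tuple u; u] ord0 (lift ord0 ord0)).
suff v01 : tnth v 0 = tnth v 1 by rewrite (tuple2_eta v) v01.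
have H k : k = 0 :> 'I_2 \/ k = 1 :> 'I_2.
  by case: k => -[|[|//]] lt; [left|right]; apply: val_inj.
by case: (H i) (H j) ij vij => -> [] -> //.
Qed.

(** d d = 0, for a 2-form proportional to an exact one. *)
Lemma closed_of_exact (U : set E) (a : tensor E 1) (w : tensor E 2) (k : R) x u v z :
  open U -> (forall p, smooth_on U (fun y => a y p)) -> k != 0 ->
  (forall y p q, U y -> extd a y [tuple p; q] = k * w y [tuple p; q]) -> U x ->
  extd w x [tuple u; v; z] = 0.
Proof.
move=> oU sa k0 daw Ux.
have sD p q : smooth_on U ('D_p (fun y => a y [tuple q])) by exact: smooth_onD.
have H p q r : 'D_r (fun y => w y [tuple p; q]) x =
    k^-1 * ('D_r ('D_p (fun y => a y [tuple q])) x -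
            'D_r ('D_q (fun y => a y [tuple p])) x).
  rewrite (@derive_eq_on _ _ _ U _ (fun y => k^-1 * (('D_p (fun y => a y [tuple q])) y
      - ('D_q (fun y => a y [tuple p])) y))) //; last first.
    by move=> y Uy; rewrite -extd1 daw // mulKf.
  rewrite (deriveM_on _ (smooth_cst (k^-1 : R) oU) (smooth_sub oU (sD p q) (sD q p)) Ux).
  by rewrite derive_cst mul0r add0r (deriveB_on _ (sD p q) (sD q p) Ux).
rewrite extd2 (H v z u) (H u z v) (H u v z).
exact: (cyclic_cancel _ (derive_smoothC v u oU (sa [tuple z]) Ux)
  (derive_smoothC z u oU (sa [tuple v]) Ux) (derive_smoothC z v oU (sa [tuple u]) Ux)).
Qed.

End TwoForms.

Section Cone.
Variable R : realType.
Local Notation E := 'rV[R]_5.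
Variables (U : set E) (alpha : tensor E 1) (w1 g : tensor E 2).
Variables (xi : E -> E) (J : E -> E -> E) (G : E -> E -> E -> E).
Hypothesis oU : open U.
Hypothesis s_alpha : smooth_form_on U alpha.
Hypothesis s_w1 : smooth_form_on U w1.
Hypothesis s_xi : smooth_on U xi.
Hypothesis s_J : smooth_endo_on U J.
Hypothesis d_alpha : forall x u v, U x ->
  extd alpha x [tuple u; v] = - 2 * w1 x [tuple u; v].
Hypothesis alpha_xi : forall x, U x -> alpha x [tuple xi x] = 1.
Hypothesis J_xi : forall x, U x -> J x (xi x) = 0.

Definition cone_two_form : tensor (E * R)%type 2 :=
  fun y v => y.2 ^+ 2 * pullback_fst w1 y v
             + y.2 * wedge (pullback_fst alpha) (@cone_dt R) y v.

Definition cone_endo : E * R -> E * R -> E * R :=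
  fun y u => let a := alpha y.1 [tuple u.1] in
    (J y.1 (u.1 - a *: xi y.1) - (u.2 / y.2) *: xi y.1, a * y.2).

Local Notation CU := (U `*` [set t : R | 0 < t]).

Let oCU : open CU.
Proof. by apply: openX => //; exact: open_pos. Qed.

Let al_lin x : U x -> multilinear (alpha x).
Proof. by have [[+ _] _] := s_alpha; apply. Qed.

Let w1_lin x : U x -> multilinear (w1 x).
Proof. by have [[+ _] _] := s_w1; apply. Qed.

Let J_lin x : U x -> forall (a : R) u w, J x (a *: u + w) = a *: J x u + J x w.
Proof. by have [+ _] := s_J; apply. Qed.

Lemma JZ x a u : U x -> J x (a *: u) = a *: J x u.
Proof.
move=> Ux; have J0 : J x 0 = 0.
  by have := J_lin Ux 1 0 0; rewrite !scale1r addr0 => /eqP; rewrite -subr_eq subrr eq_sym => /eqP.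
by have := J_lin Ux a u 0; rewrite J0 !addr0.
Qed.

Lemma JD x u w : U x -> J x (u + w) = J x u + J x w.
Proof. by move=> Ux; have := J_lin Ux 1 u w; rewrite !scale1r. Qed.

(** On all vectors, as J_1 already annihilates the Reeb component. *)
Lemma cone_endoE y u : CU y ->
  cone_endo y u = (J y.1 u.1 - (u.2 / y.2) *: xi y.1, alpha y.1 [tuple u.1] * y.2).
Proof.
move=> [Ux _]; rewrite /cone_endo /=; congr (_ - _, _).
by rewrite JD // -scaleNr JZ // J_xi // scaler0 addr0.
Qed.

Lemma cone_two_formE y (u v : E * R) : cone_two_form y [tuple u; v] =
  y.2 ^+ 2 * w1 y.1 [tuple u.1; v.1]
  + y.2 * (alpha y.1 [tuple u.1] * v.2 - alpha y.1 [tuple v.1] * u.2).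
Proof.
rewrite /cone_two_form wedge11 /pullback_fst /cone_dt.
congr (_ * w1 _ _ + _ * (alpha _ _ * _ - alpha _ _ * _));
  by apply: eq_from_tnth => -[[|[|//]] lt]; rewrite tnth_mktuple.
Qed.

Lemma smooth_alpha u : smooth_on U (fun x => alpha x [tuple u]).
Proof. by have [[_ +] _] := s_alpha; apply. Qed.

Lemma smooth_w1 u : smooth_on U (fun x => w1 x u).
Proof. by have [[_ +] _] := s_w1; apply. Qed.

Lemma smooth_t : smooth_on CU (fun y : E * R => y.2).
Proof. exact: smooth_snd. Qed.

Lemma smooth_cone_form : smooth_form_on CU cone_two_form.
Proof.
have s1 u : smooth_on CU (fun y => alpha y.1 [tuple u]).
  exact: (@smooth_fst _ _ _ _ U _ (fun x => alpha x [tuple u]) (smooth_alpha u)).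
have s2 u : smooth_on CU (fun y => w1 y.1 u).
  exact: (@smooth_fst _ _ _ _ U _ (fun x => w1 x u) (smooth_w1 u)).
have sc (r : R) : smooth_on CU (fun _ => r) by exact: smooth_cst.
have st := smooth_t.
split; [split|].
- move=> [x t] [/= Ux _]; apply/multilinear2P.
  have [wl wr] := (multilinear2P _).1 (w1_lin Ux).
  have al := form1_linear (al_lin Ux).
  split=> a u w v; rewrite !cone_two_formE /= ?wl ?wr !al;
    by rewrite -[a *: u.2]/(a * u.2); ring.
- move=> v; rewrite (tuple2_eta v); move: (tnth v 0) (tnth v 1) => p q.
  have sA k l : smooth_on CU (fun y : E * R => alpha y.1 [tuple k] * l).
    exact: (smooth_mul oCU (s1 k) (sc l)).
  have H := smooth_add oCU (smooth_mul oCU (smooth_mul oCU st st) (s2 [tuple p.1; q.1]))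
    (smooth_mul oCU st (smooth_sub oCU (sA p.1 q.2) (sA q.1 p.2))).
  apply: (smooth_eq_on oCU _ H) => y _.
  by rewrite cone_two_formE expr2.
- move=> [x t] [/= Ux _]; apply/alternating2P => u.
  have [_ aw] := s_w1; have /alternating2P w0 := aw x Ux.
  by rewrite cone_two_formE /= w0; ring.
Qed.

Lemma cone_form_closed y u v z : CU y -> extd cone_two_form y [tuple u; v; z] = 0.
Proof.
move=> CUy; have [Uy _] := CUy.
have st := smooth_t.
have s1 q : smooth_on CU (fun y => alpha y.1 [tuple q]).
  exact: (@smooth_fst _ _ _ _ U _ (fun x => alpha x [tuple q]) (smooth_alpha q)).
have s2 q : smooth_on CU (fun y => w1 y.1 q).
  exact: (@smooth_fst _ _ _ _ U _ (fun x => w1 x q) (smooth_w1 q)).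
have sc (r : R) : smooth_on CU (fun _ => r) by exact: smooth_cst.
have D (p q r : E * R) : 'D_p (fun y => cone_two_form y [tuple q; r]) y =
    2 * y.2 * p.2 * w1 y.1 [tuple q.1; r.1]
    + y.2 ^+ 2 * 'D_(p.1) (fun x => w1 x [tuple q.1; r.1]) y.1
    + p.2 * (alpha y.1 [tuple q.1] * r.2 - alpha y.1 [tuple r.1] * q.2)
    + y.2 * ('D_(p.1) (fun x => alpha x [tuple q.1]) y.1 * r.2
             - 'D_(p.1) (fun x => alpha x [tuple r.1]) y.1 * q.2).
  have sA k l : smooth_on CU (fun y : E * R => alpha y.1 [tuple k] * l).
    exact: (smooth_mul oCU (s1 k) (sc l)).
  have sB := smooth_sub oCU (sA q.1 r.2) (sA r.1 q.2).
  have stt : smooth_on CU (fun y : E * R => y.2 * y.2).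
    exact: (smooth_mul oCU st st).
  rewrite (@derive_eq_on _ _ _ CU (fun y => cone_two_form y [tuple q; r])
    (fun y : E * R => y.2 * y.2 * w1 y.1 [tuple q.1; r.1]
    + y.2 * (alpha y.1 [tuple q.1] * r.2 - alpha y.1 [tuple r.1] * q.2)) _ _ oCU _ CUy);
    last by move=> k _; rewrite cone_two_formE expr2.
  rewrite (deriveD_on _ (smooth_mul oCU stt (s2 _)) (smooth_mul oCU st sB) CUy).
  rewrite (deriveM_on _ stt (s2 _) CUy) (deriveM_on _ st st CUy).
  rewrite (deriveM_on _ st sB CUy) (deriveB_on _ (sA _ _) (sA _ _) CUy).
  rewrite !(deriveM_on _ (s1 _) (sc _) CUy) !derive_cst derive_snd.
  rewrite (derive_fst (fun x => w1 x [tuple q.1; r.1])).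
  rewrite (derive_fst (fun x => alpha x [tuple q.1])).
  rewrite (derive_fst (fun x => alpha x [tuple r.1])).
  move: ('D_ _ _ _) ('D_ _ _ _) ('D_ _ _ _) => d1 d2 d3; ring.
rewrite extd2 !D.
have sa p : smooth_on U (fun x => alpha x p) by have [[_ +] _] := s_alpha; apply.
have n2 : -2 != 0 :> R by rewrite oppr_eq0 pnatr_eq0.
have dw := closed_of_exact u.1 v.1 z.1 oU sa n2 d_alpha Uy.
rewrite extd2 in dw.
have duv := d_alpha u.1 v.1 Uy; have duz := d_alpha u.1 z.1 Uy.
have dvz := d_alpha v.1 z.1 Uy; rewrite !extd1 in duv duz dvz.
exact: (cone_closed_algebra _ _ _ _ _ _ _ dw duv duz dvz).
Qed.

Lemma cone_endo_linear y : CU y ->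
  forall (a : R) u w, cone_endo y (a *: u + w) = a *: cone_endo y u + cone_endo y w.
Proof.
move=> CUy a u w; have [Uy _] := CUy; rewrite !cone_endoE //.
rewrite /= J_lin // (form1_linear (al_lin Uy)).
rewrite -[a *: u.2]/(a * u.2); congr (_, _); last first.
  by rewrite mulrDl -mulrA.
by apply/rowP => k; rewrite /= !mxE; ring.
Qed.

Lemma smooth_cone_endo : smooth_endo_on CU cone_endo.
Proof.
split=> [y|v]; first exact: cone_endo_linear.
have H1 : smooth_on CU (fun y : E * R => J y.1 v.1 - (v.2 * y.2^-1) *: xi y.1).
  have [_ sJ] := s_J.
  have sJ1 := @smooth_fst _ _ _ _ U [set t : R | 0 < t] (fun x => J x v.1) (sJ v.1).
  have sxi1 := @smooth_fst _ _ _ _ U [set t : R | 0 < t] xi s_xi.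
  have si : smooth_on CU (fun y : E * R => y.2^-1).
    apply: (smooth_inv oCU _ smooth_t) => y [_ /= t0]; exact: lt0r_neq0.
  exact: (smooth_sub oCU sJ1 (smooth_scale oCU
    (smooth_mul oCU (smooth_cst (v.2 : R) oCU) si) sxi1)).
have H2 := smooth_mul oCU (@smooth_fst _ _ _ _ U [set t : R | 0 < t]
  (fun x => alpha x [tuple v.1]) (smooth_alpha v.1)) smooth_t.
apply: (smooth_eq_on oCU _ (smooth_pair oCU H1 H2)) => y CUy.
by rewrite cone_endoE.
Qed.

Hypothesis alpha_J : forall x u, U x -> alpha x [tuple J x u] = 0.
Hypothesis J_J : forall x u, U x -> J x (J x u) = - u + alpha x [tuple u] *: xi x.

Lemma cone_endo_square y u : CU y -> cone_endo y (cone_endo y u) = - u.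
Proof.
move=> CUy; have [Uy /= t0] := CUy; have tn := lt0r_neq0 t0; rewrite !cone_endoE //=.
have al := form1D (al_lin Uy); have aN := form1N (al_lin Uy); have aZ := form1Z (al_lin Uy).
rewrite -scaleNr JD // JZ // J_xi // scaler0 addr0 J_J // al aZ alpha_J // alpha_xi //.
congr (_, _); first by rewrite mulfK // addrK.
by rewrite add0r mulr1 mulNr divfK.
Qed.

Hypothesis w1_xi : forall x u, U x -> w1 x [tuple u; xi x] = 0.
Hypothesis w1_J : forall x u v, U x ->
  w1 x [tuple u; J x v] = g x [tuple u; v] - alpha x [tuple u] * alpha x [tuple v].
Hypothesis g_sym : forall x u v, U x -> g x [tuple u; v] = g x [tuple v; u].
Hypothesis g_pos : forall x u, U x -> u != 0 -> 0 < g x [tuple u; u].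

(** The bilinear form kappa(., J .) is the cone metric t^2 g + dt^2. *)
Lemma cone_metric y u v : CU y -> cone_two_form y [tuple u; cone_endo y v] =
  y.2 ^+ 2 * g y.1 [tuple u.1; v.1] + u.2 * v.2.
Proof.
move=> CUy; have [Uy /= t0] := CUy; have tn := lt0r_neq0 t0.
rewrite cone_two_formE cone_endoE //=.
have [_ wr] := (multilinear2P _).1 (w1_lin Uy).
have al := form1D (al_lin Uy); have aN := form1N (al_lin Uy); have aZ := form1Z (al_lin Uy).
rewrite [J _ _ - _]addrC -scaleNr wr w1_xi // w1_J // al aZ alpha_J // alpha_xi //.
by field.
Qed.

Lemma cone_compatible y : CU y ->
  (forall u v, cone_two_form y [tuple u; cone_endo y v] =
               cone_two_form y [tuple v; cone_endo y u]) /\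
  (forall u, u != 0 -> 0 < cone_two_form y [tuple u; cone_endo y u]).
Proof.
move=> CUy; have [Uy /= t0] := CUy; split=> [u v|u u0].
  by rewrite !cone_metric // g_sym // [u.2 * _]mulrC.
rewrite cone_metric //; have t2 : 0 < y.2 ^+ 2 by rewrite exprn_gt0.
(* A radial vector has no g-length, and its dt-length is positive. *)
have [u10|u1n] := eqVneq u.1 0; last first.
  by rewrite ltr_wpDr // ?mulr_gt0 ?g_pos // -expr2 sqr_ge0.
have u2n : u.2 != 0.
  by apply: contra_neq u0 => u20; rewrite [u]surjective_pairing u10 u20.
have [wl _] := (multilinear2P _).1 (w1_lin Uy).
have -> : g y.1 [tuple u.1; u.1] = 0.
  have w00 v : w1 y.1 [tuple 0; v] = 0.
    by have := wl 1 0 0 v; rewrite scaler0 addr0 mul1r => /eqP; rewrite -subr_eq subrr eq_sym => /eqP.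
  have := w1_J u.1 u.1 Uy; rewrite u10 w00 (form10 (al_lin Uy)) mulr0 subr0 => <-.
  by [].
by rewrite mulr0 add0r -expr2 exprn_even_gt0.
Qed.

Hypothesis g_linear : forall x u v w c, U x ->
  g x [tuple u; c *: v + w] = c * g x [tuple u; v] + g x [tuple u; w].
Hypothesis g_J : forall x u v, U x -> g x [tuple J x u; v] = - g x [tuple u; J x v].
Hypothesis g_xi : forall x u, U x -> g x [tuple u; xi x] = alpha x [tuple u].
Hypothesis G_sym : forall x u v, U x -> G x u v = G x v u.
Hypothesis GD : forall x u v w, U x -> G x u (v + w) = G x u v + G x u w.
Hypothesis GZ : forall x u c w, U x -> G x u (c *: w) = c *: G x u w.
Hypothesis D_xi : forall x u, U x -> 'D_u xi x = - G x u (xi x) - J x u.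
Hypothesis D_alpha : forall x u v, U x -> 'D_u (fun y => alpha y [tuple v]) x =
  alpha x [tuple G x u v] - g x [tuple J x u; v].
Hypothesis D_J : forall x u v, U x -> 'D_u (fun y => J y v) x =
  J x (G x u v) - G x u (J x v) - alpha x [tuple v] *: u + g x [tuple u; v] *: xi x.

(** The Levi-Civita connection of the cone metric t^2 g + dt^2. *)
Definition cone_gamma (y p q : E * R) : E * R :=
  (G y.1 p.1 q.1 + (p.2 / y.2) *: q.1 + (q.2 / y.2) *: p.1,
   - (y.2 * g y.1 [tuple p.1; q.1])).

(** The complex structure of the cone is parallel: its components along J_1, xi
and alpha are differentiated by D_J, D_xi and D_alpha, and the error terms
g(u, v) xi - alpha(v) u, - J_1 u and - g(J_1 u, v) are compensated by the terms
of cone_gamma that mix the base and the radial direction. *)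
Lemma derive_cone_endo y p q : CU y -> 'D_p (fun y => cone_endo y q) y =
  cone_endo y (cone_gamma y p q) - cone_gamma y p (cone_endo y q).
Proof.
move=> CUy; have [Uy /= t0] := CUy; have tn := lt0r_neq0 t0.
have [_ sJ] := s_J.
have sJ1 := @smooth_fst _ _ _ _ U [set t : R | 0 < t] (fun x => J x q.1) (sJ q.1).
have sxi1 := @smooth_fst _ _ _ _ U [set t : R | 0 < t] xi s_xi.
have sal1 := @smooth_fst _ _ _ _ U [set t : R | 0 < t]
  (fun x => alpha x [tuple q.1]) (smooth_alpha q.1).
have tU z : CU z -> z.2 != 0 by move=> [_ /= z0]; exact: lt0r_neq0.
have si := smooth_inv oCU tU smooth_t.
have sq := smooth_mul oCU (smooth_cst (q.2 : R) oCU) si.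
have sqx := smooth_scale oCU sq sxi1.
rewrite (@derive_eq_on _ _ _ CU _ (fun y : E * R =>
  (J y.1 q.1 - (q.2 * y.2^-1) *: xi y.1, alpha y.1 [tuple q.1] * y.2)) _ _ oCU _ CUy);
  last by move=> z CUz; rewrite cone_endoE.
rewrite (derive_pair_on _ (smooth_sub oCU sJ1 sqx) (smooth_mul oCU sal1 smooth_t) CUy).
rewrite (deriveB_on _ sJ1 sqx CUy) (deriveM_on _ sal1 smooth_t CUy) derive_snd.
have [_ ->] := is_derive_scale (smooth_derivable (v := p) sq CUy)
  (smooth_derivable (v := p) sxi1 CUy).
rewrite (deriveM_on _ (smooth_cst (q.2 : R) oCU) si CUy) derive_cst mul0r add0r.
have -> : 'D_p (fun x : E * R => x.2^-1) y = - (y.2 ^- 2 * p.2).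
  have dt := smooth_derivable (v := p) smooth_t CUy.
  by rewrite (deriveV tn dt) derive_snd scaleNr.
rewrite (derive_fst (fun x => J x q.1)) (derive_fst xi).
rewrite (derive_fst (fun x => alpha x [tuple q.1])) D_J // D_xi // D_alpha //.
rewrite !cone_endoE // /cone_gamma /=.
have al := form1D (al_lin Uy); have aZ := form1Z (al_lin Uy).
rewrite !JD // !JZ // !al !aZ.
rewrite [J y.1 q.1 - _]addrC -(scaleNr (q.2 / y.2) (xi y.1)) GD // GZ // g_linear // g_xi // g_J //.
move: (y.2) tn => t tn; move: (g y.1 [tuple p.1; q.1]) (g y.1 [tuple p.1; J y.1 q.1]).
move: (alpha y.1 [tuple q.1]) (alpha y.1 [tuple p.1])
  (alpha y.1 [tuple G y.1 p.1 q.1]) => aq ap aG gpq gpJ.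
congr (_, _); last by rewrite /=; field.
by apply/rowP => k; rewrite !mxE; field.
Qed.

Lemma cone_nijenhuis y u v : CU y -> nijenhuis cone_endo y u v = 0.
Proof.
move=> CUy; have [Uy _] := CUy; apply: (@nijenhuis_torsion_free _ _ _ (cone_gamma y)).
- move=> p q; rewrite /cone_gamma G_sym // g_sym //.
  by rewrite addrAC.
- move=> p q; have := cone_endo_linear CUy (-1) q p.
  by rewrite !scaleN1r addrC [X in _ = X]addrC.
- by move=> p q; exact: derive_cone_endo.
Qed.

End Cone.

(** * From adapted coframes to the manifold *)

Section LocalStructure.
Variable R : realType.
Local Notation E := 'rV[R]_5.
Variables (U : set E) (alpha : tensor E 1) (w1 w2 w3 g : tensor E 2).
Variables (xi : E -> E) (J : E -> E -> E).
Hypothesis oU : open U.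
Hypothesis s_alpha : smooth_form_on U alpha.
Hypothesis s_w1 : smooth_form_on U w1.
Hypothesis s_xi : smooth_on U xi.
Hypothesis s_J : smooth_endo_on U J.
Hypothesis d_alpha : forall x u v, U x ->
  extd alpha x [tuple u; v] = - 2 * w1 x [tuple u; v].
Hypothesis d_alpha_w2 : forall x u v w z, U x ->
  extd (wedge alpha w2) x [tuple u; v; w; z] = 0.
Hypothesis d_alpha_w3 : forall x u v w z, U x ->
  extd (wedge alpha w3) x [tuple u; v; w; z] = 0.
Hypothesis alpha_xi : forall x, U x -> alpha x [tuple xi x] = 1.
Hypothesis xi_w1 : forall x u, U x -> w1 x [tuple xi x; u] = 0.
Hypothesis J_xi : forall x, U x -> J x (xi x) = 0.
Hypothesis J_hor : forall x v, U x -> alpha x [tuple v] = 0 -> alpha x [tuple J x v] = 0.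
Hypothesis J_w1 : forall x u v, U x -> alpha x [tuple u] = 0 -> alpha x [tuple v] = 0 ->
  w1 x [tuple u; J x v] = g x [tuple u; v] - alpha x [tuple u] * alpha x [tuple v].
Hypothesis ric4 : forall x, U x -> ricci g x (xi x) (xi x) = 4.

Definition adapted_frame (V : set E) (e1 e2 e3 e4 e5 : tensor E 1) :=
  [/\ smooth_form_on V e1, smooth_form_on V e2, smooth_form_on V e3,
      smooth_form_on V e4 & smooth_form_on V e5] /\
  (forall x, V x -> forall u : E,
    e1 x [tuple u] = 0 -> e2 x [tuple u] = 0 -> e3 x [tuple u] = 0 ->
    e4 x [tuple u] = 0 -> e5 x [tuple u] = 0 -> u = 0) /\
  [/\ eq_on V alpha e5,
      eq_on V w1 (wedge e1 e2 + wedge e3 e4),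
      eq_on V w2 (wedge e1 e3 - wedge e2 e4) &
      eq_on V w3 (wedge e1 e4 + wedge e2 e3)].

Hypothesis frames : forall x, U x -> exists V e1 e2 e3 e4 e5,
    [/\ open V, V x, V `<=` U, adapted_frame V e1 e2 e3 e4 e5 &
        eq_on V g (otimes e1 e1 + otimes e2 e2 + otimes e3 e3 +
                   otimes e4 e4 + otimes e5 e5)].

(** What an adapted coframe proves without mentioning it in the conclusion: the
algebraic identities of an almost contact metric structure, the covariant
derivatives of xi, alpha and J_1, and the Ricci tensor.  Coframes exist only
locally, but these conclusions hold at every point of the chart and can
therefore be used on the whole chart and its cone. *)
Record sasaki_einstein_at (x : E) : Prop := SasakiEinsteinAt {
  at_alpha_J : forall u, alpha x [tuple J x u] = 0;
  at_J_J : forall u, J x (J x u) = - u + alpha x [tuple u] *: xi x;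
  at_w1_xi : forall u, w1 x [tuple u; xi x] = 0;
  at_w1_J : forall u v,
    w1 x [tuple u; J x v] = g x [tuple u; v] - alpha x [tuple u] * alpha x [tuple v];
  at_g_sym : forall u v, g x [tuple u; v] = g x [tuple v; u];
  at_g_pos : forall u, u != 0 -> 0 < g x [tuple u; u];
  at_g_linear : forall u v w c,
    g x [tuple u; c *: v + w] = c * g x [tuple u; v] + g x [tuple u; w];
  at_g_J : forall u v, g x [tuple J x u; v] = - g x [tuple u; J x v];
  at_g_xi : forall u, g x [tuple u; xi x] = alpha x [tuple u];
  at_gamma_sym : forall u v, gamma g x u v = gamma g x v u;
  at_D_xi : forall u, 'D_u xi x = - gamma g x u (xi x) - J x u;
  at_D_alpha : forall u v, 'D_u (fun y => alpha y [tuple v]) x =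
    alpha x [tuple gamma g x u v] - g x [tuple J x u; v];
  at_D_J : forall u v, 'D_u (fun y => J y v) x =
    J x (gamma g x u v) - gamma g x u (J x v) - alpha x [tuple v] *: u
    + g x [tuple u; v] *: xi x;
  at_ricci : exists k, (forall u w, ricci g x u w =
      k * (g x [tuple u; w] - alpha x [tuple u] * alpha x [tuple w]) +
      4 * (alpha x [tuple u] * alpha x [tuple w])) /\
    exists f : 'I_4 -> E,
      [/\ (forall i, alpha x [tuple f i] = 0),
          (forall i j, g x [tuple f i; f j] - alpha x [tuple f i] * alpha x [tuple f j] =
                   (i == j)%:R) &
          \sum_i ricci g x (f i) (f i) = 4 * k]
}.

Lemma sub_smooth_tensor (V : set E) k (T : tensor E k) :
  V `<=` U -> smooth_tensor_on U T -> smooth_tensor_on V T.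
Proof.
by move=> VU [mT sT]; split=> [x /VU|v s x /VU]; [exact: mT|exact: sT].
Qed.

(** Near x, use the coframe e1, e2, e3, e4, alpha: replacing e5 by alpha changes
no value near x, and alpha is smooth on the whole chart. *)
Lemma local_structure x : U x -> sasaki_einstein_at x.
Proof.
move=> Ux; have [V [e1 [e2 [e3 [e4 [e5 [oV Vx VU]]]]]]] := frames Ux.
move=> [[s1 s2 s3 s4 _] [free [al5 w1E w2E w3E]]] gE.
(* The default value of nth supplies the entry alpha at index 4. *)
pose e (a : 'I_5) : tensor E 1 := nth alpha [:: e1; e2; e3; e4] a.
have se a : smooth_tensor_on V (e a).
  elim/ord5_ind: a; rewrite /e /=; [by case: s1|by case: s2|by case: s3|by case: s4|].
  by apply: sub_smooth_tensor => //; case: s_alpha.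
have free_e y : V y -> forall u, (forall a, e a y [tuple u] = 0) -> u = 0.
  move=> Vy u H; apply: (free y Vy u (H i0) (H i1) (H i2) (H i3)).
  by rewrite -al5 //; exact: (H i4).
have gE' y u w : V y -> g y [tuple u; w] = \sum_a e a y [tuple u] * e a y [tuple w].
  by move=> Vy; rewrite gE // sum5 /e /= al5 // -!otimes11.
have c1 : has_coeffs V e w1 (W1 R).
  move=> y u v Vy; rewrite w1E // !sum5 /W1 /e /=.
  rewrite -[LHS]/(wedge e1 e2 y [tuple u; v] + wedge e3 e4 y [tuple u; v]) !wedge11.
  move: (e1 y _) (e2 y _) (e3 y _) (e4 y _) (alpha y _) (e1 y [tuple v])
    (e2 y [tuple v]) (e3 y [tuple v]) (e4 y [tuple v]) (alpha y [tuple v]) => *; ring.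
have c2 : has_coeffs V e w2 (W2 R).
  move=> y u v Vy; rewrite w2E // !sum5 /W2 /e /=.
  rewrite -[LHS]/(wedge e1 e3 y [tuple u; v] - wedge e2 e4 y [tuple u; v]) !wedge11.
  move: (e1 y _) (e2 y _) (e3 y _) (e4 y _) (alpha y _) (e1 y [tuple v])
    (e2 y [tuple v]) (e3 y [tuple v]) (e4 y [tuple v]) (alpha y [tuple v]) => *; ring.
have c3 : has_coeffs V e w3 (W3 R).
  move=> y u v Vy; rewrite w3E // !sum5 /W3 /e /=.
  rewrite -[LHS]/(wedge e1 e4 y [tuple u; v] + wedge e2 e3 y [tuple u; v]) !wedge11.
  move: (e1 y _) (e2 y _) (e3 y _) (e4 y _) (alpha y _) (e1 y [tuple v])
    (e2 y [tuple v]) (e3 y [tuple v]) (e4 y [tuple v]) (alpha y [tuple v]) => *; ring.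
have da y u v : V y -> extd (e i4) y [tuple u; v] = - 2 * w1 y [tuple u; v].
  by move=> /VU; exact: d_alpha.
have dw1 y u v w : V y -> extd w1 y [tuple u; v; w] = 0.
  move=> /VU Uy; have sa p : smooth_on U (fun x => alpha x p) by have [[_ +] _] := s_alpha; apply.
  have n2 : -2 != 0 :> R by rewrite oppr_eq0 pnatr_eq0.
  exact: (closed_of_exact u v w oU sa n2 d_alpha Uy).
have daw2 y u v w z : V y -> extd (wedge (e i4) w2) y [tuple u; v; w; z] = 0.
  by move=> /VU; exact: d_alpha_w2.
have daw3 y u v w z : V y -> extd (wedge (e i4) w3) y [tuple u; v; w; z] = 0.
  by move=> /VU; exact: d_alpha_w3.
have xiE y : V y -> xi y = frame_vec e i4 y.
  move=> Vy; apply: (reeb_frame se free_e c1 Vy).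
    by rewrite -[e i4]/alpha alpha_xi //; exact: VU.
  by move=> v; rewrite xi_w1 //; exact: VU.
have ric y : V y -> ricci g y (frame_vec e i4 y) (frame_vec e i4 y) = 4.
  by move=> Vy; rewrite -xiE // ric4 //; exact: VU.
have JE y v a : V y -> e a y [tuple J y v] = - \sum_b W1 R a b * e b y [tuple v].
  move=> Vy; have Uy := VU y Vy.
  apply: (transverse_J_frame se free_e gE' c1 Vy).
  - by move=> c u w; have [+ _] := s_J; apply.
  - by rewrite -xiE // J_xi.
  - by move=> w; exact: J_hor.
  - by move=> u w; exact: J_w1.
have sxiV : smooth_on V xi by move=> s y /VU; exact: s_xi.
have sJV v : smooth_on V (fun y => J y v).
  by have [_ sJ] := s_J; move=> s y /VU; exact: sJ.
split.
- by move=> u; exact: (alpha_J JE).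
- by move=> u; exact: (J_J se free_e xiE JE).
- by move=> u; exact: (w1_xi se free_e c1 xiE).
- by move=> u v; exact: (w1_J gE' c1 JE).
- by move=> u v; exact: (g_sym gE').
- by move=> u; exact: (g_pos free_e gE').
- by move=> u v w c; exact: (g_linear se gE').
- by move=> u v; exact: (g_J gE' JE).
- by move=> u; exact: (g_xi se free_e gE' xiE).
- by move=> u v; exact: (gamma_sym oV gE').
- by move=> u; exact: (derive_xi oV se free_e gE' c1 da dw1 ric sxiV xiE JE).
- by move=> u v; exact: (derive_alpha oV se free_e gE' c1 da dw1 ric JE).
- by move=> u v; exact: (derive_J oV se free_e gE' c1 c2 c3 da dw1 daw2 daw3 ric xiE sJV JE).
- exists (2 - 2 * (conn_fun (coframe_mx e) g i0 i1 i4 x + conn_fun (coframe_mx e) g i2 i3 i4 x)).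
  split; first by move=> u w; exact: (ricci_adapted_form oV se free_e gE' c1 c2 c3 da dw1 daw2 daw3 ric).
  exact: (transverse_trace oV se free_e gE' c1 c2 c3 da dw1 daw2 daw3 ric).
Qed.

End LocalStructure.

Theorem proposition3p6 (R : realType) (M : topologicalType)
  (A : manifold 'rV[R]_5 M)
  (alpha : tensor_field 'rV[R]_5 M 1)
  (w1 w2 w3 : tensor_field 'rV[R]_5 M 2)
  (g : tensor_field 'rV[R]_5 M 2)
  (xi : vector_field 'rV[R]_5 M)
  (J1 : endo_field 'rV[R]_5 M)
  (hSU2 : SU2_structure A alpha w1 w2 w3)
  (hg : induced_metric A alpha w1 w2 w3 g)
  (hxi : reeb_field A alpha w1 xi)
  (hJ1 : transverse_J1 A alpha w1 g xi J1)
  (hypo : contact_hypo A alpha w1 w2 w3)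
  (hRic : forall c x, atlas A c -> cimg c x ->
    ricci (g c) x (xi c x) (xi c x) = 4) :
  sasakian A alpha w1 xi J1 /\ alpha_einstein A alpha g xi.
Proof.
have [[fal fw1 _ _] _] := hSU2; have [[sxi _] xiP] := hxi; have [[sJ1 _] J1P] := hJ1.
have H c : atlas A c -> [/\ open (cimg c), smooth_form_on (cimg c) (alpha c),
    smooth_form_on (cimg c) (w1 c), smooth_on (cimg c) (xi c) &
    smooth_endo_on (cimg c) (J1 c)] /\
    [/\ forall x u v, cimg c x -> extd (alpha c) x [tuple u; v] = - 2 * w1 c x [tuple u; v],
     forall x, cimg c x -> alpha c x [tuple xi c x] = 1,
     forall x, cimg c x -> J1 c x (xi c x) = 0 &
     forall x, cimg c x -> sasaki_einstein_at (alpha c) (w1 c) (g c) (xi c) (J1 c) x].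
  move=> Ac.
  have oU : open (cimg c) by exact: cimg_open.
  have sal : smooth_form_on (cimg c) (alpha c) by apply: fal.1.
  have sw1 : smooth_form_on (cimg c) (w1 c) by apply: fw1.1.
  have [d1 d2 d3] := hypo c Ac.
  have da x u v : cimg c x -> extd (alpha c) x [tuple u; v] = - 2 * w1 c x [tuple u; v].
    by move=> Ux; rewrite d1.
  have da2 x u v w z : cimg c x -> extd (wedge (alpha c) (w2 c)) x [tuple u; v; w; z] = 0.
    by move=> Ux; rewrite d2.
  have da3 x u v w z : cimg c x -> extd (wedge (alpha c) (w3 c)) x [tuple u; v; w; z] = 0.
    by move=> Ux; rewrite d3.
  have axi x : cimg c x -> alpha c x [tuple xi c x] = 1 by move=> Ux; have [] := xiP c x Ac Ux.
  have wxi x u : cimg c x -> w1 c x [tuple xi c x; u] = 0.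
    by move=> Ux; have [_] := xiP c x Ac Ux; apply.
  have Jxi x : cimg c x -> J1 c x (xi c x) = 0 by move=> Ux; have [] := J1P c x Ac Ux.
  split=> //; first by split=> //; [exact: sxi|exact: sJ1].
  split=> // x Ux.
  apply: (@local_structure R (cimg c) (alpha c) (w1 c) (w2 c) (w3 c)) => //.
  - exact: sxi.
  - exact: sJ1.
  - by move=> y v Uy; have [_ + _] := J1P c y Ac Uy; apply.
  - move=> y u v Uy au av; have [_ _ ->] := J1P c y Ac Uy => //.
    rewrite /transverse_metric -otimes11 //.
  - by move=> y Uy; exact: hRic.
  - move=> y Uy; exact: hg.
split=> [c Ac|c x Ac Ux]; last first.
  have [_ [_ _ _ /(_ x Ux) /at_ricci [k [rk [f [f1 f2 f3]]]]]] := H c Ac.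
  (* The horizontal trace of k g^T is 4 k. *)
  exists (4 * k).
    exists f; split; [exact: f1| |by rewrite f3].
    by move=> i j; rewrite -f2 /transverse_metric -otimes11.
  move=> mu X Y; rewrite /mu rk hRic //.
  have -> : transverse_metric alpha g c x [tuple X; Y] =
      g c x [tuple X; Y] - alpha c x [tuple X] * alpha c x [tuple Y].
    by rewrite /transverse_metric -otimes11.
  by rewrite otimes11 [4 * k]mulrC mulfK // pnatr_eq0.
have [[oU sal sw1 sxic sJ] [da axi Jxi P]] := H c Ac.
have P_alphaJ x u Ux := at_alpha_J (P x Ux) u.
have P_JJ x u Ux := at_J_J (P x Ux) u.
split.
- split; first exact: (smooth_cone_form oU sal sw1).
  exact: (smooth_cone_endo oU sal sxic sJ Jxi).
- move=> y Cy; apply/funext => v; have [p [q [r ->]]] := tuple3_eta v.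
  exact: (cone_form_closed oU sal sw1 da p q r Cy).
- move=> y Cy u.
  exact: (cone_endo_square sal sJ axi Jxi P_alphaJ P_JJ u Cy).
- move=> y Cy u w.
  apply: (@cone_nijenhuis R (cimg c) (alpha c) (g c) (xi c) (J1 c)
    (fun x => gamma (g c) x) oU sal sxic sJ Jxi) => //.
  + by move=> x p q Ux; exact: (at_g_sym (P x Ux)).
  + by move=> x p q z k Ux; exact: (at_g_linear (P x Ux)).
  + by move=> x p q Ux; exact: (at_g_J (P x Ux)).
  + by move=> x p Ux; exact: (at_g_xi (P x Ux)).
  + by move=> x p q Ux; exact: (at_gamma_sym (P x Ux)).
  + move=> x p q z Ux; have s := at_gamma_sym (P x Ux).
    by rewrite s gammaDl s [in X in _ + X]s.
  + move=> x p k z Ux; have s := at_gamma_sym (P x Ux).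
    by rewrite s gammaZl s.
  + by move=> x p Ux; exact: (at_D_xi (P x Ux)).
  + by move=> x p q Ux; exact: (at_D_alpha (P x Ux)).
  + by move=> x p q Ux; exact: (at_D_J (P x Ux)).
- move=> y Cy.
  apply: (cone_compatible sal sw1 sJ axi Jxi P_alphaJ (g := g c)) => //.
  + by move=> x p Ux; exact: (at_w1_xi (P x Ux)).
  + by move=> x p q Ux; exact: (at_w1_J (P x Ux)).
  + by move=> x p q Ux; exact: (at_g_sym (P x Ux)).
  + by move=> x p Ux; exact: (at_g_pos (P x Ux)).
Qed.
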